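(* Suppose that an equation $\mathcal L$: $L=0$ (with $L$ a differential function of order $r>1$ in two independent variables $x=(x_1,x_2)$ and one dependent variable $u$) possesses a first co-order singular set $S=\{Q^\zeta\}$ of vector fields in reduced form $Q^\zeta=\xi\partial_1+\partial_2+\zeta\partial_u$, where $\xi=\xi(x,u)$ is fixed and $\zeta$ runs through all smooth functions of $(x,u)$. Then the determining equation \[ \zeta_1+\zeta_uG^\zeta-(\xi_1+\xi_uG^\zeta)G^\zeta=\xi G^\zeta_1+G^\zeta_2+\zeta G^\zeta_u \] for values of $\zeta$ corresponding to first co-order singular reduction operators of $\mathcal L$ is reduced, by the composition of the Bäcklund transformation \[ \xi\Phi_1+\Phi_2+\zeta\Phi_u=0,\qquad \Phi_1+G^\zeta\Phi_u=0, \] where $\Phi$ is a function of $(x,u)$, and the hodograph transformation with new independent variables $\tilde x_1=x_1$, $\tilde x_2=x_2$, $\varkappa=\Phi$ and new dependent variable $\tilde u=u$, to the initial equation $\mathcal L$ for the function $\tilde u=\tilde u(\tilde x,\varkappa)$ with $\varkappa$ playing the role of a parameter.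
   Context: All considerations are local; functions are smooth. Subscripts $1,2,u$ denote partial derivatives; $\partial_i=\partial/\partial x_i$. $J^r$ is the jet space with coordinates $x$ and $u_\alpha$, $\alpha=(\alpha_1,\alpha_2)$, $|\alpha|\le r$; $D_1,D_2$ are the total derivatives. A differential function of order $r$ is a smooth function on (a subset of) $J^r$ involving derivatives of maximal order $r$; the zero function has order $-1$. For a vector field $Q=\xi^1\partial_1+\xi^2\partial_2+\eta\partial_u$ (coefficients functions of $(x,u)$, $(\xi^1,\xi^2)\ne(0,0)$) put $Q[u]=\eta-\xi^1u_1-\xi^2u_2$ and $\mathcal Q_{(r)}=\{D_1^{a}D_2^{b}Q[u]=0,\ a+b<r\}\subset J^r$. Singularity co-order of $Q$ for $L$ (order $r$): the minimal order $k$ of differential functions $\tilde L$ with $L|_{\mathcal Q_{(r)}}=\tilde L|_{\mathcal Q_{(r)}}$. $Q$ is singular for $L$ if $k<r$. A set of vector fields is first co-order singular for $L$ if all its elements are singular for $L$ and the maximum of their singularity co-orders is $1$. $Q$ is a reduction operator of $\mathcal L$ if the $r$th prolongation of $Q$ applied to $L$ vanishes on $\{L=0\}\cap\mathcal Q_{(r)}$. For $S$ as in the claim, eliminating derivatives that involve $x_2$-differentiation on $\mathcal Q^\zeta_{(r)}$ gives a differential function $\tilde L^\zeta$ depending only on $x,u,u_1$ with $L|_{\mathcal Q^\zeta_{(r)}}=\tilde L^\zeta|_{\mathcal Q^\zeta_{(r)}}$. The determining equation concerns those $\zeta$ with $\tilde L^\zeta_{u_1}\ne0$ (singularity co-order $1$;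 maximal rank with respect to $u_1$ is a standing assumption), and $u_1=G^\zeta(x,u)$ denotes the equation $\tilde L^\zeta=0$ solved with respect to $u_1$; $G^\zeta$ depends on $\zeta$ and its derivatives up to order $r-1$. Meaning of ''is reduced to'': (a) for every solution $\zeta$ of the determining equation with $\tilde L^\zeta_{u_1}\neq0$, the two linear equations for $\Phi$ are compatible, every nonconstant solution $\Phi$ (locally, $d\Phi\ne0$) has $\Phi_u\neq0$, and the function $\tilde u(\tilde x,\varkappa)$ obtained by solving $\varkappa=\Phi(x,u)$ for $u$ satisfies $\mathcal L$ for each value of $\varkappa$, with $\tilde u_\varkappa\ne0$; (b) conversely, for a one-parametric family $u=f(x,\varkappa)$, $f_\varkappa\ne0$, of solutions of $\mathcal L$, let $\varkappa=\Phi(x,u)$ be the result of solving $u=f(x,\varkappa)$ for $\varkappa$; then $\zeta=-(\xi\Phi_1+\Phi_2)/\Phi_u$ satisfies the determining equation provided that $\tilde L^\zeta_{u_1}\ne0$. Without loss of generality (up to point transformations) the paper takes $\xi\in\{0,u\}$. *)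

(* Defs.v *)
From HB Require Import structures.
From mathcomp Require Export all_boot all_order all_algebra.
From mathcomp Require Export all_classical all_reals all_analysis.

Set Implicit Arguments.
Unset Strict Implicit.
Unset Printing Implicit Defensive.

Import Order.TTheory GRing.Theory Num.Theory.
Import numFieldNormedType.Exports.

Local Open Scope classical_set_scope.
Local Open Scope ring_scope.

Section Smooth.
Context {R : realType} {V : normedModType R}.

Fixpoint Cn (n : nat) (U : set V) (f : V -> R) : Prop :=
  match n with
  | 0 => forall p, U p -> {for p, continuous f}
  | n'.+1 => (forall p, U p -> differentiable f p) /\
             (forall v : V, Cn n' U ('D_v f))
  end.

(* C^oo; used with [U] open only, so that the values of [f] outside [U] are
   irrelevant: a function defined on [U] is encoded by any total extension. *)
Definition smooth_on (U : set V) (f : V -> R) : Prop := forall n, Cn n U f.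

End Smooth.

Section Jets.
Context {R : realType}.

(* Points (x1, x2, u); also used for (x1, x2, kappa). *)
Definition base : Type := (R * R * R)%type.

Definition pd1 (f : base -> R) : base -> R := 'D_((1, 0, 0) : base) f.
Definition pd2 (f : base -> R) : base -> R := 'D_((0, 1, 0) : base) f.
Definition pd3 (f : base -> R) : base -> R := 'D_((0, 0, 1) : base) f.

(* Multi-indices alpha = (alpha_1, alpha_2) with |alpha| <= n. *)
Definition mindex (n : nat) : Type :=
  {ab : 'I_n.+1 * 'I_n.+1 | (ab.1 + ab.2 <= n)%N}.

(* J^n: the point x and the coordinates u_alpha, |alpha| <= n, listed along
   the enumeration of the multi-indices. *)
Definition jet (n : nat) : Type := ((R * R) * 'rV[R]_#|{: mindex n}|)%type.

Definition mkjet (n : nat) (x : R * R) (c : nat -> nat -> R) : jet n :=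
  (x, \row_i c (val (enum_val i : mindex n)).1 (val (enum_val i : mindex n)).2).

(* The coordinate u_(a,b) of a jet; 0 by convention when a + b > n. *)
Definition ucoord (n : nat) (j : jet n) (a b : nat) : R :=
  if [pick m : mindex n | ((val m).1 == a :> nat) && ((val m).2 == b :> nat)]
  is Some m then j.2 0 (enum_rank m) else 0.

(* The projection J^n -> J^m; only used for m <= n. *)
Definition jproj (n m : nat) (j : jet n) : jet m := mkjet m j.1 (ucoord j).

Definition jbase (n : nat) (j : jet n) : base := (j.1, ucoord j 0 0).

Definition jet_of (n : nat) (g : R * R -> R) (x : R * R) : jet n :=
  mkjet n x (fun a b =>
    iter a (fun h : R * R -> R => 'D_((1, 0) : R * R) h)
      (iter b (fun h : R * R -> R => 'D_((0, 1) : R * R) h) g) x).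

Definition pdu (n : nat) (F : jet n -> R) (m : mindex n) : jet n -> R :=
  'D_((0, delta_mx 0 (enum_rank m)) : jet n) F.

Definition Dtot1 (n : nat) (F : jet n -> R) (j : jet n.+1) : R :=
  'D_(((1, 0), 0) : jet n) F (jproj n j) +
  \sum_(m : mindex n) ucoord j (val m).1.+1 (val m).2 * pdu F m (jproj n j).

Definition Dtot2 (n : nat) (F : jet n -> R) (j : jet n.+1) : R :=
  'D_(((0, 1), 0) : jet n) F (jproj n j) +
  \sum_(m : mindex n) ucoord j (val m).1 (val m).2.+1 * pdu F m (jproj n j).

Fixpoint iterD1 (a n : nat) (F : jet n -> R) : jet (a + n) -> R :=
  match a return jet (a + n) -> R with
  | 0 => F
  | a'.+1 => Dtot1 (@iterD1 a' n F)
  end.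

Fixpoint iterD2 (b n : nat) (F : jet n -> R) : jet (b + n) -> R :=
  match b return jet (b + n) -> R with
  | 0 => F
  | b'.+1 => Dtot2 (@iterD2 b' n F)
  end.

Arguments iterD1 a {n} F.
Arguments iterD2 b {n} F.

(* [L], defined on [Omega], is a differential function of order [r > 0]: it
   effectively involves some derivative of order [r]. *)
Definition diff_fun_of_order (r : nat) (Omega : set (jet r))
    (L : jet r -> R) : Prop :=
  [/\ open Omega, smooth_on Omega L &
      exists j (m : mindex r),
        [/\ Omega j, ((val m).1 + (val m).2 = r)%N & pdu L m j != 0]].

(* A local vector field xi^1 d_1 + xi^2 d_2 + eta d_u on the domain [vdom]. *)
Record vfield : Type := VField {
  vdom : set base;
  vxi1 : base -> R;
  vxi2 : base -> R;
  veta : base -> R }.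

Definition vfield_wf (Q : vfield) : Prop :=
  [/\ open (vdom Q), smooth_on (vdom Q) (vxi1 Q), smooth_on (vdom Q) (vxi2 Q),
      smooth_on (vdom Q) (veta Q) &
      forall p, vdom Q p -> (vxi1 Q p, vxi2 Q p) != (0, 0)].

Definition charact (Q : vfield) (j : jet 1) : R :=
  veta Q (jbase j) - vxi1 Q (jbase j) * ucoord j 1 0
                   - vxi2 Q (jbase j) * ucoord j 0 1.

Definition Qman (r : nat) (Q : vfield) : set (jet r) :=
  [set j | vdom Q (jbase j) /\
     forall a b, (a + b < r)%N ->
       iterD1 a (iterD2 b (charact Q)) (jproj (a + (b + 1)) j) = 0].

Arguments Qman r Q : clear implicits.

Section CoOrder.
Variables (r : nat) (Omega : set (jet r)) (L : jet r -> R).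

(* On Q_(r), [L] coincides with a differential function of order at most [k];
   the only differential function of order -1 is zero. *)
Definition coincides_order (Q : vfield) (k : int) : Prop :=
  match k with
  | Posz n => exists (V : set (jet n)) (F : jet n -> R),
      [/\ open V, smooth_on V F &
          forall j, Omega j -> Qman r Q j ->
            V (jproj n j) /\ L j = F (jproj n j)]
  | Negz _ => forall j, Omega j -> Qman r Q j -> L j = 0
  end.

Definition sing_coorder (Q : vfield) (k : int) : Prop :=
  [/\ -1 <= k, coincides_order Q k &
      forall m : int, -1 <= m -> coincides_order Q m -> k <= m].

Definition singular (Q : vfield) : Prop :=
  exists2 k : int, sing_coorder Q k & k < r%:Z.

Definition first_coorder_singular (S : set vfield) : Prop :=
  [/\ forall Q, S Q -> vfield_wf Q /\ singular Q,
      forall Q k, S Q -> sing_coorder Q k -> k <= 1 &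
      exists2 Q, S Q & sing_coorder Q 1].

End CoOrder.

Section Reduced.
Variables (xi : base -> R).

Definition Qzeta (U : set base) (zeta : base -> R) : vfield :=
  VField U xi (cst 1) zeta.

(* [zeta] ranges over all smooth functions on all open subsets of the domain
   [Xi] of [xi]. *)
Definition reduced_family (Xi : set base) : set vfield :=
  [set Q | exists U zeta,
     [/\ open U, U `<=` Xi, smooth_on U zeta & Q = Qzeta U zeta]].

(* [lam] is the function of (x, u, u_1) (points [(p, q)], p = (x, u), q = u_1)
   obtained from [L] by elimination on the manifold of Q^zeta. *)
Definition eliminated (r : nat) (Omega : set (jet r)) (L : jet r -> R)
    (U : set base) (zeta : base -> R)
    (V : set (base * R)) (lam : base * R -> R) : Prop :=
  [/\ open V, smooth_on V lam &
      forall j, Omega j -> Qman r (Qzeta U zeta) j ->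
        V (jbase j, ucoord j 1 0) /\ L j = lam (jbase j, ucoord j 1 0)].

(* Inside the region [W] of the (x, u, u_1)-space the equation [lam = 0] is
   solved with respect to u_1 as u_1 = G(x, u); [W] selects the branch.  The
   derivative of [lam] in u_1 is nonzero on this branch. *)
Definition solved_for_u1 (U : set base) (V : set (base * R))
    (lam : base * R -> R) (W : set (base * R)) (G : base -> R) : Prop :=
  [/\ open W, W `<=` V, smooth_on U G,
      forall p, U p -> W (p, G p) /\ 'D_((0, 1) : base * R) lam (p, G p) != 0 &
      forall p q, U p -> W (p, q) -> (lam (p, q) = 0 <-> q = G p)].

Definition determining_eq (U : set base) (zeta G : base -> R) : Prop :=
  forall p, U p ->
    pd1 zeta p + pd3 zeta p * G p - (pd1 xi p + pd3 xi p * G p) * G p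
    = xi p * pd1 G p + pd2 G p + zeta p * pd3 G p.

Definition backlund (N : set base) (zeta G Phi : base -> R) : Prop :=
  forall p, N p ->
    xi p * pd1 Phi p + pd2 Phi p + zeta p * pd3 Phi p = 0 /\
    pd1 Phi p + G p * pd3 Phi p = 0.

End Reduced.

Definition grad_neq0 (N : set base) (Phi : base -> R) : Prop :=
  forall p, N p -> (pd1 Phi p, pd2 Phi p, pd3 Phi p) != (0, 0, 0).

(* [g], on [M], results from solving [t = F (x, s)] for [s = g (x, t)], where
   [F] is considered on [N]. *)
Definition solves_last (N : set base) (F : base -> R)
    (M : set base) (g : base -> R) : Prop :=
  [/\ open M, smooth_on M g &
      forall q, M q -> N (q.1, g q) /\ F (q.1, g q) = q.2].

Definition slice (f : base -> R) (kappa : R) : R * R -> R :=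
  fun x => f (x, kappa).

End Jets.

Arguments base : clear implicits.
Arguments jet : clear implicits.
Arguments vfield : clear implicits.
Arguments iterD1 {R} a {n} F.
Arguments iterD2 {R} b {n} F.
Arguments Qman {R} r Q.

(* Main.v *)
From HB Require Import structures.
From mathcomp Require Import ring lra.
Require Import Defs.
Set Implicit Arguments.
Unset Strict Implicit.
Unset Printing Implicit Defensive.
Import Order.TTheory GRing.Theory Num.Theory.
Import numFieldNormedType.Exports.
Local Open Scope classical_set_scope.
Local Open Scope ring_scope.

(** On the graph of a function invariant under [Q^zeta], [L] reduces to a
    function [lam] of [(x, u, u_1)], so that solving [L = 0] there amounts to
    [u_1 = G].  With [H = zeta - xi G] the determining equation says exactly
    that the overdetermined system [u_1 = G, u_2 = H] is compatible, and the two
    linear equations for [Phi] say that the level sets of [Phi] are graphs of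
    solutions of that system.

    For the existence of [Phi], compatibility lets one solve [u_1 = G, u_2 = H]
    by two successive ordinary differential equations, first along [x_2] and
    then along [x_1]; [Phi] is the initial value as a function of [(x, u)].  The
    flow of a scalar equation [w' = f (t, l, w)] is obtained by Picard iteration
    on a box on which [f] and its first two derivatives in [(l, w)] are bounded.
    Its derivatives in the parameters solve a linear scalar equation, hence have
    closed formulas involving only [exp] and primitives in [t], and smoothness
    follows by induction on the order of differentiability.

    Conversely, if [u = f (x, kappa)] is a family of solutions of [L = 0] with
    inverse [kappa = Phi (x, u)], then [G] and [H] are [f_1] and [f_2] evaluated
    at [(x, Phi)], and compatibility is [f_12 = f_21]. *)

(** * Calculus of functions of class C^n *)

(** The value of [lam] at a point is tied to [L] only through a full [r]-jet above that point which
    lies in [Omega] and satisfies all differential consequences of the invariant surface condition.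
    Such jets come from prolonging graphs, and the condition must then hold on an open set of [x],
    not merely at one point. In the converse direction this requires [Phi] to stay constant along
    each slice of the family, a left-inverse property, whereas solving an equation for its last
    variable directly gives only a right inverse.

    Compatibility enters the construction of [Phi] at a single place: the defect of the second
    equation obeys a homogeneous linear equation along [x_1] with zero initial data.

    As the unknown is scalar, the linearised flow has an explicit integrating factor, so smooth
    dependence rests on one analytic fact: a primitive in one variable of a C^n function of three
    variables is again C^n. [Cn] asks for Frechet differentiability at every order, hence partial
    derivatives obtained from such formulas have to be recombined through the criterion of
    continuous partial derivatives. *)

Section DiffEps.
Context {R : realType} {V : normedModType R}.
Implicit Types (f g : V -> R) (p v : V).

(** Trades the little-o form of differentiability for an epsilon estimate, the form in which
    remainders are bounded by hand below. *)
Lemma differentiable_eps f p (df : {linear V -> R}) : continuous df ->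
  (forall e, 0 < e -> \forall h \near (0 : V),
     `|f (h + p) - f p - df h| <= e * `|h|) ->
  differentiable f p /\ 'd f p = df :> (V -> R).
Proof.
move=> cdf fe.
have E : f \o shift p = cst (f p) + df +o_ (0 : V) id.
  apply/eqaddoP => e e0; have := fe _ e0; apply: filterS => h.
  by rewrite opprD addrA.
have dfE := diff_unique cdf E; split => //.
by apply/diff_locallyP; rewrite dfE.
Qed.

Lemma differentiable_near_eq f g p : (\forall q \near p, f q = g q) ->
  differentiable f p -> differentiable g p.
Proof.
move=> fg df; have /diff_locallyP [cf /eqaddoP fe] := df.
suff [] : differentiable g p /\ 'd g p = 'd f p :> (V -> R) by [].
apply: differentiable_eps => // e e0; have := fe _ e0; apply: filter_app.
have : \forall h \near (0 : V), f (h + p) = g (h + p).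
  move: fg; rewrite (near_shift 0) /=; apply: filterS => h /=.
  by rewrite subr0.
by apply: filterS => h E /=; rewrite -E -(nbhs_singleton fg) opprD addrA.
Qed.

Lemma differentiableMp f g p : differentiable f p -> differentiable g p ->
  differentiable (fun q => f q * g q) p.
Proof. exact: differentiableM. Qed.

Lemma deriveMp f g p v : differentiable f p -> differentiable g p ->
  'D_v (fun q => f q * g q) p = f p * 'D_v g p + g p * 'D_v f p.
Proof.
by move=> /diff_derivable df /diff_derivable dg; rewrite -[LHS]/('D_v (f * g) p) deriveM.
Qed.

Lemma deriveDp f g p v : differentiable f p -> differentiable g p ->
  'D_v (fun q => f q + g q) p = 'D_v f p + 'D_v g p.
Proof.
by move=> /diff_derivable df /diff_derivable dg; rewrite -[LHS]/('D_v (f + g) p) deriveD.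
Qed.

Lemma differentiableVp f p : differentiable f p -> f p != 0 ->
  differentiable (fun q => (f q)^-1) p.
Proof. exact: differentiableV. Qed.

Lemma deriveVp f p v : differentiable f p -> f p != 0 ->
  'D_v (fun q => (f q)^-1) p = - (f p)^-1 ^+ 2 * 'D_v f p.
Proof.
move=> /diff_derivable df f0; rewrite [LHS]deriveV //.
by rewrite exprVn.
Qed.

End DiffEps.

Section CnTheory.
Context {R : realType}.

Section OneSpace.
Context {V : normedModType R}.
Implicit Types (U : set V) (f g : V -> R) (n : nat).

Lemma open_near U p : open U -> U p -> \forall q \near p, U q.
Proof. by move=> oU Up; apply: open_nbhs_nbhs; split. Qed.

Lemma open_near_eq U f g p : open U -> U p -> (forall q, U q -> f q = g q) ->
  \forall q \near p, f q = g q.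
Proof. by move=> oU Up fg; have := open_near oU Up; apply: filterS => q /fg. Qed.

(** Derivatives see only germs. Openness of [U] turns equality on [U] into equality near each of its
    points, so the arbitrary values outside [U] never matter. *)
Lemma Cn_eq n U f g : open U -> (forall p, U p -> f p = g p) ->
  Cn n U f -> Cn n U g.
Proof.
move=> oU; elim: n f g => [|n IH] f g fg.
  move=> cf p Up; have := cf p Up; rewrite /prop_for /continuous_at -(fg _ Up).
  apply: cvg_trans; apply: near_eq_cvg.
  exact: open_near_eq fg.
move=> [df Df]; split.
  move=> p Up; apply: differentiable_near_eq (df p Up).
  exact: open_near_eq fg.
move=> v; apply: IH (Df v) => p Up; apply: near_eq_derive.
exact: open_near_eq fg.
Qed.

Lemma Cn_sub n U U' f : U' `<=` U -> Cn n U f -> Cn n U' f.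
Proof.
move=> sU; elim: n f => [|n IH] f /=; first by move=> cf p /sU; exact: cf.
by move=> [df Df]; split=> [p /sU|v]; [exact: df|exact: IH].
Qed.

Lemma Cn_continuous n U f p : Cn n U f -> U p -> {for p, continuous f}.
Proof.
case: n => [|n] /=; first exact.
by move=> [df _] Up; apply: differentiable_continuous; exact: df.
Qed.

Lemma CnW n U f : Cn n.+1 U f -> Cn n U f.
Proof.
elim: n f => [|n IH] f.
  by move=> cf p Up; apply: Cn_continuous cf Up.
by move=> [df Df]; split => // v; apply: IH; exact: Df.
Qed.

Lemma Cn_differentiable n U f p : Cn n.+1 U f -> U p -> differentiable f p.
Proof. by move=> [df _]; exact: df. Qed.

Lemma Cn_cst n U (a : R) : Cn n U (fun=> a).
Proof.
elim: n a => [|n IH] a /=; first by move=> p Up; exact: cst_continuous.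
split=> [p Up|v]; first exact: differentiable_cst.
rewrite (_ : 'D_v _ = fun=> 0) //; apply/funext => p; exact: derive_cst.
Qed.

Lemma CnD n U f g : open U -> Cn n U f -> Cn n U g ->
  Cn n U (fun p => f p + g p).
Proof.
move=> oU; elim: n f g => [|n IH] f g /=.
  by move=> cf cg p Up; apply: continuousD; [exact: cf|exact: cg].
move=> [df Df] [dg Dg]; split=> [p Up|v].
  by apply: differentiableD; [exact: df|exact: dg].
apply: (Cn_eq _ _ (IH _ _ (Df v) (Dg v))) => // p Up.
by rewrite deriveDp //; [exact: df|exact: dg].
Qed.

Lemma CnM n U f g : open U -> Cn n U f -> Cn n U g ->
  Cn n U (fun p => f p * g p).
Proof.
move=> oU; elim: n f g => [|n IH] f g.
  by move=> cf cg p Up; apply: continuousM; [exact: cf|exact: cg].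
move=> Sf Sg; have [df Df] := Sf; have [dg Dg] := Sg; split=> [p Up|v].
  by apply: differentiableM; [exact: df|exact: dg].
have H := CnD oU (IH _ _ (CnW Sf) (Dg v)) (IH _ _ (CnW Sg) (Df v)).
apply: (Cn_eq _ _ H) => // p Up.
by rewrite deriveMp //; [exact: df|exact: dg].
Qed.

Lemma CnN n U f : open U -> Cn n U f -> Cn n U (fun p => - f p).
Proof.
move=> oU /(CnM oU (Cn_cst n U (-1))); apply: Cn_eq => // p _.
by rewrite mulN1r.
Qed.

Lemma CnB n U f g : open U -> Cn n U f -> Cn n U g ->
  Cn n U (fun p => f p - g p).
Proof. by move=> oU cf cg; exact: CnD oU cf (CnN oU cg). Qed.

Lemma Cn_sum n U (I : Type) (s : seq I) (f : I -> V -> R) : open U ->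
  (forall i, Cn n U (f i)) -> Cn n U (fun p => \sum_(i <- s) f i p).
Proof.
move=> oU cf; elim: s => [|i s IH].
  by apply: Cn_eq (Cn_cst n U 0) => // p _; rewrite big_nil.
by apply: Cn_eq (CnD oU (cf i) IH) => // p _; rewrite big_cons.
Qed.

Lemma CnV n U f : open U -> (forall p, U p -> f p != 0) ->
  Cn n U f -> Cn n U (fun p => (f p)^-1).
Proof.
move=> oU f0; elim: n => [|n IH].
  by move=> cf p Up; apply: continuousV; [exact: f0|exact: cf].
move=> Sf; have [df Df] := Sf; split=> [p Up|v].
  by apply: differentiableVp; [exact: df|exact: f0].
have CV := IH (CnW Sf).
have H := CnN oU (CnM oU (CnM oU CV CV) (Df v)).
apply: (Cn_eq _ _ H) => // p Up.
by rewrite deriveVp ?expr2 ?mulNr //; [exact: df|exact: f0].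
Qed.

Lemma Cn_linear n U (f : {linear V -> R}) : continuous f -> Cn n U f.
Proof.
move=> cf; case: n => [|n]; first by move=> p _; exact: cf.
split=> [p _|v]; first exact: linear_differentiable.
rewrite (_ : 'D_v f = fun=> f v); first exact: Cn_cst.
by apply/funext => p; rewrite deriveE ?diff_lin //; exact: linear_differentiable.
Qed.

End OneSpace.

(** [Cn] speaks of scalar functions only. Writing the inner map as a constant plus a finite
    combination of fixed vectors with scalar coefficients gives the chain rule, and then closure of
    [Cn] under composition, without a notion of smoothness for vector-valued maps. *)
Lemma derive_comp {V W : normedModType R} (I : finType) (e : I -> V)
    (f : V -> R) (phi : W -> V) (g : I -> W -> R) (c : V) (p v : W) :
  (forall q, phi q = c + \sum_i g i q *: e i) ->
  (forall i, differentiable (g i) p) -> differentiable f (phi p) ->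
  differentiable (f \o phi) p /\
  'D_v (f \o phi) p = \sum_i 'D_v (g i) p * 'D_(e i) f (phi p).
Proof.
move=> phiE dg df.
have E : phi = cst c + \sum_i (fun q => g i q *: e i).
  by apply/funext => q; rewrite phiE /= fct_sumE.
have dphi : differentiable phi p.
  rewrite E; apply: differentiableD; first exact: differentiable_cst.
  elim/big_ind : _ => [|x y dx dy|i _].
  - exact: differentiable_cst.
  - exact: differentiableD.
  - exact: differentiableZl.
have Dphi : 'd phi p v = \sum_i 'D_v (g i) p *: e i.
  rewrite -deriveE // E.
  have dgi i : differentiable (fun q => g i q *: e i) p by exact: differentiableZl.
  have ds (s : seq I) : differentiable (\sum_(i <- s) (fun q => g i q *: e i)) p
     /\ 'D_v (\sum_(i <- s) (fun q => g i q *: e i)) p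
        = \sum_(i <- s) 'D_v (g i) p *: e i.
    elim: s => [|i s [IH1 IH2]].
      by rewrite !big_nil; split; [exact: differentiable_cst|exact: derive_cst].
    rewrite !big_cons; split; first exact: differentiableD.
    rewrite deriveD ?IH2; [|exact: diff_derivable..].
    by congr (_ + _); rewrite deriveE // diffZl //= -deriveE.
  have [ds1 ds2] := ds (index_enum I).
  by rewrite deriveD ?ds2 ?derive_cst ?add0r //; apply: diff_derivable.
split; first exact: differentiable_comp.
rewrite deriveE; last exact: differentiable_comp.
rewrite diff_comp //= Dphi linear_sum; apply: eq_bigr => i _.
by rewrite linearZ -deriveE.
Qed.

Lemma Cn_comp {V W : normedModType R} n (I : finType) (e : I -> V)
    (f : V -> R) (phi : W -> V) (g : I -> W -> R) (c : V)
    (U : set V) (U' : set W) :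
  (forall q, phi q = c + \sum_i g i q *: e i) ->
  open U' -> (forall q, U' q -> U (phi q)) ->
  (forall i, Cn n U' (g i)) -> Cn n U f -> Cn n U' (f \o phi).
Proof.
move=> phiE oU' sU; elim: n f => [|n IH] f cg cf.
  move=> p Up; apply: continuous_comp; last exact/cf/sU.
  rewrite (_ : phi = cst c + \sum_i (fun q => g i q *: e i)); last first.
    by apply/funext => q; rewrite phiE /= fct_sumE.
  apply: continuousD; first exact: cst_continuous.
  elim/big_ind : _ => [|x y dx dy|i _].
  - exact: cst_continuous.
  - exact: continuousD.
  - by apply: continuousZl; exact: cg.
have dg i p : U' p -> differentiable (g i) p.
  by move=> Up; have [dgi _] := cg i; exact: dgi.
have [df Df] := cf.
split=> [p Up|v].
  by have [] := derive_comp 0 phiE (fun i => dg i p Up) (df _ (sU _ Up)).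
have H : Cn n U' (fun p => \sum_i 'D_v (g i) p * ('D_(e i) f \o phi) p).
  apply: Cn_sum => // i; apply: CnM => //.
    by have [_ Dgi] := cg i; exact: Dgi.
  by apply: IH (Df _) => j; exact: CnW.
apply: (Cn_eq _ _ H) => // p Up.
by have [_ ->] := derive_comp v phiE (fun i => dg i p Up) (df _ (sU _ Up)).
Qed.

End CnTheory.

Section LinearFun.
Context {R : realType} {V : normedModType R}.

Lemma linear_fun_smooth (f : V -> R) (lf : linear f) (cf : continuous f) :
  [/\ forall p, differentiable f p, forall v p, 'D_v f p = f v &
      forall U, smooth_on U f].
Proof.
pose fM := GRing.isLinear.Build _ _ _ _ _ lf.
pose fL : {linear V -> R} := HB.pack f fM.
have dfL p : differentiable f p by exact: (@linear_differentiable _ _ _ fL).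
split=> // [v p|U n]; last exact: (@Cn_linear _ _ _ _ fL).
by rewrite deriveE // (@diff_lin _ _ _ fL).
Qed.

End LinearFun.

(** * Mean value theorem along lines and symmetry of second derivatives *)

Section Line.
Context {R : realType} {V : normedModType R}.
Implicit Types (f : V -> R) (p v w : V).

Lemma is_derive_line f p v (s : R) : derivable f (s *: v + p) v ->
  is_derive s 1 (fun h => f (h *: v + p)) ('D_v f (s *: v + p)).
Proof.
have E : (fun h : R => h^-1 *: (((fun h => f (h *: v + p)) \o shift s) (h *: 1)
      - f (s *: v + p))) =
    (fun h => h^-1 *: ((f \o shift (s *: v + p)) (h *: v) - f (s *: v + p))).
  apply/funext => h /=; congr (_ *: (f _ - _)).
  by rewrite [h *: 1]mulr1 scalerDl addrA.
by move=> df; split; rewrite /derivable /derive E.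
Qed.

Lemma line_mvt f p v :
  (forall s : R, 0 <= s <= 1 -> derivable f (s *: v + p) v) ->
  exists2 s : R, 0 <= s <= 1 & f (v + p) - f p = 'D_v f (s *: v + p).
Proof.
move=> df.
have dl (s : R) : 0 <= s <= 1 ->
    is_derive s 1 (fun h => f (h *: v + p)) ('D_v f (s *: v + p)).
  by move=> s01; apply: is_derive_line; exact: df.
have dl' (s : R) : s \in `]0, 1[%R ->
    is_derive s 1 (fun h => f (h *: v + p)) ('D_v f (s *: v + p)).
  by rewrite in_itv /= => /andP[x0 x1]; apply: dl; rewrite !ltW.
have cl : {within `[0, 1], continuous (fun h : R => f (h *: v + p))}.
  apply: derivable_within_continuous => x; rewrite in_itv /= => x01.
  by have [] := dl x x01.
have [c] := MVT_segment ler01 dl' cl.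
by rewrite in_itv /= scale1r scale0r add0r subr0 mulr1 => c01 ->; exists c.
Qed.

Lemma deriveZv f p v (a : R) : differentiable f p ->
  'D_(a *: v) f p = a * 'D_v f p.
Proof. by move=> df; rewrite !deriveE // linearZ. Qed.

Lemma deriveDv f p v w : differentiable f p ->
  'D_(v + w) f p = 'D_v f p + 'D_w f p.
Proof. by move=> df; rewrite !deriveE // linearD. Qed.

Lemma is_derive_shiftp f p v w : derivable f (w + p) v ->
  is_derive p v (fun q => f (w + q)) ('D_v f (w + p)).
Proof.
have E : (fun h : R => h^-1 *: (((fun q => f (w + q)) \o shift p) (h *: v)
      - f (w + p))) =
    (fun h => h^-1 *: ((f \o shift (w + p)) (h *: v) - f (w + p))).
  by apply/funext => h /=; rewrite addrCA.
by move=> df; split; rewrite /derivable /derive E.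
Qed.

(** The mean value theorem is applied twice: along [v] to the increment of [f] in the direction [w],
    then along [w] to ['D_v f]. *)
Lemma second_difference f p v w (U : set V) (h : R) : Cn 2 U f ->
  (forall a b : R, 0 <= a <= 1 -> 0 <= b <= 1 ->
     U (a *: (h *: w) + (b *: (h *: v) + p))) ->
  exists a b : R, [/\ 0 <= a <= 1, 0 <= b <= 1 &
    f (h *: w + (h *: v + p)) - f (h *: v + p) - (f (h *: w + p) - f p) =
    h * (h * 'D_w ('D_v f) (a *: (h *: w) + (b *: (h *: v) + p)))].
Proof.
move=> Cf HU; have [df Df] := Cf; have [ddf _] := Df v.
have I0 : 0 <= (0 : R) <= 1 by rewrite lexx ler01.
have I1 : 0 <= (1 : R) <= 1 by rewrite lexx ler01.
have U0 b : 0 <= b <= 1 -> U (b *: (h *: v) + p).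
  by move=> b01; have := HU 0 b I0 b01; rewrite scale0r add0r.
have U1 b : 0 <= b <= 1 -> U (h *: w + (b *: (h *: v) + p)).
  by move=> b01; have := HU 1 b I1 b01; rewrite scale1r.
have [|b b01 Eb] := @line_mvt (fun q => f (h *: w + q) - f q) p (h *: v).
  move=> s s01; apply: derivableB; last exact: diff_derivable (df _ (U0 _ s01)).
  by have [] := is_derive_shiftp (diff_derivable (v := h *: v) (df _ (U1 _ s01))).
have [|a a01 Ea] := @line_mvt ('D_v f) (b *: (h *: v) + p) (h *: w).
  by move=> s s01; exact: diff_derivable (ddf _ (HU _ _ s01 b01)).
exists a, b; split=> //; rewrite Eb.
rewrite deriveB; last 2 first.
  - by have [] := is_derive_shiftp (diff_derivable (v := h *: v) (df _ (U1 _ b01))).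
  - exact: diff_derivable (df _ (U0 _ b01)).
have [_ ->] := is_derive_shiftp (diff_derivable (v := h *: v) (df _ (U1 _ b01))).
rewrite !deriveZv; [|exact: df (U0 _ b01)|exact: df (U1 _ b01)].
by rewrite -mulrBr Ea deriveZv //; exact: ddf (HU _ _ a01 b01).
Qed.

Lemma near_small_line p v w (P : V -> Prop) : (\forall q \near p, P q) ->
  exists2 d : R, 0 < d & forall h a b : R, 0 <= h < d ->
    0 <= a <= 1 -> 0 <= b <= 1 -> P (a *: (h *: w) + (b *: (h *: v) + p)).
Proof.
move=> /nbhs_ballP [e /= e0 eP].
have K0 : 0 < `|v| + `|w| + 1 by rewrite ltr_wpDl // addr_ge0.
exists (e / (`|v| + `|w| + 1)); first exact: divr_gt0.
move=> h a b /andP[h0 hd] /andP[a0 a1] /andP[b0 b1]; apply: eP.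
rewrite -ball_normE /ball_ /= addrA opprD addrCA subrr addr0 normrN.
apply: (@le_lt_trans _ _ (h * (`|w| + `|v|))).
  rewrite (le_trans (ler_normD _ _)) // !normrZ mulrDr lerD //.
    by rewrite !ger0_norm // ler_piMl // mulr_ge0.
  by rewrite !ger0_norm // ler_piMl // mulr_ge0.
move: hd; rewrite ltr_pdivlMr //; apply: le_lt_trans.
by rewrite ler_wpM2l // (addrC `|w|) lerDl ler01.
Qed.

Lemma near_close2 (g1 g2 : V -> R) (U : set V) p (e : R) : open U -> U p ->
  {for p, continuous g1} -> {for p, continuous g2} -> 0 < e ->
  \forall q \near p, U q /\ (`|g1 p - g1 q| < e /\ `|g2 p - g2 q| < e).
Proof.
move=> oU Up c1 c2 e0; have oUp := open_near oU Up.
have N1 : \forall q \near p, `|g1 p - g1 q| < e by move/cvgrPdist_lt: c1; apply.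
have N2 : \forall q \near p, `|g2 p - g2 q| < e by move/cvgrPdist_lt: c2; apply.
by near=> q; split; [near: q|split; near: q].
Unshelve. all: by end_near. Qed.

(** The second difference over a small parallelogram is symmetric in [v] and [w]. Evaluated in both
    orders and divided by [h ^+ 2], it equates the two mixed derivatives at two points near [p];
    their continuity at [p] finishes the argument. *)
Lemma schwarz f p v w (U : set V) : open U -> U p -> Cn 2 U f ->
  'D_v ('D_w f) p = 'D_w ('D_v f) p.
Proof.
move=> oU Up Cf; apply/eqP; rewrite -subr_eq0 -normr_le0.
apply/ler_addgt0Pl => e e0; rewrite addr0.
have [df Df] := Cf.
have [[_ Dw] [_ Dv]] := (Df w, Df v).
have e20 : 0 < e / 2 by exact: divr_gt0.
have N := near_close2 oU Up (Dw v p Up) (Dv w p Up) e20.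
have [d1 d10 H1] := near_small_line v w N.
have [d2 d20 H2] := near_small_line w v N.
pose h := Num.min d1 d2 / 2.
have m0 : 0 < Num.min d1 d2 by rewrite lt_min d10.
have h0 : 0 < h by exact: divr_gt0.
have hd : h < Num.min d1 d2 by rewrite /h ltr_pdivrMr // ltr_pMr // ltr1n.
have hd1 : 0 <= h < d1 by rewrite ltW //= (lt_le_trans hd) // ge_min lexx.
have hd2 : 0 <= h < d2 by rewrite ltW //= (lt_le_trans hd) // ge_min lexx orbT.
have [||a [b [a01 b01 E1]]] := @second_difference f p v w U h => //.
  by move=> a b a01 b01; have [] := H1 h a b hd1 a01 b01.
have [||a' [b' [a01' b01' E2]]] := @second_difference f p w v U h => //.
  by move=> a' b' a01' b01'; have [] := H2 h a' b' hd2 a01' b01'.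
have [_ [_ X1]] := H1 h a b hd1 a01 b01.
have [_ [X2 _]] := H2 h a' b' hd2 a01' b01'.
have mulhhI (A B x y : R) : A = h * (h * x) -> B = h * (h * y) -> A = B -> x = y.
  by move=> -> -> /(mulfI (lt0r_neq0 h0))/(mulfI (lt0r_neq0 h0)).
have close (x y z : R) : `|y - x| < e / 2 -> `|z - x| < e / 2 -> `|y - z| <= e.
  move=> yx zx; rewrite (_ : y - z = (y - x) - (z - x)); last first.
    by rewrite opprB addrA subrK.
  by rewrite (le_trans (ler_normB _ _)) // (splitr e) lerD // ltW.
have E := mulhhI _ _ _ _ E1 E2.
move: X1 X2; rewrite {}E; last first.
  by rewrite (addrCA (h *: w)) -!addrA; congr (_ + _); rewrite !opprD !opprK addrCA.
by move=> X1 X2; exact: close X2 X1.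
Qed.

End Line.

(** * Coordinates and partial derivatives on the three-dimensional base *)

Section Base.
Context {R : realType}.
Notation base := (base R).
Implicit Types (f : base -> R) (p v : base) (U : set base).

Lemma base_eta v : v = v.1.1 *: ((1, 0, 0) : base) + v.1.2 *: ((0, 1, 0) : base)
  + v.2 *: ((0, 0, 1) : base).
Proof.
case: v => [[a b] c].
rewrite -[RHS]/(a * 1 + b * 0 + c * 0, a * 0 + b * 1 + c * 0,
                a * 0 + b * 0 + c * 1).
by rewrite !mulr0 !mulr1 !addr0 !add0r.
Qed.

Lemma coord_smooth (W : normedModType R) (l : W -> R) :
  (forall (a : R) x y, l (a *: x + y) = a * l x + l y) -> continuous l ->
  [/\ forall p : W, differentiable l p, forall v p : W, 'D_v l p = l v &
      forall U : set W, smooth_on U l].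
Proof. by move=> ll; apply: linear_fun_smooth => a x y; rewrite ll. Qed.

Lemma x1_smooth :
  [/\ forall p, differentiable (fun p : base => p.1.1) p,
      forall v p, 'D_v (fun p : base => p.1.1) p = v.1.1 &
      forall U, smooth_on U (fun p : base => p.1.1)].
Proof.
apply: coord_smooth => // p.
by apply: (@continuous_comp _ _ _ fst fst); exact: cvg_fst.
Qed.

Lemma x2_smooth :
  [/\ forall p, differentiable (fun p : base => p.1.2) p,
      forall v p, 'D_v (fun p : base => p.1.2) p = v.1.2 &
      forall U, smooth_on U (fun p : base => p.1.2)].
Proof.
apply: coord_smooth => // p.
by apply: (@continuous_comp _ _ _ fst snd); [exact: cvg_fst|exact: cvg_snd].
Qed.

Lemma x3_smooth :
  [/\ forall p, differentiable (fun p : base => p.2) p,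
      forall v p, 'D_v (fun p : base => p.2) p = v.2 &
      forall U, smooth_on U (fun p : base => p.2)].
Proof. by apply: coord_smooth => // p; exact: cvg_snd. Qed.

Section Comp.
Context {W : normedModType R}.
Implicit Types (g : W -> R).

Let E3 (i : 'I_3) : base :=
  if i == 0 :> nat then (1, 0, 0) else if i == 1%N :> nat then (0, 1, 0)
  else (0, 0, 1).
Let G3 g1 g2 g3 (i : 'I_3) : W -> R :=
  if i == 0 :> nat then g1 else if i == 1%N :> nat then g2 else g3.

Let phiE g1 g2 g3 q :
  (g1 q, g2 q, g3 q) = 0 + \sum_i G3 g1 g2 g3 i q *: E3 i :> base.
Proof.
by rewrite !big_ord_recl big_ord0 add0r addr0 addrA {1}(base_eta (_, _, _)).
Qed.

Lemma derive_comp3 f g1 g2 g3 (p v : W) :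
  differentiable g1 p -> differentiable g2 p -> differentiable g3 p ->
  differentiable f ((g1 p, g2 p, g3 p) : base) ->
  differentiable (fun q => f (g1 q, g2 q, g3 q)) p /\
  'D_v (fun q => f (g1 q, g2 q, g3 q)) p =
    'D_v g1 p * pd1 f (g1 p, g2 p, g3 p) + 'D_v g2 p * pd2 f (g1 p, g2 p, g3 p)
    + 'D_v g3 p * pd3 f (g1 p, g2 p, g3 p).
Proof.
move=> d1 d2 d3 df.
have dG i : differentiable (G3 g1 g2 g3 i) p.
  by rewrite /G3; case: ifP => _ //; case: ifP.
have [H1 H2] := @derive_comp _ _ _ _ E3 f (fun q => (g1 q, g2 q, g3 q))
  (G3 g1 g2 g3) 0 p v (phiE g1 g2 g3) dG df.
split; first exact: H1.
rewrite !big_ord_recl big_ord0 /G3 /E3 /= addr0 addrA in H2; exact: H2.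
Qed.

Lemma Cn_comp3 (n : nat) f g1 g2 g3 (U : set base) (U' : set W) : open U' ->
  (forall q, U' q -> U (g1 q, g2 q, g3 q)) ->
  Cn n U' g1 -> Cn n U' g2 -> Cn n U' g3 -> Cn n U f ->
  Cn n U' (fun q => f (g1 q, g2 q, g3 q)).
Proof.
move=> oU' sU c1 c2 c3.
apply: (@Cn_comp _ _ _ n _ E3 f (fun q => (g1 q, g2 q, g3 q))
  (G3 g1 g2 g3) 0 _ _ (phiE g1 g2 g3)) => // i.
by rewrite /G3; case: ifP => _ //; case: ifP.
Qed.

End Comp.

Lemma derive_base f p v : differentiable f p ->
  'D_v f p = v.1.1 * pd1 f p + v.1.2 * pd2 f p + v.2 * pd3 f p.
Proof.
by move=> df; rewrite {1}(base_eta v) !deriveDv // !deriveZv.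
Qed.

Lemma base_lin (a b c : R) : linear (fun v : base => v.1.1 * a + v.1.2 * b + v.2 * c).
Proof.
move=> k x y /=.
rewrite -[_ *: (_ + _)]/(k * (_ + _)).
rewrite -[(k *: x.1.1)]/(k * x.1.1) -[(k *: x.1.2)]/(k * x.1.2) -[(k *: x.2)]/(k * x.2).
by ring.
Qed.

Lemma base_lin_continuous (a b c : R) :
  continuous (fun v : base => v.1.1 * a + v.1.2 * b + v.2 * c).
Proof.
have [_ _ S1] := x1_smooth; have [_ _ S2] := x2_smooth; have [_ _ S3] := x3_smooth.
have H : smooth_on setT (fun v : base => v.1.1 * a + v.1.2 * b + v.2 * c).
  move=> n.
  by apply: CnD; first exact: openT;
    [apply: CnD; first exact: openT|]; (apply: CnM; first exact: openT);
    first [exact: Cn_cst|exact: S1|exact: S2|exact: S3].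
by move=> p; apply: (H 0%N).
Qed.

(** The affine parametrisation of the segment treats both orders of [a] and [b] at once. *)
Lemma mvt (h dh : R -> R) (a b : R) :
  (forall t, 0 <= t <= 1 -> is_derive (t * (b - a) + a) 1 h (dh (t * (b - a) + a))) ->
  exists2 t, 0 <= t <= 1 & h b - h a = dh (t * (b - a) + a) * (b - a).
Proof.
move=> hd.
have dif t : 0 <= t <= 1 -> differentiable h (t * (b - a) + a).
  by move=> /hd [d _]; exact/derivable1_diffP.
have [t t01|t t01] := @line_mvt R R^o h a (b - a).
  exact: diff_derivable (dif t t01).
rewrite subrK => ->; exists t => //.
rewrite -[X in 'D_X _ _]mulr1 [LHS](deriveZv (V := R^o)); last exact: dif t t01.
by have [_ ->] := hd t t01; rewrite mulrC.
Qed.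

Lemma incr_dir f p v (t M e : R) :
  (forall s : R, `|s| <= `|t| -> derivable f (s *: v + p) v) ->
  (forall s : R, `|s| <= `|t| -> `|'D_v f (s *: v + p) - M| <= e) ->
  `|f (t *: v + p) - f p - t * M| <= e * `|t|.
Proof.
move=> df Df.
have st (s : R) : 0 <= s <= 1 -> `|s * (t - 0) + 0| <= `|t|.
  move=> /andP[s0 s1]; rewrite subr0 addr0 normrM ger0_norm //.
  by rewrite ler_piMl.
have [s s01|s s01] := @mvt (fun h => f (h *: v + p)) (fun h => 'D_v f (h *: v + p)) 0 t.
  exact/is_derive_line/df/st.
rewrite scale0r add0r => ->; rewrite subr0 [t * M]mulrC -mulrBl normrM.
by rewrite ler_wpM2r //; move: (Df _ (st _ s01)); rewrite subr0.
Qed.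

Lemma near_close3 (g h k : base -> R) U p (e : R) : open U -> U p ->
  {for p, continuous g} -> {for p, continuous h} -> {for p, continuous k} ->
  0 < e -> \forall q \near p, [/\ U q, `|g p - g q| < e,
    `|h p - h q| < e & `|k p - k q| < e].
Proof.
move=> oU Up c1 c2 c3 e0.
have N1 := near_close2 oU Up c1 c2 e0; have N2 := near_close2 oU Up c3 c3 e0.
move: N2; apply: filter_app; move: N1; apply: filterS.
by move=> q [H1 [H2 H3]] [_ [H4 _]]; split.
Qed.

(** The passage from [p] to [h + p] is made along the three axes in turn. The product norm is the
    maximum norm, so every intermediate displacement is bounded by [h], and each leg contributes at
    most [e / 3] times the norm of [h]. *)
Lemma differentiable_partials f p U : open U -> U p ->
  (forall q, U q -> derivable f q ((1, 0, 0) : base)) ->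
  (forall q, U q -> derivable f q ((0, 1, 0) : base)) ->
  (forall q, U q -> derivable f q ((0, 0, 1) : base)) ->
  {for p, continuous (pd1 f)} -> {for p, continuous (pd2 f)} ->
  {for p, continuous (pd3 f)} -> differentiable f p.
Proof.
move=> oU Up d1 d2 d3 c1 c2 c3.
pose df (v : base) := v.1.1 * pd1 f p + v.1.2 * pd2 f p + v.2 * pd3 f p.
pose fM := GRing.isLinear.Build _ _ _ _ _ (base_lin (pd1 f p) (pd2 f p) (pd3 f p)).
pose fL : {linear base -> R} := HB.pack df fM.
have [] // := @differentiable_eps R base f p fL (@base_lin_continuous _ _ _).
move=> e e0; have e30 : 0 < e / 3 by exact: divr_gt0.
have := near_close3 oU Up c1 c2 c3 e30.
move=> /nbhs_ballP [d /= d0 dP].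
apply/nbhs_ballP; exists d => //= h; rewrite -ball_normE /ball_ /= sub0r normrN => hd.
have Hq (q : base) : `|q| < d -> [/\ U (q + p), `|pd1 f p - pd1 f (q + p)| < e / 3,
    `|pd2 f p - pd2 f (q + p)| < e / 3 & `|pd3 f p - pd3 f (q + p)| < e / 3].
  by move=> qd; apply: dP; rewrite -ball_normE /ball_ /= opprD addrCA subrr addr0 normrN.
have [h1 [h2 h3]] : `|h.1.1| <= `|h| /\ `|h.1.2| <= `|h| /\ `|h.2| <= `|h|.
  rewrite !prod_normE /=.
  by rewrite !le_max !lexx !orbT.
pose e1 : base := (1, 0, 0); pose e2 : base := (0, 1, 0); pose e3 : base := (0, 0, 1).
have nb (a b c : R) : `|a| <= `|h.1.1| -> `|b| <= `|h.1.2| -> `|c| <= `|h.2| ->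
    `|((a, b, c) : base)| < d.
  move=> ha hb hc; rewrite !prod_normE /= !gt_max.
  by rewrite (le_lt_trans ha) ?(le_lt_trans hb) ?(le_lt_trans hc) //;
    apply: le_lt_trans hd.
have comb (a b c : R) q : a *: e1 + (b *: e2 + (c *: e3 + q)) = (a, b, c) + q.
  by rewrite !addrA [(a, b, c)]base_eta.
have comb' (a b c : R) q : c *: e3 + (b *: e2 + (a *: e1 + q)) = (a, b, c) + q.
  rewrite -comb !addrA; congr (_ + q).
  by rewrite [LHS]addrC (addrC (c *: e3)) addrA.
have z1 : `|0 : R| <= `|h.1.1| by rewrite normr0.
have z2 : `|0 : R| <= `|h.1.2| by rewrite normr0.
have z3 : `|0 : R| <= `|h.2| by rewrite normr0.
have close (x y : R) : `|x - y| < e / 3 -> `|y - x| <= e / 3 by rewrite distrC => /ltW.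
have I1 : `|f (h.1.1 *: e1 + p) - f p - h.1.1 * pd1 f p| <= e / 3 * `|h.1.1|.
  apply: incr_dir => s sh; have := comb s 0 0 p; rewrite !scale0r !add0r => ->.
    by apply: d1; have [] := Hq _ (nb _ _ _ sh z2 z3).
  by have [_ H _ _] := Hq _ (nb _ _ _ sh z2 z3); exact: close.
have I2 : `|f (h.1.2 *: e2 + (h.1.1 *: e1 + p)) - f (h.1.1 *: e1 + p)
    - h.1.2 * pd2 f p| <= e / 3 * `|h.1.2|.
  apply: incr_dir => s sh; rewrite addrCA; have := comb h.1.1 s 0 p;
    rewrite scale0r add0r => ->.
    by apply: d2; have [] := Hq _ (nb _ _ _ (lexx _) sh z3).
  by have [_ _ H _] := Hq _ (nb _ _ _ (lexx _) sh z3); exact: close.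
have I3 : `|f (h.2 *: e3 + (h.1.2 *: e2 + (h.1.1 *: e1 + p)))
    - f (h.1.2 *: e2 + (h.1.1 *: e1 + p)) - h.2 * pd3 f p| <= e / 3 * `|h.2|.
  apply: incr_dir => s sh; rewrite comb'.
    by apply: d3; have [] := Hq _ (nb _ _ _ (lexx _) (lexx _) sh).
  by have [_ _ _ H] := Hq _ (nb _ _ _ (lexx _) (lexx _) sh); exact: close.
have -> : h + p = h.2 *: e3 + (h.1.2 *: e2 + (h.1.1 *: e1 + p)).
  by rewrite comb'; case: (h) => [[]].
set A := f (h.2 *: _ + _) in I3 *; set B := f (_ *: e2 + _) in I2 I3 *.
set C := f (_ *: e1 + _) in I1 I2 *.
rewrite /= /df.
rewrite (_ : A - f p - _ = (A - B - h.2 * pd3 f p) + (B - C - h.1.2 * pd2 f p)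
   + (C - f p - h.1.1 * pd1 f p)); last by ring.
rewrite (le_trans (ler_normD _ _)) //.
have -> : e * `|h| = e / 3 * `|h| + e / 3 * `|h| + e / 3 * `|h| by field.
have e3' : 0 <= e / 3 by exact: ltW.
rewrite lerD //; last by rewrite (le_trans I1) // ler_wpM2l.
rewrite (le_trans (ler_normD _ _)) // lerD //.
  by rewrite (le_trans I3) // ler_wpM2l.
by rewrite (le_trans I2) // ler_wpM2l.
Qed.

(** The device by which every bootstrapping argument for primitives and flows gains one order: those
    arguments produce the three partial derivatives only. *)
Lemma Cn_partials n f U : open U ->
  (forall q, U q -> derivable f q ((1, 0, 0) : base)) ->
  (forall q, U q -> derivable f q ((0, 1, 0) : base)) ->
  (forall q, U q -> derivable f q ((0, 0, 1) : base)) ->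
  Cn n U (pd1 f) -> Cn n U (pd2 f) -> Cn n U (pd3 f) -> Cn n.+1 U f.
Proof.
move=> oU d1 d2 d3 c1 c2 c3.
have df p : U p -> differentiable f p.
  move=> Up; apply: (@differentiable_partials f p U) => //;
    [exact: Cn_continuous c1 Up|exact: Cn_continuous c2 Up|exact: Cn_continuous c3 Up].
split; [exact: df|move=> v].
have H : Cn n U (fun p => v.1.1 * pd1 f p + v.1.2 * pd2 f p + v.2 * pd3 f p).
  by apply: CnD => //; [apply: CnD => //|]; apply: CnM => //; exact: Cn_cst.
by apply: Cn_eq H => // p Up; rewrite derive_base //; exact: df.
Qed.

Lemma smooth_derive f v U : smooth_on U f -> smooth_on U ('D_v f).
Proof. by move=> Sf n; have [_ Df] := Sf n.+1; exact: Df. Qed.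

End Base.

(** * The scalar implicit function theorem *)

Lemma differentiable_le {R : realType} {V : normedModType R} (f : V -> R) p (e : R) :
  differentiable f p -> 0 < e ->
  \forall h \near (0 : V), `|f (h + p) - f p - 'D_h f p| <= e * `|h|.
Proof.
move=> df e0; have /diff_locallyP [_ /eqaddoP /(_ e e0)] := df.
by apply: filterS => h; rewrite deriveE // opprD addrA.
Qed.

Section IFT.
Context {R : realType}.
Notation base := (base R).

Lemma base_norm (a b c : R) : `|((a, b, c) : base)| = Num.max (Num.max `|a| `|b|) `|c|.
Proof. by rewrite !prod_normE. Qed.

Lemma base_norm_le (v : base) : [/\ `|v.1.1| <= `|v|, `|v.1.2| <= `|v| & `|v.2| <= `|v|].
Proof. by rewrite !prod_normE /= !le_max !lexx !orbT. Qed.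

Lemma near0_norm {V : normedModType R} (P : V -> Prop) : (\forall h \near (0 : V), P h) ->
  exists2 d : R, 0 < d & forall h, `|h| < d -> P h.
Proof.
move=> /nbhs_ballP [d /= d0 dP]; exists d => // h hd; apply: dP.
by rewrite -ball_normE /ball_ /= sub0r normrN.
Qed.

Lemma near_norm {V : normedModType R} (p : V) (P : V -> Prop) : (\forall q \near p, P q) ->
  exists2 d : R, 0 < d & forall h, `|h| < d -> P (h + p).
Proof.
move=> /nbhs_ballP [d /= d0 dP]; exists d => // h hd; apply: dP.
by rewrite -ball_normE /ball_ /= opprD addrCA subrr addr0 normrN.
Qed.

Lemma norm_near {V : normedModType R} (p : V) (P : V -> Prop) (d : R) : 0 < d ->
  (forall h, `|h| < d -> P (h + p)) -> \forall q \near p, P q.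
Proof.
move=> d0 dP; apply/nbhs_ballP; exists d => //= q.
by rewrite -ball_normE /ball_ /= distrC => /dP; rewrite subrK.
Qed.

Lemma continuous_eps {V : normedModType R} (g : V -> R) (p : V) :
  (forall e : R, 0 < e -> exists2 d : R, 0 < d &
     forall h, `|h| < d -> `|g p - g (h + p)| < e) -> {for p, continuous g}.
Proof.
move=> H; apply/cvgrPdist_lt => e /H [d d0 dP].
exact: norm_near d0 dP.
Qed.

Lemma eps_continuous {V : normedModType R} (g : V -> R) (p : V) (e : R) :
  {for p, continuous g} -> 0 < e -> exists2 d : R, 0 < d &
     forall h, `|h| < d -> `|g p - g (h + p)| < e.
Proof. by move=> /cvgrPdist_lt cg /cg; exact: near_norm. Qed.

Lemma norm_near0 {V : normedModType R} (P : V -> Prop) (d : R) : 0 < d ->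
  (forall h, `|h| < d -> P h) -> \forall h \near (0 : V), P h.
Proof.
move=> d0 dP; apply/nbhs_ballP; exists d => //= h.
by rewrite -ball_normE /ball_ /= sub0r normrN; exact: dP.
Qed.

Lemma is_derive_last (F : base -> R) (x : R * R) (s : R) :
  differentiable F ((x, s) : base) ->
  is_derive s 1 (fun s => F (x, s)) (pd3 F (x, s)).
Proof.
have E (h : R) : ((x, h) : base) = h *: ((0, 0, 1) : base) + (x, 0).
  case: x => x1 x2.
  by rewrite -[RHS]/(h * 0 + x1, h * 0 + x2, h * 1 + 0) !mulr0 !add0r mulr1 addr0.
move=> dF.
have D := @is_derive_line _ _ F (x, 0) ((0, 0, 1) : base) s.
rewrite -E in D; have {D} := D (diff_derivable dF).
by rewrite (_ : (fun h : R => F (h *: _ + _)) = fun s => F (x, s)) //;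
  apply/funext => h; rewrite -E.
Qed.

Lemma mvt_last (F : base -> R) (x : R * R) (a b : R) :
  (forall t, 0 <= t <= 1 -> differentiable F ((x, t * (b - a) + a) : base)) ->
  exists2 t, 0 <= t <= 1 & F (x, b) - F (x, a) = pd3 F (x, t * (b - a) + a) * (b - a).
Proof.
move=> dF.
apply: (@mvt R (fun s => F (x, s)) (fun s => pd3 F (x, s))) => t t01.
exact/is_derive_last/dF.
Qed.

(** The tolerance of one half keeps [pd3 F] away from zero and of constant sign on the box;
    [half_away] extracts both facts. *)
Lemma ift_box (F : base -> R) (N : set base) (p : base) :
  open N -> smooth_on N F -> N p -> pd3 F p != 0 ->
  exists2 d : R, 0 < d & forall q : base, `|q - p| < d ->
  N q /\ `|pd3 F p - pd3 F q| < `|pd3 F p| / 2.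
Proof.
move=> oN SF Np F3; have m0 : 0 < `|pd3 F p| / 2 by rewrite divr_gt0 // normr_gt0.
have c3 : {for p, continuous (pd3 F)}.
  exact: (Cn_continuous (smooth_derive _ SF 0%N) Np).
have := near_close2 oN Np c3 c3 m0.
move=> /near_norm[d d0 dP]; exists d => // q qd.
by have := dP _ qd; rewrite subrK => -[? []].
Qed.

Lemma half_away (a b : R) : a != 0 -> `|a - b| < `|a| / 2 ->
  `|a| / 2 <= `|b| /\ 0 < a * b.
Proof.
move=> a0 ab; have na : 0 < `|a| by rewrite normr_gt0.
split.
  have := ler_normB a (a - b); rewrite opprB addrC subrK => H.
  have := ler_normD (a - b) b; rewrite subrK => H'.
  by lra.
have : a * (a - b) < a * a.
  rewrite -expr2 -real_normK ?num_real // expr2.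
  apply: (@le_lt_trans _ _ (`|a| * `|a - b|)); first by rewrite -normrM ler_norm.
  by rewrite ltr_pM2l // (lt_le_trans ab) // ler_pdivrMr // ler_peMr // ?ler1n // ltW.
by rewrite mulrBr ltrBlDl ltrDr.
Qed.

Lemma convex_lt (a b c t d : R) : 0 <= t <= 1 -> `|a - c| < d -> `|b - c| < d ->
  `|t * (b - a) + a - c| < d.
Proof.
move=> /andP[t0 t1] ac bc.
have -> : t * (b - a) + a - c = t * (b - c) + (1 - t) * (a - c) by ring.
have t1' : 0 <= 1 - t by rewrite subr_ge0.
apply: le_lt_trans (ler_normD _ _) _.
rewrite !normrM (ger0_norm t0) (ger0_norm t1').
have [t0'|t0'] := eqVneq t 0.
  by rewrite t0' mul0r add0r subr0 mul1r.
have tp : 0 < t by rewrite lt_def t0'.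
have : t * `|b - c| < t * d by rewrite ltr_pM2l.
have : (1 - t) * `|a - c| <= (1 - t) * d by rewrite ler_wpM2l // ltW.
by lra.
Qed.

Lemma ift_mvt (F : base -> R) (N : set base) (p : base) (d : R) : smooth_on N F ->
  (forall q : base, `|q - p| < d -> N q) ->
  forall (x : R * R) (a b : R), `|x - p.1| < d -> `|a - p.2| < d -> `|b - p.2| < d ->
  exists c, [/\ `|c - p.2| < d, `|c - a| <= `|b - a| &
    F (x, b) - F (x, a) = pd3 F (x, c) * (b - a)].
Proof.
move=> SF dN x a b xd ad bd.
have Nx t : 0 <= t <= 1 -> N (x, t * (b - a) + a).
  move=> t01; apply: dN; rewrite prod_normE /= gt_max xd /=.
  exact: convex_lt.
have [|t t01 ->] := @mvt_last F x a b.
  by move=> t t01; exact: Cn_differentiable (SF 1%N) (Nx t t01).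
exists (t * (b - a) + a); split => //; first exact: convex_lt.
rewrite addrK normrM; move/andP: t01 => [t0 t1].
by rewrite ger0_norm // ler_piMl.
Qed.

Lemma Cn_graph n (F g : base -> R) (N T : set base) : open T -> Cn n T g ->
  Cn n N F -> (forall q, T q -> N (q.1, g q)) -> Cn n T (fun q => F (q.1, g q)).
Proof.
move=> oT cg cF NT.
have [_ _ S1] := @x1_smooth R; have [_ _ S2] := @x2_smooth R.
apply: Cn_eq (Cn_comp3 (f := F) oT _ (S1 T n) (S2 T n) cg cF) => //.
  by move=> [[a b] c].
by move=> [[a b] c] /NT.
Qed.

Section Regularity.
Variables (F : base -> R) (N : set base) (p : base) (d m : R) (T : set base) (g : base -> R).
Hypotheses (oN : open N) (SF : smooth_on N F) (m0 : 0 < m) (oT : open T).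
Hypothesis dN : forall q : base, `|q - p| < d -> N q /\ m <= `|pd3 F q|.
Hypothesis Tx : forall q, T q -> `|q.1 - p.1| < d.
Hypothesis gT : forall q, T q -> `|g q - p.2| < d /\ F (q.1, g q) = q.2.

Let gN q : T q -> N (q.1, g q) /\ m <= `|pd3 F (q.1, g q)|.
Proof.
move=> Tq; apply: dN; rewrite prod_normE gt_max /= Tx //.
by have [] := gT Tq.
Qed.

Let F3n q : T q -> pd3 F (q.1, g q) != 0.
Proof.
by move=> /gN[_ H]; rewrite -normr_gt0; exact: lt_le_trans m0 H.
Qed.

Let dF q : N q -> differentiable F q.
Proof. exact: Cn_differentiable (SF 1%N). Qed.

(** The mean value theorem in the last variable bounds the increment of [g] from above, since
    [pd3 F] is at least [m] in absolute value and [F] on the graph of [g] is the coordinate [t].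
    This a priori bound yields continuity of [g], and a Lipschitz estimate once [F] is
    linearised. *)
Let step (h q : base) : T q -> T (h + q) ->
  m * `|g (h + q) - g q| <= `|h| + `|F ((h.1, 0) + (q.1, g q)) - F (q.1, g q)|.
Proof.
move=> Tq Thq; have [g1 E1] := gT Tq; have [g2 E2] := gT Thq.
have [c [cd _ E]] := ift_mvt SF (fun q H => (dN H).1) (Tx Thq) g1 g2.
have [_ Hc] : N ((h + q).1, c) /\ m <= `|pd3 F ((h + q).1, c)|.
  by apply: dN; rewrite prod_normE gt_max /= (Tx Thq).
apply: (@le_trans _ _ `|F ((h + q).1, g (h + q)) - F ((h + q).1, g q)|).
  by rewrite E normrM ler_wpM2r.
rewrite E2.
have -> : F ((h + q).1, g q) = F ((h.1, 0) + (q.1, g q)).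
  by rewrite -[_ + (q.1, g q)]/(h.1 + q.1, 0 + g q) add0r.
set A := F (_ + _).
rewrite -[(h + q).2]/(h.2 + q.2) -E1.
have -> : h.2 + F (q.1, g q) - A = h.2 - (A - F (q.1, g q)) by ring.
by rewrite (le_trans (ler_normB _ _)) // lerD //; have [] := base_norm_le h.
Qed.

Let gcont q : T q -> {for q, continuous g}.
Proof.
move=> Tq; have [Nq _] := gN Tq.
have cF : {for ((q.1, g q) : base), continuous F} by exact: Cn_continuous (SF 0%N) Nq.
apply: continuous_eps => e e0.
have e'0 : 0 < m * e / 2 by rewrite divr_gt0 // mulr_gt0.
have [d1 d10 H1] := eps_continuous cF e'0.
have /near_norm[d2 d20 H2] := open_near oT Tq.
pose r := Num.min d1 (Num.min d2 (m * e / 2)).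
have r0 : 0 < r by rewrite !lt_min d10 d20.
exists r => // h hr.
have := hr; rewrite !lt_min => /and3P[zr1 zr2 zr3].
have Thq : T (h + q) by exact: H2.
have := step Tq Thq.
have hn : `|((h.1, 0) : base)| < d1.
  rewrite prod_normE gt_max /= normr0 d10 andbT.
  by apply: le_lt_trans zr1; rewrite [leRHS]prod_normE /= le_max lexx.
have := H1 _ hn; rewrite distrC; set B := `|F _ - _| => HB.
by move=> H; rewrite distrC -(ltr_pM2l m0) (le_lt_trans H) // (splitr (m * e)) ltrD.
Qed.
(** The formula is implicit differentiation of [F (x, g (x, t)) = t]. The Lipschitz bound on [g]
    makes the remainder of [F], which is small relative to the displacement along the graph, small
    relative to [h] itself. *)
Let gdiff q : T q -> differentiable g q /\ forall v, 'D_v g q =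
  v.1.1 * (- pd1 F (q.1, g q) / pd3 F (q.1, g q))
  + v.1.2 * (- pd2 F (q.1, g q) / pd3 F (q.1, g q))
  + v.2 * (pd3 F (q.1, g q))^-1.
Proof.
move=> Tq; have [Nq _] := gN Tq; have A0 := F3n Tq.
have [_ EP] := gT Tq.
pose P : base := (q.1, g q).
have dP : differentiable F P by exact: dF.
have DP (v : base) := derive_base v dP.
have D1 := near0_norm (differentiable_le dP ltr01).
have D2 (e : R) (e0 : 0 < e) := near0_norm (differentiable_le dP e0).
have HT := near_norm (open_near oT Tq).
have ST := step Tq.
move: A0 EP DP D1 D2; rewrite -/P.
set A1 := pd1 F P; set A2 := pd2 F P; set A3 := pd3 F P.
clearbody A1 A2 A3 => A0 EP DP [d1 d10 D1] D2.
(* Lipschitz constant of [g] at [q]: the linearisation of [F] with error factor 1 contributes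
   [1 + |A1| + |A2|], the displacement of [t] contributes another 1, and [step] divides by [m]. *)
pose K := (2 + `|A1| + `|A2|) / m.
have K0 : 0 <= K by rewrite divr_ge0 ?addr_ge0 // ltW.
have K1 : 0 < 1 + K by rewrite ltr_wpDr.
have nA : 0 < `|A3| by rewrite normr_gt0.
pose df (v : base) := v.1.1 * (- A1 / A3) + v.1.2 * (- A2 / A3) + v.2 * A3^-1.
pose fM := GRing.isLinear.Build _ _ _ _ _ (base_lin (- A1 / A3) (- A2 / A3) A3^-1).
pose fL : {linear base -> R} := HB.pack df fM.
suff [dg Dg] : differentiable g q /\ 'd g q = fL :> (base -> R).
  by split=> // v; rewrite deriveE // Dg.
apply: (@differentiable_eps R base g q fL (@base_lin_continuous _ _ _ _)) => e e0.
have e'0 : 0 < e * `|A3| / (1 + K) by rewrite divr_gt0 // mulr_gt0.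
have {D2} [d2 d20 D2] := D2 _ e'0.
have [d3 d30 D3] := HT.
pose r := Num.min d1 (Num.min (d2 / (1 + K)) d3).
have r0 : 0 < r by rewrite !lt_min d10 d30 divr_gt0.
apply: (norm_near0 r0) => h; rewrite !lt_min => /and3P[h1 h2 h3].
have Th := D3 _ h3; have := ST _ Th; rewrite -/P.
set k := g (h + q) - g q => Hk.
have [n1 n2 n3] := base_norm_le h.
have hn : `|((h.1, 0) : base)| <= `|h|.
  by rewrite prod_normE ge_max /= normr0 normr_ge0 andbT [leRHS]prod_normE /= le_max lexx.
have Lip : `|k| <= K * `|h|.
  rewrite /K mulrAC ler_pdivlMr // mulrC (le_trans Hk) //.
  have := D1 _ (le_lt_trans hn h1); rewrite DP /= mul0r addr0 mul1r.
  set X := F _ - _ => HX.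
  have : `|X| <= `|X - (h.1.1 * A1 + h.1.2 * A2)| + `|h.1.1 * A1 + h.1.2 * A2|.
    by rewrite -[X in `|X|](subrK (h.1.1 * A1 + h.1.2 * A2)) ler_normD.
  have : `|h.1.1 * A1 + h.1.2 * A2| <= `|h| * `|A1| + `|h| * `|A2|.
    by rewrite (le_trans (ler_normD _ _)) // !normrM lerD // ler_wpM2r.
  by lra.
pose w : base := (h.1, k).
have wn : `|w| <= (1 + K) * `|h|.
  rewrite prod_normE ge_max /= mulrDl mul1r.
  rewrite (le_trans Lip) ?lerDr // andbT.
  have : `|h.1| <= `|h| by rewrite [leRHS]prod_normE le_max lexx.
  by move=> /le_trans -> //; rewrite lerDl mulr_ge0.
have wd : `|w| < d2.
  by apply: le_lt_trans wn _; move: h2; rewrite ltr_pdivlMr // mulrC.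
have := D2 _ wd; rewrite DP.
have -> : w + P = ((h + q).1, g (h + q)).
  by rewrite -[LHS]/(h.1 + q.1, k + g q) subrK.
have [_ ->] := gT Th; rewrite EP /= addrK => HH.
have -> : k - fL h = - (h.2 - (h.1.1 * A1 + h.1.2 * A2 + k * A3)) / A3.
  rewrite /= /df; field.
  exact: A0.
rewrite normrM normrN normfV ler_pdivrMr // (le_trans HH) //.
apply: (@le_trans _ _ (e * `|A3| / (1 + K) * ((1 + K) * `|h|))).
  by rewrite ler_wpM2l // ltW.
by rewrite le_eqVlt; apply/orP; left; apply/eqP; field; rewrite gt_eqF.
Qed.

(** Bootstrapping: the gradient of [g] is a rational expression in the derivatives of [F] along the
    graph of [g], so it is as regular as [g]. *)
Lemma implicit_smooth : smooth_on T g.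
Proof.
have smF v : smooth_on N ('D_v F) by exact: smooth_derive.
have NT q : T q -> N (q.1, g q) by move=> /gN[].
have nz q : T q -> pd3 F (q.1, g q) != 0 by exact: F3n.
elim=> [|n IH]; first exact: gcont.
split=> [q Tq|v]; first by have [] := gdiff Tq.
have C1 : Cn n T (fun q => pd1 F (q.1, g q)) by exact: (Cn_graph oT IH (smF _ n) NT).
have C2 : Cn n T (fun q => pd2 F (q.1, g q)) by exact: (Cn_graph oT IH (smF _ n) NT).
have C3 : Cn n T (fun q => pd3 F (q.1, g q)) by exact: (Cn_graph oT IH (smF _ n) NT).
have CV := CnV oT nz C3.
have Cc (a : R) := Cn_cst n T a.
have H1 := CnM oT (Cc v.1.1) (CnM oT (CnN oT C1) CV).
have H2 := CnM oT (Cc v.1.2) (CnM oT (CnN oT C2) CV).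
apply: Cn_eq oT _ (CnD oT (CnD oT H1 H2) (CnM oT (Cc v.2) CV)) => q Tq.
by have [_ ->] := gdiff Tq.
Qed.

End Regularity.
(** Existence comes from the intermediate value theorem and regularity from [implicit_smooth].
    Injectivity of [F] in its last variable on the box is what identifies the solution at the base
    point with [p.2]. *)
Lemma local_solution (F : base -> R) (N : set base) (p : base) :
  open N -> smooth_on N F -> N p -> pd3 F p != 0 ->
  exists (T : set base) (g : base -> R),
    [/\ solves_last N F T g, T (p.1, F p) & g (p.1, F p) = p.2].
Proof.
move=> oN SF Np F3.
have [d d0 dP] := ift_box oN SF Np F3.
pose m := `|pd3 F p| / 2; have m0 : 0 < m by rewrite divr_gt0 // normr_gt0.
have dN q : `|q - p| < d -> N q /\ m <= `|pd3 F q|.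
  by move=> /dP[Nq /(half_away F3)[]].
have dN' q : `|q - p| < d -> N q by move=> /dN[].
have sg q : `|q - p| < d -> 0 < pd3 F p * pd3 F q.
  by move=> /dP[Nq /(half_away F3)[]].
have mv := ift_mvt SF dN'.
have nq (x : R * R) (c : R) : `|x - p.1| < d -> `|c - p.2| < d ->
    `|((x, c) : base) - p| < d.
  by move=> xd cd; rewrite prod_normE gt_max /= xd.
have p1d : `|p.1 - p.1| < d by rewrite subrr normr0.
have p2d : `|p.2 - p.2| < d by rewrite subrr normr0.
have inj x a b : `|x - p.1| < d -> `|a - p.2| < d -> `|b - p.2| < d ->
    F (x, a) = F (x, b) -> a = b.
  move=> xd ad bd /esym/eqP; rewrite -subr_eq0.
  have [c [cd _ ->]] := mv _ _ _ xd ad bd.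
  have [_ H] := dN _ (nq _ _ xd cd).
  rewrite mulf_eq0 => /orP[/eqP F0|]; last by rewrite subr_eq0 => /eqP.
  by move: (lt_le_trans m0 H); rewrite F0 normr0 ltxx.
pose n := d / 2; have n0 : 0 < n by exact: divr_gt0.
have nd : n < d by rewrite /n ltr_pdivrMr // ltr_pMr // ltr1n.
have bm : `|(p.2 - n) - p.2| < d by rewrite addrAC subrr add0r normrN gtr0_norm.
have bp : `|(p.2 + n) - p.2| < d by rewrite addrAC subrr add0r gtr0_norm.
(* Negative exactly when [F (x, .)] takes values strictly on opposite sides of [t] at the two ends.
   Being a continuous condition, it persists near the base point and supplies the hypothesis of the
   intermediate value theorem there. *)
pose H (q : base) := (F (q.1, p.2 - n) - q.2) * (F (q.1, p.2 + n) - q.2).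
pose q0 : base := (p.1, F p).
have Fp : F p = F (p.1, p.2) by case: (p).
have Hq0 : H q0 < 0.
  have [c1 [c1d _ E1]] := mv _ _ _ p1d p2d bm.
  have [c2 [c2d _ E2]] := mv _ _ _ p1d p2d bp.
  have s1 := sg _ (nq _ _ p1d c1d); have s2 := sg _ (nq _ _ p1d c2d).
  rewrite /H /= Fp E1 E2.
  have s12 : 0 < pd3 F (p.1, c1) * pd3 F (p.1, c2).
    have : 0 < (pd3 F p * pd3 F (p.1, c1)) * (pd3 F p * pd3 F (p.1, c2)).
      exact: mulr_gt0.
    have -> : (pd3 F p * pd3 F (p.1, c1)) * (pd3 F p * pd3 F (p.1, c2)) =
      pd3 F p ^+ 2 * (pd3 F (p.1, c1) * pd3 F (p.1, c2)) by ring.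
    by rewrite pmulr_rgt0 // exprn_even_gt0.
  have -> : pd3 F (p.1, c1) * (p.2 - n - p.2) * (pd3 F (p.1, c2) * (p.2 + n - p.2))
     = - (n ^+ 2 * (pd3 F (p.1, c1) * pd3 F (p.1, c2))) by ring.
  by rewrite oppr_lt0 mulr_gt0 // exprn_gt0.
have Bx (q : base) : ball q0 d q -> `|q.1 - p.1| < d.
  rewrite -ball_normE /ball_ /= distrC => H'; apply: le_lt_trans H'.
  by rewrite [leRHS]prod_normE le_max lexx.
have oB : open (ball q0 d) by exact: ball_open.
have cH : {for q0, continuous H}.
  have [_ _ S3] := @x3_smooth R.
  have C (b : R) : `|b - p.2| < d -> Cn 0 (ball q0 d) (fun q : base => F (q.1, b) - q.2).
    move=> bd; apply: CnB (S3 _ 0%N) => //.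
    apply: Cn_graph (SF 0%N) _ => //; first exact: Cn_cst.
    by move=> q /Bx qd; apply: dN'; exact: nq.
  apply: (Cn_continuous (CnM oB (C _ bm) (C _ bp))); exact: ballxx.
have nH : 0 < - H q0 by rewrite oppr_gt0.
have [e1 e10 He1] := eps_continuous cH nH.
pose e := Num.min d e1; have e0 : 0 < e by rewrite lt_min d0.
pose T := ball q0 e.
have oT : open T by exact: ball_open.
have TH q : T q -> ball q0 d q /\ H q < 0.
  rewrite /T -!ball_normE /ball_ /= lt_min => /andP[-> qe]; split=> //.
  have := He1 (q - q0); rewrite distrC => /(_ qe); rewrite subrK.
  by move=> H'; have := ler_norm (H q - H q0); rewrite distrC; lra.
have sol q : T q -> exists s, `|s - p.2| < d /\ F (q.1, s) = q.2.
  move=> /TH [/Bx qd Hq].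
  have le12 : p.2 - n <= p.2 + n by lra.
  have dI s : s \in `[p.2 - n, p.2 + n]%R -> `|s - p.2| < d.
    rewrite in_itv /= => /andP[s1 s2]; apply: le_lt_trans nd.
    by rewrite ler_norml; apply/andP; split; lra.
  have cF : {within `[p.2 - n, p.2 + n], continuous (fun s => F (q.1, s))}.
    apply: derivable_within_continuous => s /dI sd.
    have Nq := dN' _ (nq _ _ qd sd).
    have dF : differentiable F ((q.1, s) : base).
      exact: Cn_differentiable (SF 1%N) Nq.
    by have [] := is_derive_last dF.
  have [|s /dI sd Fs] := @IVT R (fun s => F (q.1, s)) _ _ q.2 le12 cF.
    move: Hq; rewrite /H; set A := F (_, p.2 - n); set B := F (_, p.2 + n).
    by rewrite ge_min le_max => Hq; apply/andP; split; apply/orP; nra.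
  by exists s.
(* A chosen root; the default 0 is returned only where there is none, which does not happen on
   [T]. *)
pose g (q : base) := xget 0 [set s | `|s - p.2| < d /\ F (q.1, s) = q.2].
have gP q : T q -> `|g q - p.2| < d /\ F (q.1, g q) = q.2.
  by move=> /sol [s Ps]; apply: (@xgetPex _ 0 [set s | `|s - p.2| < d /\ F (q.1, s) = q.2]); exists s.
have T0 : T q0 by exact: ballxx.
exists T, g; split => //.
  split=> //.
    apply: (implicit_smooth SF m0 oT dN) => // q Tq.
    by have [/Bx] := TH _ Tq.
  move=> q Tq; have [gd gq] := gP _ Tq; split=> //.
  by have [/Bx qd _] := TH _ Tq; apply: dN'; exact: nq.
have [gd gq] := gP _ T0; apply: (inj p.1) => //.
by rewrite -Fp -[RHS]gq.
Qed.
End IFT.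

(** * Jets and differential consequences of an invariant surface condition *)

Section JetAlgebra.
Context {R : realType}.
Implicit Types (n m a b : nat).

Lemma mindexP n a b : (a + b <= n)%N ->
  exists m : mindex n, ((val m).1 = a :> nat) /\ ((val m).2 = b :> nat).
Proof.
move=> abn.
have an : (a < n.+1)%N by rewrite ltnS (leq_trans _ abn) // leq_addr.
have bn : (b < n.+1)%N by rewrite ltnS (leq_trans _ abn) // leq_addl.
by exists (exist _ (Ordinal an, Ordinal bn) abn).
Qed.

Lemma ucoord_mkjet n x (c : nat -> nat -> R) a b : (a + b <= n)%N ->
  ucoord (mkjet n x c) a b = c a b.
Proof.
move=> /mindexP[m [ma mb]]; rewrite /ucoord; case: pickP => [k|/(_ m)].
  by move=> /andP[/eqP ka /eqP kb]; rewrite /mkjet mxE enum_rankK ka kb.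
by rewrite ma mb !eqxx.
Qed.

Lemma ucoord_mindex n (j : jet R n) (m : mindex n) :
  ucoord j (val m).1 (val m).2 = j.2 0 (enum_rank m).
Proof.
rewrite /ucoord; case: pickP => [k|/(_ m)]; last by rewrite !eqxx.
move=> /andP[/eqP ka /eqP kb]; congr (j.2 0 (enum_rank _)).
apply: val_inj; case: (val k) (val m) ka kb => k1 k2 [m1 m2] /= ka kb.
by congr (_, _); apply: val_inj.
Qed.

Lemma mkjet_eq n x (c d : nat -> nat -> R) :
  (forall a b, (a + b <= n)%N -> c a b = d a b) -> mkjet n x c = mkjet n x d.
Proof.
move=> cd; rewrite /mkjet; congr (_, _); apply/rowP => i; rewrite !mxE.
by apply: cd; exact: (valP (enum_val i : mindex n)).
Qed.

Lemma ucoord_jproj n m (j : jet R n) a b : (a + b <= m)%N ->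
  ucoord (jproj m j) a b = ucoord j a b.
Proof. exact: ucoord_mkjet. Qed.

Lemma jbase_jproj n m (j : jet R n) : jbase (jproj m j) = jbase j.
Proof. by rewrite /jbase ucoord_jproj. Qed.

Lemma ucoord_jet_of n (g : R * R -> R) x a b : (a + b <= n)%N ->
  ucoord (jet_of n g x) a b =
  iter a (fun h : R * R -> R => 'D_((1, 0) : R * R) h)
      (iter b (fun h : R * R -> R => 'D_((0, 1) : R * R) h) g) x.
Proof. exact: ucoord_mkjet. Qed.

Lemma jproj_jet_of n m (g : R * R -> R) x : (m <= n)%N ->
  jproj m (jet_of n g x) = jet_of m g x.
Proof.
move=> mn; apply: mkjet_eq => a b abm; rewrite ucoord_jet_of //.
exact: leq_trans abm mn.
Qed.

Lemma jbase_jet_of n (g : R * R -> R) x : jbase (jet_of n g x) = (x, g x).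
Proof. by rewrite /jbase ucoord_jet_of. Qed.

Let jx n (i : bool + mindex n) : jet R n :=
  match i with
  | inl true => ((1, 0), 0)
  | inl false => ((0, 1), 0)
  | inr m => (0, delta_mx 0 (enum_rank m))
  end.

Let jc n (j : jet R n) (i : bool + mindex n) : R :=
  match i with
  | inl true => j.1.1
  | inl false => j.1.2
  | inr m => j.2 0 (enum_rank m)
  end.

Lemma jet_sum n (j : jet R n) : j = 0 + \sum_i jc j i *: jx i.
Proof.
rewrite add0r big_sumType /= big_bool /=.
have -> : \sum_(i : mindex n) j.2 0 (enum_rank i) *: ((0, delta_mx 0 (enum_rank i)) : jet R n)
  = (0, j.2).
  transitivity ((0, \sum_(i : mindex n) j.2 0 (enum_rank i) *: delta_mx 0 (enum_rank i)) : jet R n).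
    elim/big_ind2 : _ => // [x1 y1 x2 y2 -> ->|i _].
      by rewrite -[LHS]/(0 + 0, _ + _) addr0.
    by rewrite -[LHS]/(_ *: 0, _) scaler0.
  congr (_, _); rewrite [RHS]row_sum_delta (reindex (@enum_rank (mindex n))) //.
  by exists enum_val => k _; [exact: enum_rankK|exact: enum_valK].
case: j => [[x1 x2] y].
rewrite -[RHS]/((x1 * 1 + x2 * 0 + 0, x1 * 0 + x2 * 1 + 0), x1 *: 0 + x2 *: 0 + y).
by rewrite !mulr1 !mulr0 !scaler0 !addr0 !add0r.
Qed.

Lemma derive_comp_jet (W : normedModType R) n (F : jet R n -> R) (phi : W -> jet R n) (p v : W) :
  differentiable (fun q => (phi q).1.1) p -> differentiable (fun q => (phi q).1.2) p ->
  (forall m : mindex n, differentiable (fun q => (phi q).2 0 (enum_rank m)) p) ->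
  differentiable F (phi p) ->
  'D_v (fun q => F (phi q)) p =
    'D_v (fun q => (phi q).1.1) p * 'D_(((1, 0), 0) : jet R n) F (phi p)
  + 'D_v (fun q => (phi q).1.2) p * 'D_(((0, 1), 0) : jet R n) F (phi p)
  + \sum_(m : mindex n) 'D_v (fun q => (phi q).2 0 (enum_rank m)) p * pdu F m (phi p).
Proof.
move=> d1 d2 dm dF.
have dG i : differentiable (fun q => jc (phi q) i) p by case: i => [[]|m] //=.
have [_ ->] := @derive_comp _ _ _ _ (@jx n) F phi (fun i q => jc (phi q) i) 0 p v
  (fun q => jet_sum (phi q)) dG dF.
by rewrite big_sumType /= big_bool /=.
Qed.

Lemma Cn_comp_jet (W : normedModType R) k n (F : jet R n -> R) (phi : W -> jet R n)
  (U : set (jet R n)) (U' : set W) : open U' -> (forall q, U' q -> U (phi q)) ->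
  Cn k U' (fun q => (phi q).1.1) -> Cn k U' (fun q => (phi q).1.2) ->
  (forall m : mindex n, Cn k U' (fun q => (phi q).2 0 (enum_rank m))) ->
  Cn k U F -> Cn k U' (fun q => F (phi q)).
Proof.
move=> oU' sU c1 c2 cm.
apply: (@Cn_comp _ _ _ k _ (@jx n) F phi (fun i q => jc (phi q) i) 0 _ _
  (fun q => jet_sum (phi q))) => //.
by case=> [[]|m] //=.
Qed.

Lemma continuous_jet (W : normedModType R) n (phi : W -> jet R n) (p : W) :
  {for p, continuous (fun q => (phi q).1.1)} -> {for p, continuous (fun q => (phi q).1.2)} ->
  (forall m : mindex n, {for p, continuous (fun q => (phi q).2 0 (enum_rank m))}) ->
  {for p, continuous phi}.
Proof.
move=> c1 c2 cm.
rewrite (_ : phi = \sum_i (fun q => jc (phi q) i *: jx i)); last first.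
  by apply/funext => q; rewrite {1}[phi q]jet_sum add0r fct_sumE.
elim/big_ind : _ => [|x y dx dy|i _].
- exact: cst_continuous.
- exact: continuousD.
- by apply: continuousZl; case: i => [[]|m] /=.
Qed.

(** The zero function is listed with the coordinates because [ucoord] is 0 beyond the order of the
    jet space. *)
Lemma jet_coord_smooth n (l : jet R n -> R) :
  [\/ l = (fun j => j.1.1), l = (fun j => j.1.2) |
     exists i, l = (fun j => j.2 0 i)] \/ l = (fun=> 0) ->
  (forall p v, 'D_v l p = l v) /\ forall U, smooth_on U l.
Proof.
move=> H.
have ll : linear l.
  by case: H => [[->|->|[i ->]]|->] k x y //=; rewrite ?mxE // scaler0 addr0.
have cl : continuous l.
  case: H => [[->|->|[i ->]]|->] p.
  - by apply: (@continuous_comp _ _ _ fst fst); exact: cvg_fst.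
  - by apply: (@continuous_comp _ _ _ fst snd); [exact: cvg_fst|exact: cvg_snd].
  - apply: (@continuous_comp _ _ _ snd (fun M : 'rV[R]_#|{: mindex n}| => M 0 i)).
      exact: cvg_snd.
    exact: coord_continuous.
  - exact: cst_continuous.
by have [_ H1 H2] := linear_fun_smooth ll cl; split=> // p v; exact: H1.
Qed.

Lemma ucoord_smooth n a b : forall U, smooth_on U (fun j : jet R n => ucoord j a b).
Proof.
have [] // := @jet_coord_smooth n (fun j => ucoord j a b).
rewrite /ucoord; case: pickP => [m _|_]; last by right.
by left; apply: Or33; exists (enum_rank m).
Qed.

Lemma jx1_smooth n : forall U, smooth_on U (fun j : jet R n => j.1.1).
Proof. by have [] // := @jet_coord_smooth n (fun j => j.1.1); left; apply: Or31. Qed.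

Lemma jx2_smooth n : forall U, smooth_on U (fun j : jet R n => j.1.2).
Proof. by have [] // := @jet_coord_smooth n (fun j => j.1.2); left; apply: Or32. Qed.

Lemma jproj_coord n m (k : mindex m) :
  (fun j : jet R n => (jproj m j).2 0 (enum_rank k)) =
  fun j => ucoord j (val k).1 (val k).2.
Proof. by apply/funext => j; rewrite -ucoord_mindex ucoord_jproj //; exact: valP k. Qed.

Lemma jproj_continuous n m : continuous (@jproj R n m).
Proof.
move=> j; apply: continuous_jet => [||k].
- exact: (@jx1_smooth n setT 0%N).
- exact: (@jx2_smooth n setT 0%N).
- rewrite jproj_coord; exact: (@ucoord_smooth n _ _ setT 0%N).
Qed.

Lemma open_jproj n m (U : set (jet R m)) : open U -> open (jproj m @^-1` U : set (jet R n)).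
Proof. by apply: open_comp => j _; exact: jproj_continuous. Qed.

Lemma smooth_jproj n m (F : jet R m -> R) (U : set (jet R m)) : open U ->
  smooth_on U F -> smooth_on (jproj m @^-1` U) (fun j : jet R n => F (jproj m j)).
Proof.
move=> oU SF k; apply: (Cn_comp_jet (open_jproj oU)) (SF k) => //.
- exact: jx1_smooth.
- exact: jx2_smooth.
- by move=> i; rewrite jproj_coord; exact: ucoord_smooth.
Qed.

Lemma smooth_Dtot n (F : jet R n -> R) (U : set (jet R n)) : open U ->
  smooth_on U F ->
  smooth_on (jproj n @^-1` U) (Dtot1 F) /\ smooth_on (jproj n @^-1` U) (Dtot2 F).
Proof.
move=> oU SF; have oU' := @open_jproj n.+1 _ _ oU.
have SD v : smooth_on (jproj n @^-1` U) (fun j : jet R n.+1 => 'D_v F (jproj n j)).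
  have SDF : smooth_on U ('D_v F) by move=> k; have [_ D] := SF k.+1; exact: D.
  exact: smooth_jproj oU SDF.
split=> k; (apply: CnD => //; first exact: SD);
  by apply: Cn_sum => // m; apply: CnM => //; [exact: ucoord_smooth|exact: SD].
Qed.

Lemma jbase_continuous n : continuous (@jbase R n).
Proof.
move=> j; have c1 : {for j, continuous (fst : jet R n -> R * R)} by exact: cvg_fst.
have c2 := @ucoord_smooth n 0 0 setT 0%N j I.
exact: cvg_pair c1 c2.
Qed.

Lemma open_jbase n (U : set (base R)) : open U -> open (@jbase R n @^-1` U).
Proof. by apply: open_comp => j _; exact: jbase_continuous. Qed.

Lemma smooth_jbase n (f : base R -> R) (U : set (base R)) : open U ->
  smooth_on U f -> smooth_on (@jbase R n @^-1` U) (fun j : jet R n => f (jbase j)).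
Proof.
move=> oU Sf k; have oU' := @open_jbase n _ oU.
have E (j : jet R n) : (j.1.1, j.1.2, ucoord j 0 0) = jbase j.
  by rewrite /jbase; case: (j.1).
apply: Cn_eq oU' _ (Cn_comp3 (f := f) oU' _ (@jx1_smooth n _ k) (@jx2_smooth n _ k)
  (@ucoord_smooth n 0 0 _ k) (Sf k)).
  by move=> j _; rewrite E.
by move=> j; rewrite E.
Qed.

Notation D1 := ((1, 0) : R * R).
Notation D2 := ((0, 1) : R * R).

(** * Prolonged graphs and total derivatives *)

Section Prolongation.
Variables (X : set (R * R)) (g : R * R -> R).
Hypotheses (oX : open X) (Sg : smooth_on X g).

Let smD v (h : R * R -> R) : smooth_on X h -> smooth_on X ('D_v h).
Proof. by move=> Sh n; have [_ D] := Sh n.+1; exact: D. Qed.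

Let smI v (h : R * R -> R) a : smooth_on X h ->
  smooth_on X (iter a (fun h : R * R -> R => 'D_v h) h).
Proof. by move=> Sh; elim: a => //= a IH; exact: smD. Qed.

(** Jets are built with all [x_2]-derivatives innermost, so a further [x_2]-derivative applied from
    outside has to be carried through the [x_1]-derivatives. *)
Let iter_swap v w a (h : R * R -> R) x : smooth_on X h -> X x ->
  'D_w (iter a (fun h : R * R -> R => 'D_v h) h) x =
  iter a (fun h : R * R -> R => 'D_v h) ('D_w h) x.
Proof.
move=> Sh; elim: a x => //= a IH x Xx.
rewrite (schwarz _ _ oX Xx (smI v a Sh 2)).
by apply: near_eq_derive; apply: (open_near_eq oX Xx) => y /IH.
Qed.

Let r2_coord (l : R * R -> R) : l = fst \/ l = snd ->
  [/\ forall p, differentiable l p, forall v p, 'D_v l p = l v & smooth_on X l].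
Proof.
move=> H; have [||H1 H2 H3] := @linear_fun_smooth R _ l => //.
  by move=> k x y; case: H => ->.
by case: H => -> p; [exact: cvg_fst|exact: cvg_snd].
Qed.

Let jet_ofE n (m : mindex n) y : (jet_of n g y).2 0 (enum_rank m) =
  iter (val m).1 (fun h : R * R -> R => 'D_D1 h)
    (iter (val m).2 (fun h : R * R -> R => 'D_D2 h) g) y.
Proof. by rewrite -ucoord_mindex ucoord_jet_of //; exact: (valP m). Qed.

(** The chain rule along the prolonged graph. For [Dtot1] the raised coordinate is an outer
    derivative and matches at once; for [Dtot2] the mixed derivatives are commuted by
    [iter_swap]. *)
Lemma Dtot_jet_of n (F : jet R n -> R) x : X x -> differentiable F (jet_of n g x) ->
  Dtot1 F (jet_of n.+1 g x) = 'D_D1 (fun y => F (jet_of n g y)) x /\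
  Dtot2 F (jet_of n.+1 g x) = 'D_D2 (fun y => F (jet_of n g y)) x.
Proof.
move=> Xx dF.
have [f1 f2 _] := @r2_coord _ (or_introl erefl).
have [s1 s2 _] := @r2_coord _ (or_intror erefl).
have dm (m : mindex n) : differentiable (fun q => (jet_of n g q).2 0 (enum_rank m)) x.
  rewrite (_ : (fun q => _) = iter (val m).1 (fun h : R * R -> R => 'D_D1 h)
    (iter (val m).2 (fun h : R * R -> R => 'D_D2 h) g)); last first.
    by apply/funext => y; exact: jet_ofE.
  exact: Cn_differentiable (smI _ _ (smI _ _ Sg) 1%N) Xx.
have Dm v (m : mindex n) : 'D_v (fun q => (jet_of n g q).2 0 (enum_rank m)) x =
  'D_v (iter (val m).1 (fun h : R * R -> R => 'D_D1 h)
    (iter (val m).2 (fun h : R * R -> R => 'D_D2 h) g)) x.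
  by congr ('D_v _ x); apply/funext => y; exact: jet_ofE.
have E v := derive_comp_jet v (f1 x : differentiable (fun q => (jet_of n g q).1.1) x)
  (s1 x : differentiable (fun q => (jet_of n g q).1.2) x) dm dF.
rewrite /Dtot1 /Dtot2 jproj_jet_of // !E; split.
  rewrite (f2 D1 x : 'D_D1 (fun q => (jet_of n g q).1.1) x = 1).
  rewrite (s2 D1 x : 'D_D1 (fun q => (jet_of n g q).1.2) x = 0).
  rewrite mul1r mul0r addr0; congr (_ + _); apply: eq_bigr => m _.
  by rewrite Dm ucoord_jet_of // addSn ltnS; exact: (valP m).
rewrite (f2 D2 x : 'D_D2 (fun q => (jet_of n g q).1.1) x = 0).
rewrite (s2 D2 x : 'D_D2 (fun q => (jet_of n g q).1.2) x = 1).
rewrite mul1r mul0r add0r; congr (_ + _); apply: eq_bigr => m _.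
rewrite Dm ucoord_jet_of; last by rewrite addnS ltnS; exact: (valP m).
by rewrite (iter_swap _ _ _ (smI _ _ Sg) Xx).
Qed.

(** Vanishing on the prolonged graph is packed with smoothness on a neighbourhood of it, since a
    total derivative also involves derivatives of [F] transverse to the graph. In this form the
    property passes to total derivatives. *)
Definition vanishes n (F : jet R n -> R) :=
  exists O : set (jet R n), [/\ open O, smooth_on O F &
    forall x, X x -> O (jet_of n g x) /\ F (jet_of n g x) = 0].

Lemma vanishes_Dtot n (F : jet R n -> R) : vanishes F ->
  vanishes (Dtot1 F) /\ vanishes (Dtot2 F).
Proof.
move=> [ O [oO SF OF]]; have [S1 S2] := smooth_Dtot oO SF.
have Z v x : X x -> 'D_v (fun y => F (jet_of n g y)) x = 0.
  move=> Xx; rewrite (@near_eq_derive _ _ _ _ (fun=> 0)) ?derive_cst //.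
  by apply: (open_near_eq oX Xx) => y /OF[].
have DF x : X x -> differentiable F (jet_of n g x).
  by move=> /OF[Ox _]; exact: Cn_differentiable (SF 1%N) Ox.
have oJ := @open_jproj n.+1 _ _ oO.
split; exists (jproj n @^-1` O : set (jet R n.+1)); split=> // x Xx;
  (have [Ox _] := OF _ Xx; split; first by rewrite /preimage /= jproj_jet_of);
  have [D1E D2E] := Dtot_jet_of Xx (DF _ Xx); by rewrite (D1E, D2E) Z.
Qed.

Lemma vanishes_iterD a b n (F : jet R n -> R) : vanishes F ->
  vanishes (iterD1 a (iterD2 b F)).
Proof.
move=> VF; have : vanishes (iterD2 b F).
  by elim: b => //= b IH; have [] := vanishes_Dtot IH.
by elim: a => //= a IH /IH; case/vanishes_Dtot.
Qed.

(** On the prolonged graph each differential consequence of the invariant surface condition is an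
    iterated derivative of a function vanishing identically on the open set [X]. *)
Lemma jet_of_Qman r (U : set (base R)) (xi zeta : base R -> R) :
  open U -> smooth_on U xi -> smooth_on U zeta ->
  (forall x, X x -> U (x, g x) /\
     zeta (x, g x) = xi (x, g x) * 'D_D1 g x + 'D_D2 g x) ->
  forall x, X x -> (0 < r)%N -> Qman r (Qzeta xi U zeta) (jet_of r g x).
Proof.
move=> oU Sxi Sz H x Xx r0; split.
  by rewrite jbase_jet_of; have [] := H x Xx.
(* The characteristic lives on [J^1], so its consequence of index [(a, b)] lives on the jets of
   order [a + b + 1]; this order is at most [r] because [a + b < r]. *)
move=> a b ab; rewrite jproj_jet_of; last first.
  by rewrite addnA addn1.
suff V : vanishes (charact (Qzeta xi U zeta)).
  by have [ O [_ _ HO]] := vanishes_iterD a b V; have [] := HO x Xx.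
have oB := @open_jbase 1 _ oU.
exists (@jbase R 1 @^-1` U); split=> // [n|y Xy].
  have Sx1 := @smooth_jbase 1 _ _ oU Sxi n.
  have Sz1 := @smooth_jbase 1 _ _ oU Sz n.
  have u10 := @ucoord_smooth 1 1 0 (@jbase R 1 @^-1` U) n.
  have u01 := @ucoord_smooth 1 0 1 (@jbase R 1 @^-1` U) n.
  by apply: CnB => //; [apply: CnB|]; rewrite //; apply: CnM => //; exact: Cn_cst.
have [Uy zE] := H y Xy; split; first by rewrite /preimage /= jbase_jet_of.
by rewrite /charact /= jbase_jet_of !ucoord_jet_of //= zE; ring.
Qed.

End Prolongation.
End JetAlgebra.

(** * Primitives depending on parameters *)

Section Antiderivative.
Context {R : realType}.

Lemma mvt_bound (P h : R -> R) (t0 t M : R) :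
  (forall s, `|s - t0| <= `|t - t0| -> is_derive s 1 P (h s)) ->
  (forall s, `|s - t0| <= `|t - t0| -> `|h s| <= M) ->
  `|P t - P t0| <= M * `|t - t0|.
Proof.
move=> dP hM.
have st s : 0 <= s <= 1 -> `|s * (t - t0) + t0 - t0| <= `|t - t0|.
  by move=> /andP[s0 s1]; rewrite addrK normrM ger0_norm // ler_piMl.
have [s /st s01|s /st s01 ->] := @mvt R P h t0 t; first exact: dP.
by rewrite normrM ler_wpM2r // hM.
Qed.

Lemma antiderivative_unique (P Q h : R -> R) (t0 t : R) :
  (forall s, `|s - t0| <= `|t - t0| -> is_derive s 1 P (h s)) ->
  (forall s, `|s - t0| <= `|t - t0| -> is_derive s 1 Q (h s)) ->
  P t0 = Q t0 -> P t = Q t.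
Proof.
move=> dP dQ E.
have := @mvt_bound (P - Q) (fun=> 0) t0 t 0.
rewrite mul0r => H; apply/eqP; rewrite -subr_eq0 -normr_le0.
have -> : P t - Q t = (P - Q) t - (P - Q) t0.
  by rewrite -[(P - Q) t]/(P t - Q t) -[(P - Q) t0]/(P t0 - Q t0) E subrr subr0.
apply: H => s sE; last by rewrite normr0.
by apply: is_derive_eq (is_deriveB (dP s sE) (dQ s sE)) _; rewrite subrr.
Qed.

Lemma antiderivative_segment (g : R -> R) (a b : R) : continuous g ->
  exists P : R -> R, forall s, a < s < b -> is_derive s 1 P (g s).
Proof.
move=> cg.
exists (fun x => \int[lebesgue_measure]_(t in [set` `[a, x]]) g t)%R.
move=> s /andP[as_ sb].
have ig : lebesgue_measure.-integrable `[a, b] (EFin \o g).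
  apply: continuous_compact_integrable; first exact: segment_compact.
  by apply: continuous_subspaceT.
have [dP DP] := continuous_FTC1_closed sb ig as_ (cg s).
by split; [exact: dP|rewrite -derive1E; exact: DP].
Qed.

(** Precomposition with the retraction [clip] onto the closed interval makes [g] continuous on the
    whole line without changing it inside. *)
Lemma antiderivative_ball (g : R -> R) (t0 r : R) : 0 < r ->
  (forall s, `|s - t0| <= r -> {for s, continuous g}) ->
  exists P : R -> R, P t0 = 0 /\ forall s, `|s - t0| < r -> is_derive s 1 P (g s).
Proof.
move=> r0 cg.
pose clip (s : R) := Num.max (t0 - r) (Num.min (t0 + r) s).
have clipI s : `|clip s - t0| <= r.
  have c1 : t0 - r <= clip s by rewrite le_max lexx.
  have c2 : clip s <= t0 + r by rewrite ge_max ge_min lexx andbT; lra.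
  by rewrite ler_norml; apply/andP; split; lra.
have clipE s : `|s - t0| < r -> clip s = s.
  rewrite ltr_norml => /andP[s1 s2]; rewrite /clip.
  by rewrite min_r ?max_r //; lra.
have cclip : continuous clip.
  move=> s; apply: (@continuous_max _ _ (fun=> t0 - r) (fun s => Num.min (t0 + r) s)).
    exact: cst_continuous.
  apply: (@continuous_min _ _ (fun=> t0 + r) id); first exact: cst_continuous.
  exact: cvg_id.
have cgc : continuous (g \o clip).
  by move=> s; apply: continuous_comp; [exact: cclip|exact: cg].
have [P dP] := antiderivative_segment (t0 - r) (t0 + r) cgc.
exists (fun s => P s - P t0); split; first exact: subrr.
move=> s sr; have sr' : t0 - r < s < t0 + r.
  by move: sr; rewrite ltr_norml => /andP[s1 s2]; apply/andP; split; lra.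
apply: is_derive_eq (is_deriveB (dP s sr') (is_derive_cst (P t0) s 1)) _.
by rewrite subr0 /= clipE.
Qed.

(** Nothing controls [g] near the ends of the open interval, so primitives on smaller closed
    intervals are glued. The point [t] uses the radius halfway between its distance to [t0] and [d];
    normalisation at [t0] makes the pieces agree. *)
Lemma antiderivative_open (g : R -> R) (t0 d : R) : 0 < d ->
  (forall s, `|s - t0| < d -> {for s, continuous g}) ->
  exists P : R -> R, P t0 = 0 /\ forall s, `|s - t0| < d -> is_derive s 1 P (g s).
Proof.
move=> d0 cg.
have H r : exists P : R -> R, 0 < r < d ->
    P t0 = 0 /\ forall s, `|s - t0| < r -> is_derive s 1 P (g s).
  have [/andP[r0 rd]|nr] := boolP (0 < r < d); last by exists (fun=> 0).
  have [P HP] := antiderivative_ball r0 (fun s sr => cg s (le_lt_trans sr rd)).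
  by exists P.
have {H} [P HP] := choice H.
pose r (t : R) := (`|t - t0| + d) / 2.
have rP t : `|t - t0| < d -> `|t - t0| < r t < d.
  by move=> td; apply/andP; split; rewrite /r; lra.
have r0 t : `|t - t0| < d -> 0 < r t < d.
  by move=> /rP /andP[H1 ->]; rewrite (le_lt_trans _ H1).
have P0 t : `|t - t0| < d -> P (r t) t0 = 0 by move=> /r0/HP[].
have dP t s : `|t - t0| < d -> `|s - t0| < r t -> is_derive s 1 (P (r t)) (g s).
  by move=> /r0/HP[_]; apply.
exists (fun t => P (r t) t); split.
  by apply: P0; rewrite subrr normr0.
move=> t td; have [/andP[tr rd]] := rP t td.
pose e := r t - `|t - t0|; have e0 : 0 < e by rewrite subr_gt0.
have near_eq : \forall s \near t, P (r t) s = P (r s) s.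
  apply: (norm_near e0) => h he.
  have hr : `|h + t - t0| < r t.
    by rewrite -addrA (le_lt_trans (ler_normD _ _)) // -ltrBrDr.
  have hd := lt_trans hr rd.
  apply: (@antiderivative_unique _ _ g t0) => [s sh|s sh|].
  - by apply: dP => //; exact: le_lt_trans sh hr.
  - by apply: dP => //; apply: le_lt_trans sh _; have /andP[] := rP _ hd.
  - by rewrite !P0.
by apply: near_eq_is_derive near_eq _; exact: dP.
Qed.
End Antiderivative.

Section Primitive.
Context {R : realType}.
Notation base := (base R).
Notation e1 := ((1, 0, 0) : base).

Lemma ball_coord (p q : base) (d : R) : ball p d q <->
  [/\ `|q.1.1 - p.1.1| < d, `|q.1.2 - p.1.2| < d & `|q.2 - p.2| < d].
Proof.
rewrite -ball_normE /ball_ /= distrC !prod_normE /= !gt_max.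
split; first by move=> /andP[/andP[]].
by case=> -> -> ->.
Qed.

Lemma is_derive_first (F : base -> R) (q : base) x :
  is_derive q e1 F x <-> is_derive q.1.1 1 (fun s => F (s, q.1.2, q.2)) x.
Proof.
have E : (fun h : R => h^-1 *: ((F \o shift q) (h *: e1) - F q)) =
  (fun h : R => h^-1 *: (((fun s => F (s, q.1.2, q.2)) \o shift q.1.1) (h *: (1 : R))
     - F (q.1.1, q.1.2, q.2))).
  apply/funext => h; case: q => [[a b] c] /=; congr (_ *: (F _ - _)).
  by rewrite -[LHS]/(h * 1 + a, h * 0 + b, h * 0 + c) !mulr0 !add0r.
by split=> -[H1 H2]; split; move: H1 H2; rewrite /derivable /derive E.
Qed.

(** Compactness of the segment of first coordinates makes the radius [n] uniform along it. *)
Lemma tube (G : base -> R) (t0 : R) (q : base) (e : R) : 0 < e ->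
  (forall s, `|s - t0| <= `|q.1.1 - t0| -> {for ((s, q.1.2, q.2) : base), continuous G}) ->
  exists2 n : R, 0 < n & forall s (w : base), `|s - t0| <= `|q.1.1 - t0| -> `|w| < n ->
    `|G (w + (s, q.1.2, q.2)) - G (s, q.1.2, q.2)| < e.
Proof.
move=> e0 cG; pose r := `|q.1.1 - t0|.
have K : near_covering `[t0 - r, t0 + r]%classic.
  by apply/compact_near_coveringP; exact: segment_compact.
have Kr s : `[t0 - r, t0 + r]%classic s <-> `|s - t0| <= r.
  by rewrite /= in_itv /= ler_norml; split=> /andP[H1 H2]; apply/andP; split; lra.
have e20 : 0 < e / 2 by exact: divr_gt0.
have /near0_norm[n n0 H] : \forall w \near (0 : base), `[t0 - r, t0 + r]%classic `<=`
    (fun s => `|G (w + (s, q.1.2, q.2)) - G (s, q.1.2, q.2)| < e).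
  apply: (K base (nbhs (0 : base)) (fun w s =>
    `|G (w + (s, q.1.2, q.2)) - G (s, q.1.2, q.2)| < e)) => x /Kr xr.
  have [n n0 Hn] := eps_continuous (cG _ xr) e20.
  have n20 : 0 < n / 2 by exact: divr_gt0.
  exists (ball x (n / 2), ball (0 : base) (n / 2)); first by split; exact: nbhsx_ballx.
  move=> [y w] [] /=; rewrite -!ball_normE /ball_ /= sub0r normrN distrC => yx wn.
  have yn : `|((y - x, 0, 0) : base)| < n / 2 by rewrite base_norm normr0 !gt_max yx n20.
  have E1 : (y, q.1.2, q.2) = (y - x, 0, 0) + (x, q.1.2, q.2) :> base.
    by rewrite -[RHS]/(y - x + x, 0 + _, 0 + _) subrK !add0r.
  have H1 : `|G (x, q.1.2, q.2) - G (y, q.1.2, q.2)| < e / 2.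
    by rewrite E1; apply: Hn; apply: lt_trans yn _; rewrite ltr_pdivrMr // ltr_pMr // ltr1n.
  have H2 : `|G (x, q.1.2, q.2) - G (w + (y, q.1.2, q.2))| < e / 2.
    rewrite E1 addrA; apply: Hn; rewrite (splitr n).
    by apply: le_lt_trans (ler_normD _ _) _; exact: ltrD.
  rewrite (splitr e) -(subrKA (G (x, q.1.2, q.2))).
  by rewrite (le_lt_trans (ler_normD _ _)) // ltrD // distrC.
by exists n => // s w sr wn; apply: H => //; exact/Kr.
Qed.

Variables (p0 : base) (d : R).
Hypothesis d0 : 0 < d.
Let B := ball p0 d.
Let t0 := p0.1.1.

(** For the maximum norm a ball is a cube, so it contains the segment in the first coordinate from
    any of its points to the central slice. *)
Lemma slice_ball q s : B q -> `|s - t0| <= `|q.1.1 - t0| -> B (s, q.1.2, q.2).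
Proof.
by move=> /ball_coord[q1 q2 q3] sq; apply/ball_coord; split=> //; exact: le_lt_trans q1.
Qed.

Definition primitive (phi psi : base -> R) := forall q, B q ->
  is_derive q e1 phi (psi q) /\ phi (t0, q.1.2, q.2) = 0.

Lemma primitive_slice phi psi q : primitive phi psi -> B q ->
  (forall s, `|s - t0| <= `|q.1.1 - t0| ->
     is_derive s 1 (fun s => phi (s, q.1.2, q.2)) (psi (s, q.1.2, q.2))) /\
  phi (t0, q.1.2, q.2) = 0.
Proof.
move=> P Bq; split; last by have [] := P q Bq.
move=> s sq; have [D _] := P _ (slice_ball Bq sq).
by move/is_derive_first: D.
Qed.

Lemma primitive_bound phi psi q M : primitive phi psi -> B q ->
  (forall s, `|s - t0| <= `|q.1.1 - t0| -> `|psi (s, q.1.2, q.2)| <= M) ->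
  `|phi q| <= M * `|q.1.1 - t0|.
Proof.
move=> P Bq HM; have [D Z] := primitive_slice P Bq.
have := mvt_bound D HM; rewrite Z subr0.
by rewrite (_ : (q.1.1, q.1.2, q.2) = q) //; case: (q) => [[]].
Qed.

(** The primitives are chosen separately on each line parallel to the first axis, which says nothing
    about the other two variables. Normalisation on the central slice determines them on the cube
    and makes regularity provable afterwards. *)
Lemma primitive_exists psi : Cn 0 B psi -> exists phi, primitive phi psi.
Proof.
move=> cpsi.
have H (x : R * R) : exists P : R -> R, B (t0, x.1, x.2) ->
   P t0 = 0 /\ forall s, `|s - t0| < d -> is_derive s 1 P (psi (s, x.1, x.2)).
  have [Bx|nB] := pselect (B (t0, x.1, x.2)); last by exists (fun=> 0).
  have [|P HP] := @antiderivative_open R (fun s => psi (s, x.1, x.2)) t0 d d0.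
    move=> s sd; have Bs : B (s, x.1, x.2).
      by move/ball_coord: Bx => [_ H2 H3]; apply/ball_coord.
    have c2 : {for s, continuous (fun s : R => (s, x.1))}.
      have c1 : {for s, continuous (fun s : R => x.1)} by exact: cst_continuous.
      have c0 : {for s, continuous (fun s : R => s)} by exact: cvg_id.
      exact: cvg_pair c0 c1.
    have c3 : {for s, continuous (fun s : R => x.2)} by exact: cst_continuous.
    have c4 : {for s, continuous (fun s : R => ((s, x.1, x.2) : base))} by exact: cvg_pair c2 c3.
    exact: continuous_comp c4 (cpsi _ Bs).
  by exists P.
have [P HP] := choice H.
exists (fun q => P (q.1.2, q.2) q.1.1) => q Bq.
have [q1 q2 q3] := (ball_coord _ _ _).1 Bq.
have Bq0 : B (t0, (q.1.2, q.2).1, (q.1.2, q.2).2).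
  by apply/ball_coord; split=> //=; rewrite subrr normr0.
have [Z D] := HP _ Bq0; split=> //=.
apply/is_derive_first; have := D _ q1 => /=.
by rewrite (_ : (q.1.1, q.1.2, q.2) = q) //; case: (q) => [[]].
Qed.

End Primitive.

Lemma is_derive_eps {R : realType} {V : normedModType R} (f : V -> R) q v l :
  (forall e : R, 0 < e -> exists2 n : R, 0 < n & forall h : R, `|h| < n ->
     `|f (h *: v + q) - f q - h * l| <= e * `|h|) -> is_derive q v f l.
Proof.
move=> H.
have C : (fun h : R => h^-1 *: ((f \o shift q) (h *: v) - f q)) @ 0^' --> l.
  apply/cvgrPdist_le => e /H [n n0 Hn].
  apply/nbhs_ballP; exists n => //= h; rewrite -ball_normE /ball_ /= sub0r normrN => hn h0.
  have hp : 0 < `|h| by rewrite normr_gt0.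
  rewrite -(ler_pM2l hp) mulrC -normrM.
  have -> : (l - h^-1 *: (f (h *: v + q) - f q)) * h =
     - (f (h *: v + q) - f q - h * l).
    by rewrite -[_ *: (_ - _)]/(_ * _); field.
  by rewrite normrN [leRHS]mulrC Hn.
by split; [apply/cvg_ex; exists l|exact/cvg_lim].
Qed.

(** * Primitives preserve the class C^n: differentiation under the integral sign *)

Section PrimitiveSmooth.
Context {R : realType}.
Notation base := (base R).
Notation e1 := ((1, 0, 0) : base).
Variables (p0 : base) (d : R).
Hypothesis d0 : 0 < d.
Let B := ball p0 d.
Let t0 := p0.1.1.

Let oB : open B. Proof. exact: ball_open. Qed.

Let at_eta (q : base) : (q.1.1, q.1.2, q.2) = q.
Proof. by case: q => [[]]. Qed.

Let small_in (q : base) : B q -> exists2 n : R, 0 < n & forall h, `|h| < n -> B (h + q).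
Proof. by move=> Bq; exact: near_norm (open_near oB Bq). Qed.

Let Bt (q : base) : B q -> `|q.1.1 - t0| < d.
Proof. by move/ball_coord=> []. Qed.

(** The displacement is split at the corner [q']: the move across the lines is controlled by uniform
    closeness of [psi] along the segment of integration, the move along the line by a local bound
    [M] for [psi]. *)
Lemma primitive_continuous (phi psi : base -> R) : primitive p0 d phi psi ->
  Cn 0 B psi -> Cn 0 B phi.
Proof.
move=> P cpsi q Bq; apply: continuous_eps => e e0.
have e2 : 0 < e / (2 * d) by rewrite divr_gt0 // mulr_gt0.
have cs s : `|s - t0| <= `|q.1.1 - t0| -> {for ((s, q.1.2, q.2) : base), continuous psi}.
  by move=> sq; apply: cpsi; exact: slice_ball sq.
have [n1 n10 H1] := tube e2 cs.
have [n2 n20 H2] := small_in Bq.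
have [n3 n30 H3] := eps_continuous (cpsi q Bq) ltr01.
pose M := `|psi q| + 1; have M0 : 0 < M by rewrite ltr_wpDl.
pose n4 := e / (2 * M); have n40 : 0 < n4 by rewrite divr_gt0 // mulr_gt0.
exists (Num.min (Num.min n1 n2) (Num.min n3 n4)); first by rewrite !lt_min n10 n20 n30.
move=> w; rewrite !lt_min => /andP[/andP[w1 w2] /andP[w3 w4]].
have Bw := H2 _ w2.
have [c1 c2 c3] := base_norm_le w.
pose q' : base := (q.1.1, (w + q).1.2, (w + q).2).
have Bq' : B q'.
  by move/ball_coord: Bq => [b1 _ _]; move/ball_coord: Bw => [_ b2 b3]; apply/ball_coord.
have step1 : `|phi q' - phi q| < e / 2.
  have [D1 Z1] := primitive_slice P Bq; have [D2 Z2] := primitive_slice P Bq'.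
  have := @mvt_bound _ (fun s => phi (s, q'.1.2, q'.2) - phi (s, q.1.2, q.2))
    (fun s => psi (s, q'.1.2, q'.2) - psi (s, q.1.2, q.2)) t0 q.1.1 (e / (2 * d)).
  rewrite -/t0 in Z1 Z2; rewrite Z1 Z2 !at_eta subrr subr0 -/q'.
  move=> H; have {}H := H _ _.
  apply: le_lt_trans (H _ _) _.
  - by move=> s sq; exact: is_deriveB (D2 s sq) (D1 s sq).
  - move=> s sq; have := H1 s (0, w.1.2, w.2) sq.
    rewrite base_norm normr0 !gt_max n10 (le_lt_trans c2 w1) (le_lt_trans c3 w1).
    move=> /(_ isT) /ltW.
    by rewrite -[X in psi X - _]/(0 + s, w.1.2 + q.1.2, w.2 + q.2) add0r.
  - have -> : e / 2 = e / (2 * d) * d by field; rewrite gt_eqF.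
    by rewrite ltr_pM2l //; exact: Bt.
have step2 : `|phi (w + q) - phi q'| < e / 2.
  have := @mvt_bound _ (fun s => phi (s, (w + q).1.2, (w + q).2))
    (fun s => psi (s, (w + q).1.2, (w + q).2)) q.1.1 (w + q).1.1 M.
  rewrite at_eta -/q' -[(w + q).1.1]/(w.1.1 + q.1.1) addrK => H.
  have {}H := H _ _.
  apply: le_lt_trans (H _ _) _.
  - move=> s sw; have Bs : B (s, (w + q).1.2, (w + q).2).
      have := H2 (s - q.1.1, w.1.2, w.2); rewrite -[_ + q]/(s - q.1.1 + q.1.1, _, _) subrK; apply.
      rewrite base_norm !gt_max (le_lt_trans sw (le_lt_trans c1 w2)).
      by rewrite (le_lt_trans c2 w2) (le_lt_trans c3 w2).
    by have [/is_derive_first] := P _ Bs.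
  - move=> s sw.
    have := H3 (s - q.1.1, w.1.2, w.2); rewrite -[_ + q]/(s - q.1.1 + q.1.1, _, _) subrK.
    rewrite base_norm !gt_max (le_lt_trans sw (le_lt_trans c1 w3)).
    rewrite (le_lt_trans c2 w3) (le_lt_trans c3 w3) => /(_ isT).
    set x := psi _; set y := psi _; rewrite /M -/x => xy.
    have := ler_normB x (x - y); rewrite opprB addrC subrK => H'.
    by rewrite (le_trans H') // lerD2l ltW.
  - have -> : e / 2 = M * n4 by rewrite /n4; field; rewrite gt_eqF.
    by rewrite ltr_pM2l // (le_lt_trans c1).
rewrite (splitr e) -(subrKA (phi q')) (le_lt_trans (ler_normD _ _)) //.
by rewrite ltrD // distrC.
Qed.

(** Differentiation under the integral sign in a direction tangent to the slices. The increment of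
    [phi] minus [h * chi] is itself a primitive, whose integrand is at most [e / d] times [|h|]
    uniformly on a segment of length less than [d]. *)
Lemma primitive_derive (phi psi chi : base -> R) (v : base) : v.1.1 = 0 ->
  primitive p0 d phi psi -> Cn 1 B psi -> primitive p0 d chi ('D_v psi) ->
  forall q, B q -> is_derive q v phi (chi q).
Proof.
move=> v0 P Cpsi P' q Bq; have [dpsi Dpsi] := Cpsi.
apply: is_derive_eps => e e0.
have ed : 0 < e / d by exact: divr_gt0.
have cs s : `|s - t0| <= `|q.1.1 - t0| -> {for ((s, q.1.2, q.2) : base), continuous ('D_v psi)}.
  by move=> sq; apply: Dpsi; exact: slice_ball sq.
have [n1 n10 H1] := tube ed cs.
have [n2 n20 H2] := small_in Bq.
have K : 0 < `|v| + 1 by rewrite ltr_wpDl.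
pose n := Num.min n1 n2 / (`|v| + 1).
exists n; first by rewrite divr_gt0 // lt_min n10.
move=> h hn.
have hv a : `|a| <= `|h| -> `|a *: v| < n1 /\ `|a *: v| < n2.
  move=> ah; apply/andP; rewrite -lt_min normrZ.
  apply: (@le_lt_trans _ _ (`|h| * (`|v| + 1))).
    by rewrite ler_pM // lerDl.
  by rewrite -ltr_pdivlMr.
have Bh a : `|a| <= `|h| -> B (a *: v + q) by move=> /hv[_]; exact: H2.
have atE (a s : R) : (s, (a *: v + q).1.2, (a *: v + q).2) = a *: v + (s, q.1.2, q.2).
  by rewrite -[RHS]/(a * v.1.1 + s, _, _) v0 mulr0 add0r.
have E1 : (h *: v + q).1.1 = q.1.1 by rewrite -[LHS]/(h * v.1.1 + q.1.1) v0 mulr0 add0r.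
have Bhh := Bh h (lexx _).
have [D1 Z1] := primitive_slice P Bq; have [D3 Z3] := primitive_slice P' Bq.
have [D2 Z2] := primitive_slice P Bhh.
have := @mvt_bound _ (fun s => phi (s, (h *: v + q).1.2, (h *: v + q).2)
   - phi (s, q.1.2, q.2) - h * chi (s, q.1.2, q.2))
  (fun s => psi (s, (h *: v + q).1.2, (h *: v + q).2)
   - psi (s, q.1.2, q.2) - h * 'D_v psi (s, q.1.2, q.2)) t0 q.1.1 (e / d * `|h|).
have E2 : (q.1.1, (h *: v + q).1.2, (h *: v + q).2) = h *: v + q.
  by rewrite -{1}E1 at_eta.
rewrite Z1 Z2 Z3 mulr0 !subr0 E2 !at_eta => H; have {}H := H _ _.
apply: le_trans (H _ _) _.
- move=> s sq; apply: is_deriveB; last exact: is_deriveZ (D3 s sq).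
  by apply: is_deriveB (D1 s sq); apply: D2; rewrite E1.
- move=> s sq; rewrite atE; apply: incr_dir => a ah.
    rewrite -atE; apply/diff_derivable/dpsi; apply: slice_ball (Bh a ah) _.
    by rewrite -[(a *: v + q).1.1]/(a * v.1.1 + q.1.1) v0 mulr0 add0r.
  by apply/ltW/H1 => //; have [] := hv a ah.
- rewrite mulrAC ler_wpM2r // -{2}(divfK (lt0r_neq0 d0) e) ler_wpM2l // ?ltW //.
  exact: Bt.
Qed.

(** Along directions tangent to the slices the derivative of a primitive is the primitive of the
    derivative, to which the induction hypothesis applies; along the first axis it is [psi]. *)
Lemma primitive_Cn n (phi psi : base -> R) : primitive p0 d phi psi ->
  Cn n B psi -> Cn n B phi.
Proof.
elim: n phi psi => [|n IH] phi psi P Cpsi; first exact: primitive_continuous P Cpsi.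
have [_ Dpsi] := Cpsi.
have C1 : Cn 1 B psi.
  by elim: n {IH Dpsi} Cpsi => // n IHn /CnW.
have cD v : Cn 0 B ('D_v psi) by have [_ D] := C1; exact: D.
have DP v : v.1.1 = 0 -> (forall q, B q -> derivable phi q v) /\ Cn n B ('D_v phi).
  move=> v0; have [chi Pchi] := primitive_exists d0 (cD v).
  have D := primitive_derive v0 P C1 Pchi.
  split=> [q /D[]//|].
  by apply: Cn_eq oB _ (IH _ _ Pchi (Dpsi v)) => q /D[_ ->].
have [[d2 C2] [d3 C3]] := (DP (0, 1, 0) erefl, DP (0, 0, 1) erefl).
apply: (Cn_partials oB _ d2 d3 _ C2 C3).
- by move=> q /P[[]].
- apply: Cn_eq oB _ (CnW Cpsi) => q /P[[_ E] _]; exact: esym E.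
Qed.

End PrimitiveSmooth.

(** * Flow of a scalar ordinary differential equation *)

Section Geometric.
Context {R : realType}.
Notation h := (2^-1 : R).

Lemma half_pow_ge0 n : 0 <= h ^+ n.
Proof. by rewrite exprn_ge0 // invr_ge0. Qed.

Lemma half_pow_small (e : R) : 0 < e -> exists n, h ^+ n < e.
Proof.
move=> e0; have [n _ H] := near_infty_natSinv_expn_lt (PosNum e0).
exists n; have := H n (leqnn n) => /=.
by rewrite exprVn div1r.
Qed.

Lemma le_geometric (x y C : R) : (forall n, x <= y + C * h ^+ n) -> x <= y.
Proof.
move=> H; apply/ler_addgt0Pl => e e0.
have K0 : 0 < `|C| + 1 by rewrite ltr_wpDl.
have [n Hn] := half_pow_small (divr_gt0 e0 K0).
apply: le_trans (H n) _; rewrite addrC lerD2r.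
apply: (@le_trans _ _ ((`|C| + 1) * h ^+ n)).
  by rewrite ler_wpM2r ?half_pow_ge0 // (le_trans (ler_norm _)) // lerDl.
by rewrite mulrC -ler_pdivlMr // ltW.
Qed.

(** The intervals of radius [2 * h ^+ n] around [u n] meet pairwise by telescoping, and the supremum
    of their lower ends lies in all of them. The explicit rate makes later convergence uniform in
    the base point. *)
Lemma geometric_limit (u : nat -> R) : (forall n, `|u n.+1 - u n| <= h ^+ n) ->
  exists l, forall n, `|u n - l| <= 2 * h ^+ n.
Proof.
move=> uh.
have step n k : `|u (k + n)%N - u n| <= 2 * h ^+ n - 2 * h ^+ (k + n).
  elim: k => [|k IH]; first by rewrite add0n !subrr normr0.
  rewrite addSn -(subrKA (u (k + n)%N)) (le_trans (ler_normD _ _)) //.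
  have := uh (k + n)%N; rewrite exprS mulVKf ?pnatr_eq0 //.
  set x := `|_|; set y := `|_| in IH *; move: IH.
  have -> : 2 * h ^+ (k + n) = h ^+ (k + n) + h ^+ (k + n) by rewrite mulr_natl mulr2n.
  by lra.
have le_ab m n : u m - 2 * h ^+ m <= u n + 2 * h ^+ n.
  have hm := half_pow_ge0 m; have hn := half_pow_ge0 n.
  have [mn|nm] := leqP m n.
    have := step m (n - m)%N; rewrite subnK // ler_norml => /andP[H _].
    by lra.
  have := step n (m - n)%N; rewrite subnK ?(ltnW nm) // ler_norml => /andP[_ H].
  by lra.
pose A := range (fun n => u n - 2 * h ^+ n).
have ubA n : ubound A (u n + 2 * h ^+ n) by move=> _ [m _ <-].
have A0 : A !=set0 by exists (u 0%N - 2 * h ^+ 0), 0%N.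
have hA : has_sup A by split=> //; exists (u 0%N + 2 * h ^+ 0).
exists (sup A) => n; rewrite ler_norml; apply/andP; split.
  by have := ge_sup A0 (ubA n); lra.
have : u n - 2 * h ^+ n <= sup A by apply: ub_le_sup; [case: hA|exists n].
by lra.
Qed.

End Geometric.

Section LocalBounds.
Context {R : realType}.
Notation base := (base R).

Lemma ball_convex {V : normedModType R} (p0 p v : V) (r s : R) : 0 <= s <= 1 ->
  ball p0 r p -> ball p0 r (v + p) -> ball p0 r (s *: v + p).
Proof.
rewrite -!ball_normE /ball_ /= => /andP[s0 s1] Bp Bv.
have E t : p0 - (t + p) = (p0 - p) - t by rewrite opprD addrCA addrC.
move: Bv; rewrite !E => Bv.
have -> : p0 - p - s *: v = s *: (p0 - p - v) + (1 - s) *: (p0 - p).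
  by rewrite scalerBr scalerBl scale1r [RHS]addrC addrA subrK.
apply: le_lt_trans (ler_normD _ _) _.
rewrite !normrZ (ger0_norm s0) ger0_norm ?subr_ge0 //.
have [->|s_neq0] := eqVneq s 0; first by rewrite mul0r add0r subr0 mul1r.
have sp : 0 < s by rewrite lt_def s_neq0.
have H1 : s * `|p0 - p - v| < s * r by rewrite ltr_pM2l.
have H2 : (1 - s) * `|p0 - p| <= (1 - s) * r by rewrite ler_wpM2l ?subr_ge0 // ltW.
have -> : r = s * r + (1 - s) * r by rewrite mulrBl mul1r addrC subrK.
exact: ltr_leD.
Qed.

Lemma local_bounds (N : set base) (p0 : base) (G : nat -> base -> R) (n : nat) :
  open N -> N p0 -> (forall i, (i < n)%N -> smooth_on N (G i)) ->
  exists r K : R, [/\ 0 < r, 1 <= K & forall q, ball p0 r q ->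
     N q /\ forall i, (i < n)%N -> `|G i q| <= K].
Proof.
move=> oN Np; elim: n => [|n IH] SG.
  have [r r0 H] := near_norm (open_near oN Np).
  exists r, 1; split=> // q; rewrite -ball_normE /ball_ /= distrC => qr.
  by split=> //; have := H _ qr; rewrite subrK.
have [|r [K [r0 K1 H]]] := IH; first by move=> i ni; apply: SG; exact: ltnW.
have cG : {for p0, continuous (G n)} by exact: (Cn_continuous (SG n (ltnSn n) 0%N) Np).
have [r' r'0 H'] := eps_continuous cG ltr01.
exists (Num.min r r'), (Num.max K (`|G n p0| + 1)); split.
- by rewrite lt_min r0.
- by rewrite le_max K1.
move=> q; rewrite -ball_normE /ball_ /= lt_min => /andP[qr qr'].
have [] := H q; first by rewrite -ball_normE.
move=> Nq HG; split=> // i; rewrite ltnS leq_eqVlt => /orP[/eqP ->|/HG]; last first.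
  by move=> Gi; rewrite le_max Gi.
have := H' (q - p0); rewrite distrC => /(_ qr'); rewrite subrK => Gq.
rewrite le_max; apply/orP; right.
have := ler_normB (G n p0) (G n p0 - G n q); rewrite opprB addrC subrK => H''.
by rewrite (le_trans H'') // lerD2l ltW.
Qed.

Lemma line_in_ball (p0 p v : base) (r s : R) : 0 <= s <= 1 ->
  ball p0 r p -> ball p0 r (v + p) -> ball p0 r (s *: v + p).
Proof. exact: ball_convex. Qed.

Section Box.
Variables (N : set base) (p0 : base) (r K : R) (g : base -> R).
Hypotheses (Sg : smooth_on N g) (BN : forall q, ball p0 r q -> N q).

Lemma lipschitz_box : (forall q, ball p0 r q -> `|pd2 g q| <= K /\ `|pd3 g q| <= K) ->
  forall (p : base) (a b : R), ball p0 r p -> ball p0 r ((0, a, b) + p) ->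
  `|g ((0, a, b) + p) - g p| <= K * (`|a| + `|b|).
Proof.
move=> HK p a b Bp Bv.
have dg q : ball p0 r q -> differentiable g q.
  by move=> /BN; exact: Cn_differentiable (Sg 1%N).
have [s s01|s s01 ->] := @line_mvt _ _ g p (0, a, b).
  exact: diff_derivable (dg _ (line_in_ball s01 Bp Bv)).
have Bs := line_in_ball s01 Bp Bv; have [H2 H3] := HK _ Bs.
rewrite derive_base /= ?mul0r ?add0r; last exact: dg.
move: H2 H3; set x2 := pd2 g _; set x3 := pd3 g _; clearbody x2 x3 => H2 H3.
rewrite (le_trans (ler_normD _ _)) // !normrM mulrDr lerD // mulrC.
  by rewrite ler_wpM2r.
by rewrite ler_wpM2r.
Qed.

End Box.

(** The mean value theorem for [g] followed by the Lipschitz bound for [pd2 g] and [pd3 g]. The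
    first coordinate is kept fixed because solutions are compared at equal times. *)
Lemma taylor_box (N : set base) (p0 : base) (r K : R) (g : base -> R) :
  smooth_on N g -> (forall q, ball p0 r q -> N q) ->
  (forall q, ball p0 r q -> `|pd2 (pd2 g) q| <= K /\ `|pd3 (pd2 g) q| <= K) ->
  (forall q, ball p0 r q -> `|pd2 (pd3 g) q| <= K /\ `|pd3 (pd3 g) q| <= K) ->
  forall (p : base) (a b : R), ball p0 r p -> ball p0 r ((0, a, b) + p) ->
  `|g ((0, a, b) + p) - g p - (a * pd2 g p + b * pd3 g p)| <= K * (`|a| + `|b|) ^+ 2.
Proof.
move=> Sg BN HK2 HK3 p a b Bp Bv.
have K0 : 0 <= K by have [H _] := HK2 _ Bp; exact: le_trans H.
have dg q : ball p0 r q -> differentiable g q.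
  by move=> /BN; exact: Cn_differentiable (Sg 1%N).
have [s s01|s s01 ->] := @line_mvt _ _ g p (0, a, b).
  exact: diff_derivable (dg _ (line_in_ball s01 Bp Bv)).
have Bs := line_in_ball s01 Bp Bv.
rewrite derive_base /= ?mul0r ?add0r; last exact: dg.
have E : s *: ((0, a, b) : base) + p = (0, s * a, s * b) + p.
  by rewrite -[s *: _]/(s * 0, s * a, s * b) mulr0.
have := Bs; rewrite E => Bs'.
have L2 := lipschitz_box (smooth_derive _ Sg : smooth_on N (pd2 g)) BN HK2 Bp Bs'.
have L3 := lipschitz_box (smooth_derive _ Sg : smooth_on N (pd3 g)) BN HK3 Bp Bs'.
have sab : `|s * a| + `|s * b| <= `|a| + `|b|.
  move: s01 => /andP[s0 s1].
  by rewrite !normrM ger0_norm // lerD // ler_piMl.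
move: L2 L3; clear -sab K0.
set x2 := pd2 g (_ + p); set y2 := pd2 g p; set x3 := pd3 g (_ + p); set y3 := pd3 g p.
clearbody x2 y2 x3 y3 => L2 L3.
have -> : a * x2 + b * x3 - (a * y2 + b * y3) = a * (x2 - y2) + b * (x3 - y3) by ring.
rewrite (le_trans (ler_normD _ _)) // !normrM expr2 mulrA mulrDr mulrC.
have KK : K * (`|s * a| + `|s * b|) <= K * (`|a| + `|b|) by exact: ler_wpM2l.
by rewrite lerD // ?(mulrC `|b|) ler_wpM2r // (le_trans _ KK).
Qed.

Lemma primitive_B (p0 : base) (d : R) (phi psi phi' psi' : base -> R) :
  primitive p0 d phi psi -> primitive p0 d phi' psi' ->
  primitive p0 d (fun q => phi q - phi' q) (fun q => psi q - psi' q).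
Proof.
move=> P P' q Bq; have [D Z] := P q Bq; have [D' Z'] := P' q Bq.
by split; [exact: is_deriveB D D'|rewrite Z Z' subrr].
Qed.

End LocalBounds.

(** * Picard iteration with parameter and initial value *)

Section Picard.
Context {R : realType}.
Notation base := (base R).
Variables (f : base -> R) (N : set base) (p0 : base) (r K d : R).
Hypotheses (Sf : smooth_on N f) (K1 : 1 <= K) (r0 : 0 < r).
Hypotheses (d0 : 0 < d) (d1 : d <= 1) (dE : d + K * d = r / 2) (Kd : K * d <= 2^-1).
Hypothesis BN : forall q, ball p0 r q -> N q.
Hypothesis fK : forall q, ball p0 r q -> `|f q| <= K.
Hypothesis DfK : forall q, ball p0 r q -> `|pd2 f q| <= K /\ `|pd3 f q| <= K.

Let B := ball p0 d.
Let t0 := p0.1.1.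
Let oB : open B. Proof. exact: ball_open. Qed.
Let K0 : 0 <= K. Proof. exact: le_trans K1. Qed.
Let Bt (q : base) : B q -> `|q.1.1 - t0| < d.
Proof. by move/ball_coord=> []. Qed.

(** A total choice of primitive, with default the zero function; [primP] applies once [psi] is
    continuous on the cube. *)
Definition prim (psi : base -> R) : base -> R :=
  xget (fun=> 0) [set phi | primitive p0 d phi psi].

Lemma primP psi : Cn 0 B psi -> primitive p0 d (prim psi) psi.
Proof.
move=> /(primitive_exists d0)[phi Pphi].
by apply: (@xgetPex _ (fun=> 0) [set phi | primitive p0 d phi psi]); exists phi.
Qed.

(** A point of the base is read as (time, parameter, initial value), and the iteration is the
    integral equation of [w' = f (t, l, w)] with [w = q.2] at time [p0.1.1]. *)
Fixpoint picard (n : nat) : base -> R :=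
  match n with
  | 0 => fun q => q.2
  | n'.+1 => fun q => q.2 + prim (fun q => f (q.1, picard n' q)) q
  end.

(** The invariant set of the Picard map: the bound [r / 2] keeps the graph in the box where [f] is
    controlled, and it is reproduced because the initial value contributes at most [d] and the
    integral at most [K * d]. *)
Let admissible (w : base -> R) :=
  Cn 0 B w /\ forall q, B q -> `|w q - p0.2| <= r / 2.

Let graph_ball (w : base -> R) q : admissible w -> B q -> ball p0 r (q.1, w q).
Proof.
move=> [_ H] Bq; have /ball_coord[b1 b2 b3] := Bq.
have dr : d <= r.
  have : 0 <= K * d by rewrite mulr_ge0 // ltW.
  by move: dE r0; lra.
apply/ball_coord; split=> /=; [exact: lt_le_trans dr|exact: lt_le_trans dr|].
by apply: le_lt_trans (H q Bq) _; move: r0; lra.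
Qed.

Let graph_cont (w : base -> R) : admissible w -> Cn 0 B (fun q => f (q.1, w q)).
Proof.
move=> aw; apply: (Cn_graph oB aw.1 (Sf 0%N)) => q Bq.
exact: BN (graph_ball aw Bq).
Qed.

Let prim_small (w : base -> R) q : admissible w -> B q ->
  `|prim (fun q => f (q.1, w q)) q| <= K * d.
Proof.
move=> aw Bq; have P := primP (graph_cont aw).
apply: le_trans (primitive_bound P Bq (M := K) _) _.
  by move=> s sq; apply: fK; exact: graph_ball (slice_ball Bq sq).
by rewrite ler_wpM2l // ltW // Bt.
Qed.

Let step_admissible (w : base -> R) : admissible w ->
  admissible (fun q => q.2 + prim (fun q => f (q.1, w q)) q).
Proof.
move=> aw; have P := primP (graph_cont aw); split.
  have [_ _ S3] := @x3_smooth R.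
  exact: CnD oB (S3 B 0%N) (primitive_continuous d0 P (graph_cont aw)).
move=> q Bq; have := prim_small aw Bq; have /ball_coord[_ _ b3] := Bq.
rewrite addrAC => H; apply: le_trans (ler_normD _ _) _.
by rewrite -dE lerD // ltW.
Qed.

Lemma picard_admissible n : admissible (picard n).
Proof.
elim: n => [|n IH]; last exact: step_admissible.
split=> /=; first by have [_ _ S3] := @x3_smooth R; exact: (S3 B 0%N).
move=> q /ball_coord[_ _ b3]; rewrite (le_trans (ltW b3)) // -dE lerDl.
by rewrite mulr_ge0 // ltW.
Qed.

Let move_w (q : base) (a b : R) : (q.1, a) = ((0, 0, a - b) : base) + (q.1, b) :> base.
Proof.
case: q => [[x y] z].
by rewrite -[RHS]/(0 + x, 0 + y, a - b + b) !add0r subrK.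
Qed.

Let contraction (w w' : base -> R) (e : R) : admissible w -> admissible w' ->
  (forall q, B q -> `|w' q - w q| <= e) ->
  forall q, B q -> `|prim (fun q => f (q.1, w' q)) q - prim (fun q => f (q.1, w q)) q|
     <= 2^-1 * e.
Proof.
move=> aw aw' we q Bq.
have P := primitive_B (primP (graph_cont aw')) (primP (graph_cont aw)).
have e0 : 0 <= e by exact: le_trans (we q Bq).
apply: le_trans (primitive_bound P Bq (M := K * e) _) _.
  move=> s sq; have Bs := slice_ball Bq sq.
  have := lipschitz_box Sf BN DfK (graph_ball aw Bs) (a := 0)
    (b := w' (s, q.1.2, q.2) - w (s, q.1.2, q.2)).
  rewrite -(move_w (s, q.1.2, q.2)) => /(_ (graph_ball aw' Bs)).
  by rewrite normr0 add0r => /le_trans -> //; rewrite ler_wpM2l // we.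
apply: (@le_trans _ _ (K * d * e)).
  by rewrite mulrAC ler_wpM2r // ler_wpM2l // ltW // Bt.
by rewrite ler_wpM2r.
Qed.

Lemma picard_step n q : B q -> `|picard n.+1 q - picard n q| <= 2^-1 ^+ n.
Proof.
elim: n q => [|n IH] q Bq.
  rewrite /= addrC addKr expr0.
  by rewrite (le_trans (prim_small (picard_admissible 0) Bq)) // (le_trans Kd) //; lra.
have := contraction (picard_admissible n) (picard_admissible n.+1) IH Bq.
by rewrite -exprS /= opprD addrACA subrr add0r.
Qed.

(** The constant is uniform in [n], hence survives in the limit. The value 4 closes the induction:
    with [K * d <= 1 / 2] the new increment is at most [|b| + (|a| + 4 (|a| + |b|)) / 2], which is
    below [4 (|a| + |b|)]. *)
Lemma picard_lipschitz n q (a b : R) : B q -> B ((0, a, b) + q) ->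
  `|picard n ((0, a, b) + q) - picard n q| <= 4 * (`|a| + `|b|).
Proof.
have ab0 : 0 <= `|a| + `|b| by rewrite addr_ge0.
elim: n q => [|n IH] q Bq Bq'.
  rewrite /= -[_ + q.2]/(b + q.2) addrK.
  by have := normr_ge0 a; have := normr_ge0 b; lra.
have aw := picard_admissible n; set w := picard n in IH aw *.
have [D1 Z1] := primitive_slice (primP (graph_cont aw)) Bq.
have [D2 Z2] := primitive_slice (primP (graph_cont aw)) Bq'.
set q' := (0, a, b) + q in Bq' D2 Z2 *.
have E1 : q'.1.1 = q.1.1 by rewrite -[LHS]/(0 + q.1.1) add0r.
have E2 : (q.1.1, q'.1.2, q'.2) = q' by rewrite -E1; case: (q') => [[]].
have E3 : (q.1.1, q.1.2, q.2) = q by case: (q) => [[]].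
have H : `|prim (fun q => f (q.1, w q)) q' - prim (fun q => f (q.1, w q)) q|
    <= K * (`|a| + 4 * (`|a| + `|b|)) * d.
  have := @mvt_bound _ (fun s => prim (fun q => f (q.1, w q)) (s, q'.1.2, q'.2)
     - prim (fun q => f (q.1, w q)) (s, q.1.2, q.2))
    (fun s => f ((s, q'.1.2, q'.2).1, w (s, q'.1.2, q'.2))
     - f ((s, q.1.2, q.2).1, w (s, q.1.2, q.2))) t0 q.1.1 (K * (`|a| + 4 * (`|a| + `|b|))).
  rewrite Z1 Z2 E2 E3 !subr0 => H; have {}H := H _ _.
  apply: le_trans (H _ _) _.
  - by move=> s sq; apply: is_deriveB (D1 s sq); apply: D2; rewrite E1.
  - move=> s sq; have Bs := slice_ball Bq sq.
    have Bs' : B (s, q'.1.2, q'.2) by apply: slice_ball Bq' _; rewrite E1.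
    have sE : (s, q'.1.2, q'.2) = (0, a, b) + (s, q.1.2, q.2) :> base.
      by rewrite -[RHS]/(0 + s, q'.1.2, q'.2) add0r.
    have IHs := IH _ Bs; rewrite -sE in IHs; have {}IHs := IHs Bs'.
    have := lipschitz_box Sf BN DfK (graph_ball aw Bs) (a := a)
      (b := w (s, q'.1.2, q'.2) - w (s, q.1.2, q.2)).
    rewrite -[_ + (_, w _)]/(0 + s, q'.1.2, w (s, q'.1.2, q'.2) - w (s, q.1.2, q.2)
      + w (s, q.1.2, q.2)) add0r subrK => /(_ (graph_ball aw Bs')) /le_trans -> //.
    by rewrite ler_wpM2l // lerD2l.
  - by rewrite ler_wpM2l ?(ltW (Bt Bq)) // mulr_ge0 // addr_ge0 // mulr_ge0.
have X0 : 0 <= `|a| + 4 * (`|a| + `|b|) by rewrite addr_ge0 // mulr_ge0.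
have H' : K * (`|a| + 4 * (`|a| + `|b|)) * d <= 2^-1 * (`|a| + 4 * (`|a| + `|b|)).
  by rewrite mulrAC; exact: ler_wpM2r.
rewrite /= -/w; move: (le_trans H H').
set P' := prim _ q'; set P := prim _ q; clearbody P P' => HP.
have -> : q'.2 + P' - (q.2 + P) = b + (P' - P).
  by rewrite -[q'.2]/(b + q.2) opprD addrACA addrK.
have := ler_normD b (P' - P); have := normr_ge0 a; have := normr_ge0 b.
by move: HP; set x := `|a|; set y := `|b|; set z := `|_ - _|; lra.
Qed.

(** The geometric rate is the same at all points of the cube. This carries over continuity, the
    bound defining [admissible] and the Lipschitz estimate; the fixed-point equation follows by
    comparing [W] with [picard n.+1] through [contraction]. *)
Lemma picard_limit : exists W : base -> R,
  [/\ Cn 0 B W, forall q, B q -> ball p0 r (q.1, W q),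
      primitive p0 d (fun q => W q - q.2) (fun q => f (q.1, W q)) &
      forall q (a b : R), B q -> B ((0, a, b) + q) ->
        `|W ((0, a, b) + q) - W q| <= 4 * (`|a| + `|b|)].
Proof.
have H q : exists l, B q -> forall n, `|picard n q - l| <= 2 * 2^-1 ^+ n.
  have [Bq|nB] := pselect (B q); last by exists 0.
  by have [l Hl] := geometric_limit (fun n => picard_step n Bq); exists l.
have [W HW] := choice H.
have cW : Cn 0 B W.
  move=> q Bq; apply: continuous_eps => e e0.
  have e6 : 0 < e / 3 / 2 by rewrite !divr_gt0.
  have [n Hn] := half_pow_small e6.
  have e3 : 0 < e / 3 by rewrite divr_gt0.
  have [n1 n10 H1] := eps_continuous ((picard_admissible n).1 q Bq) e3.
  have [n2 n20 H2] := near_norm (open_near oB Bq).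
  exists (Num.min n1 n2); first by rewrite lt_min n10.
  move=> h; rewrite lt_min => /andP[h1 h2].
  have := H1 _ h1; have := HW _ Bq n; have := HW _ (H2 _ h2) n.
  rewrite [`|picard n q - W q|]distrC [`|picard n (h + q) - W (h + q)|]distrC; move: Hn; rewrite ltr_pdivlMr // mulrC => Hn A1 A2 A3.
  have -> : W q - W (h + q) = (W q - picard n q) + (picard n q - picard n (h + q))
    - (W (h + q) - picard n (h + q)) by ring.
  have A4 := ler_normB (W q - picard n q + (picard n q - picard n (h + q)))
    (W (h + q) - picard n (h + q)).
  have A5 := ler_normD (W q - picard n q) (picard n q - picard n (h + q)).
  by apply: le_lt_trans A4 _; lra.
have aW : admissible W.
  split=> // q Bq; apply: (@le_geometric _ _ _ 2) => n.
  have := HW _ Bq n; have := (picard_admissible n).2 _ Bq; rewrite [`|picard n q - W q|]distrC.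
  move=> A1 A2; have := ler_normD (picard n q - p0.2) (W q - picard n q).
  by rewrite addrC subrKA => A3; lra.
exists W; split=> //.
- by move=> q Bq; exact: graph_ball aW Bq.
- have P := primP (graph_cont aW) => q Bq; have [D Z] := P q Bq.
  have E q' : B q' -> W q' - q'.2 = prim (fun q => f (q.1, W q)) q'.
    move=> Bq'; apply/eqP; rewrite -subr_eq0 -normr_le0.
    apply: (@le_geometric _ _ _ 2) => n; rewrite add0r.
    have We q'' : B q'' -> `|W q'' - picard n q''| <= 2 * 2^-1 ^+ n.
      by move=> Bq''; rewrite distrC; exact: HW.
    have := contraction (picard_admissible n) aW We Bq'.
    have := HW _ Bq' n.+1; rewrite [`|picard n.+1 q' - W q'|]distrC exprS /=.
    set P' := prim _ q'; set P1 := prim _ q'; clearbody P' P1 => A1 A2.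
    rewrite (_ : W q' - q'.2 - P1 = W q' - (q'.2 + P') - (P1 - P')); last by ring.
    have := ler_normB (W q' - (q'.2 + P')) (P1 - P').
    move: A1 A2; set x := 2^-1 ^+ n; lra.
  split.
    apply: near_eq_is_derive D; apply: (open_near_eq oB Bq) => q' Bq'.
    by rewrite E.
  rewrite E //; apply/ball_coord; move/ball_coord: Bq => [_ b2 b3]; split=> //=.
  by rewrite subrr normr0.
- move=> q a b Bq Bq'; apply: (@le_geometric _ _ _ 4) => n.
  have := HW _ Bq n; have := HW _ Bq' n; have := picard_lipschitz n Bq Bq'.
  set w := picard n q; set w' := picard n _; set x := W _; set y := W q.
  clearbody w w' x y => A1 A2 A3.
  rewrite (_ : x - y = (w' - w) - (w' - x) + (w - y)); last by ring.
  have A4 := ler_normD (w' - w - (w' - x)) (w - y).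
  have A5 := ler_normB (w' - w) (w' - x).
  apply: le_trans A4 _; lra.
Qed.

End Picard.

Lemma derive_expR_comp {R : realType} {V : normedModType R} (g : V -> R) p v :
  differentiable g p ->
  differentiable (fun q => expR (g q)) p /\
  'D_v (fun q => expR (g q)) p = expR (g p) * 'D_v g p.
Proof.
move=> dg.
have dE : differentiable (expR : R -> R) (g p).
  by apply/derivable1_diffP; exact: derivable_expR.
have dc : differentiable (fun q => expR (g q)) p by exact: (differentiable_comp dg dE).
split=> //; rewrite deriveE // (diff_comp dg dE) /= -(deriveE v dg) -(deriveE _ dE).
set w := 'D_v g p; rewrite -[X in 'D_X _ _]mulr1 [LHS](deriveZv (V := R^o) _ w dE).
by have [_ ->] := is_derive_expR (g p); rewrite mulrC.
Qed.

Lemma Cn_expR {R : realType} {V : normedModType R} n (U : set V) (g : V -> R) :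
  open U -> Cn n U g -> Cn n U (fun q => expR (g q)).
Proof.
move=> oU; elim: n g => [|n IH] g Cg.
  by move=> p Up; apply: (continuous_comp (Cg p Up)); exact: continuous_expR.
have [dg Dg] := Cg; split=> [p Up|v].
  by have [] := derive_expR_comp 0 (dg p Up).
apply: Cn_eq oU _ (CnM oU (IH _ (CnW Cg)) (Dg v)) => p Up.
by have [_ ->] := derive_expR_comp v (dg p Up).
Qed.

(** * Smooth dependence of the flow on time, parameter and initial value *)

Section Flow.
Context {R : realType}.
Notation base := (base R).
Variables (f : base -> R) (N : set base) (p0 : base) (r K d : R) (W : base -> R).
Hypotheses (Sf : smooth_on N f) (K1 : 1 <= K).
Hypotheses (d0 : 0 < d) (d1 : d <= 1) (Kd : K * d <= 2^-1).
Hypothesis BN : forall q, ball p0 r q -> N q.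
Hypothesis DfK : forall q, ball p0 r q -> `|pd2 f q| <= K /\ `|pd3 f q| <= K.
Hypothesis D2fK : forall q, ball p0 r q -> `|pd2 (pd2 f) q| <= K /\ `|pd3 (pd2 f) q| <= K.
Hypothesis D3fK : forall q, ball p0 r q -> `|pd2 (pd3 f) q| <= K /\ `|pd3 (pd3 f) q| <= K.
Let B := ball p0 d.
Let t0 := p0.1.1.
Hypothesis CW : Cn 0 B W.
Hypothesis WB : forall q, B q -> ball p0 r (q.1, W q).
Hypothesis WP : primitive p0 d (fun q => W q - q.2) (fun q => f (q.1, W q)).
Hypothesis WL : forall q (a b : R), B q -> B ((0, a, b) + q) ->
        `|W ((0, a, b) + q) - W q| <= 4 * (`|a| + `|b|).

Let oB : open B. Proof. exact: ball_open. Qed.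
Let Bt0 (q : base) : B q -> `|q.1.1 - t0| < d.
Proof. by move/ball_coord=> []. Qed.
Let K0 : 0 <= K. Proof. exact: le_trans K1. Qed.

Let Cgraph n (g : base -> R) : smooth_on N g -> Cn n B W -> Cn n B (fun q => g (q.1, W q)).
Proof. by move=> Sg CWn; apply: (Cn_graph oB CWn (Sg n)) => q /WB; exact: BN. Qed.

Let W0 q : B q -> W (t0, q.1.2, q.2) = q.2.
Proof. by move=> /WP[_ /eqP]; rewrite subr_eq0 => /eqP. Qed.

Let DW q : B q -> is_derive q ((1, 0, 0) : base) W (f (q.1, W q)).
Proof.
move=> Bq; have [D _] := WP Bq.
have [d3 D3 _] := @x3_smooth R.
have D' : is_derive q ((1, 0, 0) : base) (fun q : base => q.2) 0.
  by split; [exact: diff_derivable|exact: D3].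
apply: is_derive_eq; last exact: addr0.
have := is_deriveD D D'; congr (is_derive _ _ _ _).
by apply/funext => x /=; rewrite -[LHS]/(W x - x.2 + x.2) subrK.
Qed.

Let DWs q s : B q -> `|s - t0| <= `|q.1.1 - t0| ->
  is_derive s 1 (fun s => W (s, q.1.2, q.2)) (f ((s, q.1.2), W (s, q.1.2, q.2))).
Proof.
by move=> Bq sq; have /is_derive_first := DW (slice_ball Bq sq).
Qed.

Let c q := pd3 f (q.1, W q).
Let C := prim p0 d c.
Let E q := expR (- C q).
(** Variation of constants, with integrating factor [E]: [z v] solves the variational equation
    [z_t = c z + v.1.2 f_l] with value [v.2] at the initial time. It is the candidate for
    ['D_v W]. *)
Let z (v : base) q := expR (C q) * (v.2 + prim p0 d (fun q => E q * (v.1.2 * pd2 f (q.1, W q))) q).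

Let Cc n : Cn n B W -> Cn n B c.
Proof. by move=> CWn; apply: Cgraph CWn; exact: smooth_derive. Qed.

Let PC : primitive p0 d C c.
Proof. by apply: primP => //; exact: Cc. Qed.

Let CE n : Cn n B W -> Cn n B E.
Proof.
move=> CWn; apply: (Cn_expR oB); apply: (CnN oB).
exact (primitive_Cn d0 PC (Cc CWn)).
Qed.

Let Cb (v : base) n : Cn n B W -> Cn n B (fun q => E q * (v.1.2 * pd2 f (q.1, W q))).
Proof.
move=> CWn; apply: (CnM oB (CE CWn)); apply: (CnM oB (Cn_cst n B v.1.2)).
by apply: Cgraph CWn; exact: smooth_derive.
Qed.

Let PZ (v : base) : primitive p0 d (prim p0 d (fun q => E q * (v.1.2 * pd2 f (q.1, W q))))
  (fun q => E q * (v.1.2 * pd2 f (q.1, W q))).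
Proof. by apply: primP => //; exact: Cb. Qed.

Let Cz (v : base) n : Cn n B W -> Cn n B (z v).
Proof.
move=> CWn; apply: (CnM oB).
  by apply: (Cn_expR oB); exact (primitive_Cn d0 PC (Cc CWn)).
exact (CnD oB (Cn_cst n B v.2) (primitive_Cn d0 (PZ v) (Cb v CWn))).
Qed.

Let C_bound q : B q -> `|C q| <= 1.
Proof.
move=> Bq; have /ball_coord[b1 _ _] := Bq.
apply: le_trans (primitive_bound PC Bq (M := K) _) _.
  by move=> s sq; have [] := DfK (WB (slice_ball Bq sq)).
apply: (@le_trans _ _ (K * d)); first by rewrite ler_wpM2l // ltW.
by rewrite (le_trans Kd) //; lra.
Qed.

Let expC q : B q -> expR (C q) <= expR 1 /\ E q <= expR 1.
Proof.
move=> /C_bound; rewrite ler_norml => /andP[C1 C2]; rewrite /E !ler_expR.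
by split=> //; lra.
Qed.

(** The candidate derivative is compared with the true increment before [W] is known to be
    differentiable in these directions. By the Lipschitz estimate the displacement fed to Taylor's
    formula has size at most [|h| * L]. One factor [expR 1] bounds [E] in the integrand, the other
    bounds [expR (C q)] when the integrating factor is undone, and the time interval has length at
    most 1. *)
Let flow_quadratic (v q : base) (h : R) : v.1.1 = 0 -> B q -> B (h *: v + q) ->
  `|W (h *: v + q) - W q - h * z v q| <=
    expR 1 * (expR 1 * (K * (`|v.1.2| + 4 * (`|v.1.2| + `|v.2|)) ^+ 2)) * `|h| ^+ 2.
Proof.
move=> v0 Bq Bq'.
set L := `|v.1.2| + _.
have vE : h *: v = (0, h * v.1.2, h * v.2) :> base.
  by case: (v) v0 => [[v1 v2] v3] /= ->; rewrite -[LHS]/(h * 0, h * v2, h * v3) mulr0.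
rewrite vE in Bq' *.
set q' : base := (0, h * v.1.2, h * v.2) + q in Bq' *.
have E1 : q'.1.1 = q.1.1 by rewrite -[LHS]/(0 + q.1.1) add0r.
have E2 : (q.1.1, q'.1.2, q'.2) = q' by rewrite -E1; case: (q') => [[]].
have E3 : (q.1.1, q.1.2, q.2) = q by case: (q) => [[]].
have [DC ZC] := primitive_slice PC Bq.
have [DZ ZZ] := primitive_slice (PZ v) Bq.
(* The derivative of [S] is [exp (- C)] times the second-order Taylor remainder
   of [f], because multiplying by [exp (- C)] absorbs the linear term. *)
pose S s := E (s, q.1.2, q.2) * (W (s, q'.1.2, q'.2) - W (s, q.1.2, q.2))
  - h * (v.2 + prim p0 d (fun q => E q * (v.1.2 * pd2 f (q.1, W q))) (s, q.1.2, q.2)).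
pose S' s := E (s, q.1.2, q.2) * (f ((s, q'.1.2), W (s, q'.1.2, q'.2))
   - f ((s, q.1.2), W (s, q.1.2, q.2))
   - ((h * v.1.2) * pd2 f ((s, q.1.2), W (s, q.1.2, q.2))
      + (W (s, q'.1.2, q'.2) - W (s, q.1.2, q.2)) * pd3 f ((s, q.1.2), W (s, q.1.2, q.2)))).
have DS s : `|s - t0| <= `|q.1.1 - t0| -> is_derive s 1 S (S' s).
  move=> sq.
  have D1 : is_derive s 1 (fun s => W (s, q'.1.2, q'.2)) (f ((s, q'.1.2), W (s, q'.1.2, q'.2))).
    by apply: DWs => //; rewrite E1.
  have D2 := DWs Bq sq.
  have D3 := DC s sq.
  have D4 : is_derive s 1 (fun s => E (s, q.1.2, q.2)) (- c (s, q.1.2, q.2) * E (s, q.1.2, q.2)).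
    apply: is_derive_eq (is_derive1_comp (is_derive_expR _) (is_deriveN D3)) _.
    by rewrite mulrC.
  have D5 := is_deriveM D4 (is_deriveB D1 D2).
  have D6 := is_deriveZ h (is_deriveD (is_derive_cst v.2 s 1) (DZ s sq)).
  apply: is_derive_eq (is_deriveB D5 D6) _.
  transitivity (E (s, q.1.2, q.2) * (f ((s, q'.1.2), W (s, q'.1.2, q'.2))
   - f ((s, q.1.2), W (s, q.1.2, q.2)))
   + (W (s, q'.1.2, q'.2) - W (s, q.1.2, q.2)) * (- c (s, q.1.2, q.2) * E (s, q.1.2, q.2))
   - h * (0 + E (s, q.1.2, q.2) * (v.1.2 * pd2 f ((s, q.1.2), W (s, q.1.2, q.2))))) => //.
  rewrite /S' /c /=; set x1 := E _; set x2 := f _; set x3 := f _; set x4 := W _; set x5 := W _.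
  set x6 := pd3 _ _; set x7 := pd2 _ _; clearbody x1 x2 x3 x4 x5 x6 x7.
  by ring.
have KL0 : 0 <= K * (`|h| * L) ^+ 2 by rewrite mulr_ge0 // exprn_ge0 // mulr_ge0 // addr_ge0 // mulr_ge0 // addr_ge0.
have bS s : `|s - t0| <= `|q.1.1 - t0| -> `|S' s| <= expR 1 * (K * (`|h| * L) ^+ 2).
  move=> sq; have Bs := slice_ball Bq sq.
  have Bs' : B (s, q'.1.2, q'.2) by apply: slice_ball Bq' _; rewrite E1.
  have sE : (s, q'.1.2, q'.2) = (0, h * v.1.2, h * v.2) + (s, q.1.2, q.2) :> base.
    by rewrite -[RHS]/(0 + s, q'.1.2, q'.2) add0r.
  rewrite /S' normrM; apply: ler_pM => //.
    by rewrite ger0_norm ?expR_ge0 //; have [] := expC Bs.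
  have WLs := WL (q := (s, q.1.2, q.2)) (a := h * v.1.2) (b := h * v.2) Bs.
  rewrite -sE in WLs; have {}WLs := WLs Bs'.
  have := taylor_box Sf BN D2fK D3fK (p := ((s, q.1.2), W (s, q.1.2, q.2)))
    (a := h * v.1.2) (b := W (s, q'.1.2, q'.2) - W (s, q.1.2, q.2)) (WB Bs).
  rewrite -[_ + (_, W _)]/(0 + s, q'.1.2, W (s, q'.1.2, q'.2) - W (s, q.1.2, q.2)
      + W (s, q.1.2, q.2)) add0r subrK => /(_ (WB Bs')) T.
  apply: le_trans T _; rewrite ler_wpM2l // lerXn2r ?nnegrE ?addr_ge0 //.
    by rewrite mulr_ge0 // /L addr_ge0 // mulr_ge0 // addr_ge0.
  rewrite /L mulrDr normrM lerD2l (le_trans WLs) // !normrM -mulrDr.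
  by rewrite mulrCA.
have := mvt_bound DS bS.
have [-> S0] : S q.1.1 = E q * (W q' - W q) - h * (v.2 + prim p0 d (fun q => E q * (v.1.2 * pd2 f (q.1, W q))) q)
   /\ S t0 = 0.
  split; first by rewrite /S E2 E3.
  have EC : E (t0, q.1.2, q.2) = 1 by rewrite /E ZC oppr0 expR0.
  have W0' : W (t0, q'.1.2, q'.2) = h * v.2 + q.2 by rewrite W0.
  by rewrite /S ZZ EC W0' W0 //; ring.
rewrite S0 subr0; have [e1 e2] := expC Bq.
set Zq := prim _ _ _ q.
have zE : z v q = expR (C q) * (v.2 + Zq) by [].
rewrite zE; have EE : expR (C q) * E q = 1 by rewrite /E -expRD subrr expR0.
have -> : W q' - W q - h * (expR (C q) * (v.2 + Zq)) =
  expR (C q) * (E q * (W q' - W q) - h * (v.2 + Zq)).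
  by rewrite [RHS]mulrBr [in RHS]mulrA EE mul1r [in RHS]mulrCA.
move=> H; rewrite normrM (ger0_norm (expR_ge0 _)).
have -> : expR 1 * (expR 1 * (K * L ^+ 2)) * `|h| ^+ 2 =
  expR 1 * (expR 1 * (K * (`|h| * L) ^+ 2)) by ring.
apply: ler_pM => //.
apply: le_trans H _; rewrite ler_piMr //.
  by rewrite mulr_ge0 ?expR_ge0.
by apply: le_trans (ltW (Bt0 Bq)) d1.
Qed.

Let flow_derive (v q : base) : v.1.1 = 0 -> B q -> is_derive q v W (z v q).
Proof.
move=> v0 Bq; apply: is_derive_eps => e e0.
have H := @flow_quadratic v q.
set A := expR 1 * _ in H.
have A0 : 0 <= A.
  by rewrite /A !mulr_ge0 ?expR_ge0 ?exprn_ge0 // addr_ge0 // mulr_ge0 // addr_ge0.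
have A1 : 0 < A + 1 by rewrite ltr_wpDl.
have [n n0 Hn] := near_norm (open_near oB Bq).
have v1 : 0 < `|v| + 1 by rewrite ltr_wpDl.
exists (Num.min (n / (`|v| + 1)) (e / (A + 1))); first by rewrite lt_min !divr_gt0.
move=> h; rewrite lt_min !ltr_pdivlMr // => /andP[h1 h2].
have Bh : B (h *: v + q).
  apply: Hn; rewrite normrZ; apply: le_lt_trans h1.
  by rewrite ler_wpM2l // lerDl.
apply: le_trans (H h v0 Bq Bh) _.
rewrite expr2 mulrA ler_wpM2r //; apply: le_trans (ltW h2).
by rewrite mulrC ler_wpM2l // lerDl.
Qed.

(** All three partial derivatives of [W] are expressed through [W] by compositions with smooth
    functions, exponentials and primitives, operations which preserve C^n; so C^n for [W] gives C^n
    for its partial derivatives. *)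
Lemma flow_smooth : smooth_on B W.
Proof.
elim=> [|n IH]; first exact: CW.
have D2 q := @flow_derive (0, 1, 0) q erefl.
have D3 q := @flow_derive (0, 0, 1) q erefl.
have C1 : Cn n B (pd1 W).
  apply: Cn_eq oB _ (Cgraph Sf IH) => q Bq.
  by have [_ E1] := DW Bq; exact: esym E1.
have C2 : Cn n B (pd2 W).
  apply: Cn_eq oB _ (Cz (0, 1, 0) IH) => q Bq.
  by have [_ E1] := D2 q Bq; exact: esym E1.
have C3 : Cn n B (pd3 W).
  apply: Cn_eq oB _ (Cz (0, 0, 1) IH) => q Bq.
  by have [_ E1] := D3 q Bq; exact: esym E1.
apply: (Cn_partials oB _ _ _ C1 C2 C3).
- by move=> q Bq; have [H _] := DW Bq; exact: H.
- by move=> q Bq; have [H _] := D2 q Bq; exact: H.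
- by move=> q Bq; have [H _] := D3 q Bq; exact: H.
Qed.

Lemma flow_equation q : B q ->
  pd1 W q = f (q.1, W q) /\ W (p0.1.1, q.1.2, q.2) = q.2.
Proof. by move=> Bq; split; [have [_ E1] := DW Bq; exact: E1|exact: W0]. Qed.

End Flow.

Lemma local_flow {R : realType} (f : base R -> R) (N : set (base R)) (p0 : base R) :
  open N -> smooth_on N f -> N p0 ->
  exists (d : R) (W : base R -> R), [/\ 0 < d, smooth_on (ball p0 d) W &
    forall q, ball p0 d q -> [/\ N (q.1, W q), pd1 W q = f (q.1, W q) &
      W (p0.1.1, q.1.2, q.2) = q.2]].
Proof.
move=> oN Sf Np.
have SD (g : base R -> R) (v : base R) : smooth_on N g -> smooth_on N ('D_v g).
  exact: smooth_derive.
pose G := nth (fun=> 0) [:: f; pd2 f; pd3 f; pd2 (pd2 f); pd3 (pd2 f); pd2 (pd3 f); pd3 (pd3 f)].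
have [|r' [K [r'0 K1 H]]] := @local_bounds R N p0 G 7 oN Np.
  have S2 : smooth_on N (pd2 f) by exact: SD.
  have S3 : smooth_on N (pd3 f) by exact: SD.
  have S22 : smooth_on N (pd2 (pd2 f)) by exact: SD.
  have S32 : smooth_on N (pd3 (pd2 f)) by exact: SD.
  have S23 : smooth_on N (pd2 (pd3 f)) by exact: SD.
  have S33 : smooth_on N (pd3 (pd3 f)) by exact: SD.
  case=> [_|[_|[_|[_|[_|[_|[_|i]]]]]]];
    [exact: Sf|exact: S2|exact: S3|exact: S22|exact: S32|exact: S23|exact: S33|].
  by rewrite !ltnS ltn0.
(* The cap at 1 yields [K * d <= 1 / 2] and [d <= 1] from [d + K * d = r / 2]. *)
pose r := Num.min r' 1; have r0 : 0 < r by rewrite lt_min r'0 ltr01.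
have r1 : r <= 1 by rewrite ge_min lexx orbT.
have BN q : ball p0 r q -> N q /\ forall i, (i < 7)%N -> `|G i q| <= K.
  by move=> /(le_ball (_ : r <= r')) Bq; apply/H/Bq; rewrite ge_min lexx.
have BN' q : ball p0 r q -> N q by case/BN.
(* [d + K d = r / 2] keeps the Picard iterates inside the box of radius [r];
   [K d <= 1 / 2] makes the Picard map a contraction. *)
pose d := r / (2 * (1 + K)).
have K10 : 0 < 1 + K by rewrite (lt_le_trans ltr01) // lerDl (le_trans _ K1).
have d0 : 0 < d by rewrite divr_gt0 // mulr_gt0.
have dE : d + K * d = r / 2 by rewrite /d; field; rewrite gt_eqF.
have Kd : K * d <= 2^-1 by lra.
have d1 : d <= 1.
  have : 0 <= K * d by rewrite mulr_ge0 ?(ltW d0) // (le_trans _ K1).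
  by lra.
have fK q : ball p0 r q -> `|f q| <= K by move=> /BN[_ /(_ 0%N)]; exact.
have DfK q : ball p0 r q -> `|pd2 f q| <= K /\ `|pd3 f q| <= K.
  by move=> /BN[_ Hi]; split; [exact: (Hi 1%N)|exact: (Hi 2%N)].
have D2fK q : ball p0 r q -> `|pd2 (pd2 f) q| <= K /\ `|pd3 (pd2 f) q| <= K.
  by move=> /BN[_ Hi]; split; [exact: (Hi 3%N)|exact: (Hi 4%N)].
have D3fK q : ball p0 r q -> `|pd2 (pd3 f) q| <= K /\ `|pd3 (pd3 f) q| <= K.
  by move=> /BN[_ Hi]; split; [exact: (Hi 5%N)|exact: (Hi 6%N)].
have [W [CW WB WP WL]] := picard_limit Sf K1 r0 d0 dE Kd BN' fK DfK.
exists d, W; split=> //.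
  exact: (flow_smooth Sf K1 d0 d1 Kd BN' DfK D2fK D3fK CW WB WP WL).
move=> q Bq; have [E1 E2] := flow_equation WP Bq.
by split=> //; exact/BN'/WB.
Qed.

(** * Integrability of a compatible overdetermined system *)

Section Graph.
Context {R : realType}.
Notation base := (base R).

Lemma base_etaE (q : base) : (q.1.1, q.1.2, q.2) = q.
Proof. by case: q => [[]]. Qed.

Lemma base_eta1 (q : base) (a : R) : (q.1.1, q.1.2, a) = (q.1, a).
Proof. by case: q => [[]]. Qed.

Lemma derive_graph (F g : base -> R) (q v : base) :
  differentiable g q -> differentiable F ((q.1, g q) : base) ->
  'D_v (fun q : base => F (q.1, g q)) q =
  v.1.1 * pd1 F (q.1, g q) + v.1.2 * pd2 F (q.1, g q) + 'D_v g q * pd3 F (q.1, g q).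
Proof.
move=> dg; rewrite -base_eta1 => dF.
have [x1d x1D _] := @x1_smooth R; have [x2d x2D _] := @x2_smooth R.
have [_ H] := derive_comp3 v (x1d q) (x2d q) dg dF.
rewrite x1D x2D in H; rewrite -H; congr ('D_v _ q).
by apply/funext => z; rewrite base_eta1.
Qed.

(** Implicit differentiation of [F (x, g (x, t)) = t]. It serves all three inversions: of the
    general solution, of [Phi], and of a given family. *)
Lemma solves_last_derive (F g : base -> R) (N M : set base) (q : base) :
  smooth_on N F -> solves_last N F M g -> M q ->
  [/\ pd1 F (q.1, g q) + pd1 g q * pd3 F (q.1, g q) = 0,
      pd2 F (q.1, g q) + pd2 g q * pd3 F (q.1, g q) = 0 &
      pd3 g q * pd3 F (q.1, g q) = 1].
Proof.
move=> SF [oM Sg H] Mq.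
have [Nq _] := H q Mq.
have dg : differentiable g q by exact: Cn_differentiable (Sg 1%N) Mq.
have dF : differentiable F ((q.1, g q) : base) by exact: Cn_differentiable (SF 1%N) Nq.
have [_ x3D _] := @x3_smooth R.
have E v : 'D_v (fun q : base => F (q.1, g q)) q = v.2.
  rewrite -(x3D v q); apply: near_eq_derive; apply: (open_near_eq oM Mq) => z Mz.
  by have [] := H z Mz.
have E' v := esym (etrans (esym (derive_graph v dg dF)) (E v)).
have := E' (1, 0, 0); have := E' (0, 1, 0); have := E' (0, 0, 1).
rewrite -/(pd1 g q) -/(pd2 g q) -/(pd3 g q) /=.
set a1 := pd1 F _; set a2 := pd2 F _; set a3 := pd3 F _.
set g1 := pd1 g q; set g2 := pd2 g q; set g3 := pd3 g q.
clearbody a1 a2 a3 g1 g2 g3.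
by rewrite !mul0r !mul1r !addr0 !add0r => E3 E2 E1; split.
Qed.

(** A direction with zero first component stays in the initial slice, where [W] is the last
    coordinate. *)
Lemma derive_initial (W : base -> R) (p0 : base) (d : R) (q v : base) :
  smooth_on (ball p0 d) W ->
  (forall q, ball p0 d q -> W (p0.1.1, q.1.2, q.2) = q.2) ->
  ball p0 d q -> q.1.1 = p0.1.1 -> v.1.1 = 0 -> 'D_v W q = v.2.
Proof.
move=> SW H Bq q1 v0.
have dW : differentiable W q by exact: Cn_differentiable (SW 1%N) Bq.
have := @is_derive_line _ _ W q v 0; rewrite scale0r add0r => /(_ (diff_derivable dW)) [_ <-].
have nb : \forall h \near (0 : R), W (h *: v + q) = v.2 *: h + q.2.
  have [n n0 Hn] := near_norm (open_near (ball_open p0 d) Bq).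
  have v1 : 0 < `|v| + 1 by rewrite ltr_wpDl.
  apply: (@norm_near0 R R^o _ (n / (`|v| + 1))); first exact: divr_gt0.
  move=> h; rewrite ltr_pdivlMr // => h1.
  have Bh : ball p0 d (h *: v + q).
    apply: Hn; rewrite normrZ; apply: le_lt_trans h1.
    by rewrite ler_wpM2l // lerDl.
  have -> : v.2 *: h + q.2 = (h *: v + q).2 by rewrite -[LHS]/(v.2 * h + q.2) mulrC.
  rewrite -(H _ Bh); congr W.
  by rewrite -[h *: v + q]base_etaE -[(h *: v + q).1.1]/(h * v.1.1 + q.1.1) v0 mulr0 add0r q1.
rewrite (near_eq_derive _ nb).
have D1 : is_derive (0 : R) (1 : R) (fun h : R => v.2 *: h) (v.2 *: (1 : R)).
  exact: is_deriveZ.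
have D : is_derive (0 : R) (1 : R) (fun h : R => v.2 *: h + q.2) (v.2 *: (1 : R) + 0).
  exact: is_deriveD.
by have [_ ->] := D; rewrite addr0 -[LHS]/(v.2 * 1) mulr1.
Qed.

(** Multiplied by the exponential of minus a primitive of [c], the function [E] becomes constant
    along the first axis. *)
Lemma linear_ode_zero (p : base) (d : R) (E c : base -> R) : 0 < d ->
  Cn 0 (ball p d) c ->
  (forall q, ball p d q -> is_derive q ((1, 0, 0) : base) E (c q * E q)) ->
  (forall q, ball p d q -> E (p.1.1, q.1.2, q.2) = 0) ->
  forall q, ball p d q -> E q = 0.
Proof.
move=> d0 Cc DE E0 q Bq.
have [C PC] := primitive_exists d0 Cc.
have [DC ZC] := primitive_slice PC Bq.
have DS s : `|s - p.1.1| <= `|q.1.1 - p.1.1| ->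
    is_derive s 1 (fun s => expR (- C (s, q.1.2, q.2)) * E (s, q.1.2, q.2)) 0.
  move=> sq; have /is_derive_first D1 := DE _ (slice_ball Bq sq).
  have D2 := is_derive1_comp (is_derive_expR _) (is_deriveN (DC s sq)).
  apply: is_derive_eq (is_deriveM D2 D1) _ => /=.
  rewrite -[_ *: _]/(_ * _) -[X in _ + X]/(_ * _).
  by set x := expR _; set y := c _; set z := E _; ring.
have H0 (s : R) : `|s - p.1.1| <= `|q.1.1 - p.1.1| -> `|(fun=> 0) s : R| <= 0 by rewrite normr0.
have := mvt_bound DS H0; rewrite mul0r (E0 _ Bq) mulr0 subr0 base_etaE.
by rewrite normr_le0 mulf_eq0 (gt_eqF (expR_gt0 _)) => /eqP.
Qed.

Lemma frobenius (U : set base) (G H : base -> R) (p : base) :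
  open U -> smooth_on U G -> smooth_on U H -> U p ->
  (forall q, U q -> pd2 G q + H q * pd3 G q = pd1 H q + G q * pd3 H q) ->
  exists (T : set base) (Phi : base -> R),
    [/\ open T, smooth_on T Phi, T p, T `<=` U & forall q, T q ->
      [/\ pd3 Phi q != 0, pd1 Phi q + G q * pd3 Phi q = 0 &
          pd2 Phi q + H q * pd3 Phi q = 0]].
Proof.
move=> oU SG SH Up compat.
have [x1d x1D x1S] := @x1_smooth R; have [x2d x2D x2S] := @x2_smooth R.
have [x3d x3D x3S] := @x3_smooth R.
(* Base point for [u_2 = H] on the line [x_1 = p.1.1]: here [x_2] is the time and [u] the initial
   value, and the parameter is set to 0 as this equation has none. *)
pose p1 : base := (p.1.2, 0, p.2).
pose f1 (q : base) := H (p.1.1, q.1.1, q.2).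
pose N1 := [set q : base | U (p.1.1, q.1.1, q.2)].
have oN1 : open N1.
  apply: (@open_comp _ _ (fun q : base => (p.1.1, q.1.1, q.2)) U) => // q _.
  have c1 : {for q, continuous (fun q : base => p.1.1)} by exact: cst_continuous.
  have c2 : {for q, continuous (fun q : base => q.1.1)} by exact: (x1S setT 0%N).
  have c3 : {for q, continuous (fun q : base => q.2)} by exact: (x3S setT 0%N).
  have c4 : {for q, continuous (fun q : base => (p.1.1, q.1.1))} by exact: cvg_pair c1 c2.
  exact: cvg_pair c4 c3.
have Sf1 : smooth_on N1 f1.
  move=> n; exact: (Cn_comp3 oN1 _ (Cn_cst n N1 p.1.1) (x1S N1 n) (x3S N1 n) (SH n)).
have N1p : N1 p1 by rewrite /N1 /= base_etaE.
have [d1 [W1 [d10 SW1 HW1]]] := local_flow oN1 Sf1 N1p.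
have [d2 [W2 [d20 SW2 HW2]]] := local_flow oU SG Up.
(* Solution of [u_2 = H] over [x_1 = p.1.1] that takes the value [q.2] at [x_2 = p.1.2]. *)
pose al (q : base) := W1 (q.1.2, 0, q.2).
have B1 q : ball p d1 q -> ball p1 d1 (q.1.2, 0, q.2).
  by move=> /ball_coord[_ b2 b3]; apply/ball_coord; split=> //=; rewrite subrr normr0.
have Sal : smooth_on (ball p d1) al.
  move=> n; have oB1 : open (ball p d1) by exact: ball_open.
  exact: (Cn_comp3 oB1 B1 (x2S _ n) (Cn_cst n _ 0) (x3S _ n) (SW1 n)).
have pd1p : ball p d1 p by exact: ballxx.
have alp q : ball p d1 q -> q.1.2 = p.1.2 -> al q = q.2.
  by move=> /B1/HW1[_ _ E] q2; rewrite /al q2 -[RHS]E.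
(* Since [al p = p.2], continuity keeps [(q.1, al q)] in the domain of the second flow. *)
have [e1 e10 He1] := eps_continuous (Sal 0%N p pd1p) d20.
pose e := Num.min (Num.min d1 d2) e1.
have e0 : 0 < e by rewrite !lt_min d10 d20.
pose B := ball p e; have oB : open B by exact: ball_open.
have Bp : B p by exact: ballxx.
have BB1 q : B q -> ball p d1 q by apply: le_ball; rewrite !ge_min lexx.
have BB2 q : B q -> ball p d2 (q.1, al q).
  move=> Bq; have /ball_coord[b1 b2 b3] : ball p d2 q.
    by apply: le_ball Bq; rewrite !ge_min lexx orbT.
  apply/ball_coord; split=> //=.
  have := He1 (q - p); rewrite subrK [`|al p - _|]distrC (alp p) //; apply.
  move: Bq; rewrite /B -ball_normE /ball_ /= distrC => Bq; apply: lt_le_trans Bq _.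
  by rewrite ge_min lexx orbT.
(* General solution of the system: it starts from [al] and follows [u_1 = G], with the last
   coordinate as constant of integration. *)
pose Psi (q : base) := W2 (q.1, al q).
have SalB : smooth_on B al by move=> n; exact: Cn_sub BB1 (Sal n).
have SPsi : smooth_on B Psi by move=> n; exact: Cn_graph oB (SalB n) (SW2 n) BB2.
have UPsi q : B q -> U (q.1, Psi q) by move=> /BB2/HW2[].
have dal q : B q -> differentiable al q by move=> Bq; exact: Cn_differentiable (SalB 1%N) Bq.
have dW2 q : B q -> differentiable W2 ((q.1, al q) : base).
  by move=> /BB2; exact: Cn_differentiable (SW2 1%N).
have Dal v q : B q -> 'D_v al q = v.1.2 * pd1 W1 (q.1.2, 0, q.2) + v.2 * pd3 W1 (q.1.2, 0, q.2).
  move=> Bq; have dW1 : differentiable W1 ((q.1.2, 0, q.2) : base).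
    exact: Cn_differentiable (SW1 1%N) (B1 _ (BB1 _ Bq)).
  have [_ ->] := derive_comp3 v (x2d q) (differentiable_cst (0 : R) q) (x3d q) dW1.
  by rewrite x2D x3D derive_cst mul0r addr0.
have DPsi v q : B q -> 'D_v Psi q = v.1.1 * pd1 W2 (q.1, al q) + v.1.2 * pd2 W2 (q.1, al q)
    + 'D_v al q * pd3 W2 (q.1, al q).
  by move=> Bq; rewrite derive_graph //; [exact: dal|exact: dW2].
have iW2 q : ball p d2 q -> W2 (p.1.1, q.1.2, q.2) = q.2 by move=> /HW2[].
have iW1 q : ball p1 d1 q -> W1 (p1.1.1, q.1.2, q.2) = q.2 by move=> /HW1[].
have PsiE q : B q -> q.1.1 = p.1.1 -> Psi q = al q.
  by move=> Bq q1; rewrite -[RHS](iW2 _ (BB2 _ Bq)) /= -q1 base_eta1.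
have Psi1 q : B q -> pd1 Psi q = G (q.1, Psi q).
  move=> Bq; rewrite [LHS]DPsi // Dal // !mul0r !addr0 mul0r addr0 mul1r.
  by have [_ -> _] := HW2 _ (BB2 _ Bq).
have Psi2_initial q : B q -> q.1.1 = p.1.1 -> pd2 Psi q = H (q.1, Psi q).
  move=> Bq q1; rewrite [LHS]DPsi // Dal // !mul0r mul1r !mul1r add0r.
  rewrite [pd2 W2 _](derive_initial SW2 iW2 (BB2 _ Bq)) //.
  rewrite [pd3 W2 _](derive_initial SW2 iW2 (BB2 _ Bq)) // addr0 add0r mulr1.
  have [_ -> _] := HW1 _ (B1 _ (BB1 _ Bq)).
  rewrite PsiE //.
  by rewrite /f1 /= -q1 base_eta1.
have Psi3p : pd3 Psi p = 1.
  rewrite [LHS](DPsi _ _ Bp) (Dal _ _ Bp) /=.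
  have -> : pd3 W2 (p.1, al p) = 1 by exact: (derive_initial SW2 iW2 (BB2 _ Bp)).
  have -> : pd3 W1 (p.1.2, 0, p.2) = 1.
    exact: (derive_initial SW1 iW1 (B1 _ (BB1 _ Bp))).
  set x := pd1 _ _; set y := pd2 _ _; set z := pd1 _ _; clearbody x y z.
  by rewrite !mul0r !add0r !mulr1.
have Psip : Psi p = p.2.
  by rewrite PsiE // alp.
(* Defect of the second equation. Equality of mixed derivatives of [Psi] and [compat] give
   [E_1 = G_u E], and [E] vanishes on the slice [x_1 = p.1.1] by the choice of [al]. *)
pose E q := pd2 Psi q - H (q.1, Psi q).
have SPsi2 : smooth_on B (pd2 Psi) by exact: smooth_derive.
have SHPsi : smooth_on B (fun q => H (q.1, Psi q)).
  by move=> n; exact: Cn_graph oB (SPsi n) (SH n) UPsi.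
pose c q := pd3 G (q.1, Psi q).
have Cc : Cn 0 B c.
  exact: Cn_graph oB (SPsi 0%N) (smooth_derive _ SG 0%N) UPsi.
have dPsi q : B q -> differentiable Psi q by move=> Bq; exact: Cn_differentiable (SPsi 1%N) Bq.
have DE q : B q -> is_derive q ((1, 0, 0) : base) E (c q * E q).
  move=> Bq; have Uq := UPsi _ Bq.
  have dG : differentiable G ((q.1, Psi q) : base) by exact: Cn_differentiable (SG 1%N) Uq.
  have dH : differentiable H ((q.1, Psi q) : base) by exact: Cn_differentiable (SH 1%N) Uq.
  have dP2 : differentiable (pd2 Psi) q by exact: Cn_differentiable (SPsi2 1%N) Bq.
  have dHP : differentiable (fun q => H (q.1, Psi q)) q by exact: Cn_differentiable (SHPsi 1%N) Bq.
  split; first by apply: derivableB; exact: diff_derivable.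
  rewrite deriveB; [|exact: diff_derivable..].
  have -> : 'D_((1, 0, 0) : base) (pd2 Psi) q = 'D_((0, 1, 0) : base) (pd1 Psi) q.
    exact: schwarz oB Bq (SPsi 2%N).
  have -> : 'D_((0, 1, 0) : base) (pd1 Psi) q = 'D_((0, 1, 0) : base) (fun q => G (q.1, Psi q)) q.
    by apply: near_eq_derive; exact: (open_near_eq oB Bq).
  rewrite (derive_graph _ (dPsi _ Bq) dG) (derive_graph _ (dPsi _ Bq) dH).
  rewrite -/(pd2 Psi q) -/(pd1 Psi q) Psi1 // /E /c.
  have := compat _ Uq; move: (pd2 Psi q) => x /=.
  set y1 := pd2 G _; set y2 := pd3 G _; set y3 := pd1 H _; set y4 := pd3 H _.
  set y5 := G _; set y6 := H _; set y7 := pd1 G _; set y8 := pd2 H _.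
  clearbody y1 y2 y3 y4 y5 y6 y7 y8 => Hc.
  have -> : y1 = y3 + y5 * y4 - y6 * y2 by rewrite -Hc addrK.
  by ring.
have E0 q : B q -> E q = 0.
  apply: (linear_ode_zero e0 Cc DE) => z Bz.
  have Bz' : B (p.1.1, z.1.2, z.2).
    by apply: slice_ball Bz _; rewrite subrr normr0.
  by rewrite /E Psi2_initial // subrr.
have Psi2 q : B q -> pd2 Psi q = H (q.1, Psi q).
  by move=> /E0/eqP; rewrite subr_eq0 => /eqP.
have Psi3n : pd3 Psi p != 0 by rewrite Psi3p oner_neq0.
(* [Phi] recovers the constant of integration; this is possible since [Psi] has last partial
   derivative 1 at [p]. *)
have [T [Phi [ST Tp _]]] := local_solution oB SPsi Bp Psi3n.
have [oT SPhi HT] := ST.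
exists (T `&` U), Phi; split.
- exact: openI.
- by move=> n; apply: Cn_sub (SPhi n); exact: subIsetl.
- by split=> //; move: Tp; rewrite Psip; case: (p) => [[]].
- exact: subIsetr.
move=> q [Tq Uq]; have [Bq Pq] := HT _ Tq.
have [] := solves_last_derive SPsi ST Tq.
rewrite Psi1 // Psi2 // Pq /= -!surjective_pairing.
set x := pd3 Psi _; set g := G q; set h := H q; set y1 := pd1 Phi q.
set y2 := pd2 Phi q; set y3 := pd3 Phi q; clearbody x g h y1 y2 y3 => A1 A2 A3.
have x0 : x != 0 by apply/eqP => x0; move: A3; rewrite x0 mulr0 => /esym/eqP; rewrite oner_eq0.
have y30 : y3 != 0 by apply/eqP => y30; move: A3; rewrite y30 mul0r => /esym/eqP; rewrite oner_eq0.
have gE : g = - (y1 * x) by apply/eqP; rewrite -addr_eq0 A1.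
have hE : h = - (y2 * x) by apply/eqP; rewrite -addr_eq0 A2.
split=> //.
  have -> : y1 + g * y3 = y1 * (1 - y3 * x) by rewrite gE; ring.
  by rewrite A3 subrr mulr0.
have -> : y2 + h * y3 = y2 * (1 - y3 * x) by rewrite hE; ring.
by rewrite A3 subrr mulr0.
Qed.

End Graph.

(** * The reduction of the determining equation *)

Section Slices.
Context {R : realType}.
Notation base := (base R).

Lemma plane_coord_smooth (l : R * R -> R) : l = fst \/ l = snd ->
  [/\ forall p, differentiable l p, forall v p, 'D_v l p = l v &
      forall U, smooth_on U l].
Proof.
move=> H; have [||H1 H2 H3] := @linear_fun_smooth R _ l => //.
  by move=> k x y; case: H => ->.
by case: H => -> p; [exact: cvg_fst|exact: cvg_snd].
Qed.

Lemma sliceE (f : base -> R) k : slice f k = fun x => f (x.1, x.2, k).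
Proof. by apply/funext => -[x1 x2]. Qed.

Lemma derive_slice (f : base -> R) k (x : R * R) : differentiable f ((x, k) : base) ->
  'D_((1, 0) : R * R) (slice f k) x = pd1 f (x, k) /\
  'D_((0, 1) : R * R) (slice f k) x = pd2 f (x, k).
Proof.
move=> df; have [d1 D1 _] := @plane_coord_smooth fst (or_introl erefl).
have [d2 D2 _] := @plane_coord_smooth snd (or_intror erefl).
have df' : differentiable f ((x.1, x.2, k) : base) by case: (x) df.
have xE : (x.1, x.2, k) = (x, k) by case: (x).
have E v : 'D_v (slice f k) x = v.1 * pd1 f (x, k) + v.2 * pd2 f (x, k).
  rewrite sliceE.
  have [_ ->] := derive_comp3 v (d1 x) (d2 x) (differentiable_cst (k : R) x) df'.
  by rewrite D1 D2 derive_cst mul0r addr0 xE.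
by rewrite !E /=; set a := pd1 _ _; set b := pd2 _ _; clearbody a b;
  rewrite !mul0r !mul1r addr0 add0r.
Qed.

Lemma slice_domain (T : set base) k : open T -> open [set x : R * R | T (x, k)].
Proof.
move=> oT; apply: (@open_comp _ _ (fun x : R * R => ((x, k) : base)) T) => // x _.
have c1 : {for x, continuous (fun x : R * R => x)} by exact: cvg_id.
have c2 : {for x, continuous (fun x : R * R => k)} by exact: cst_continuous.
exact: cvg_pair c1 c2.
Qed.

Lemma slice_smooth (f : base -> R) (T : set base) k : open T -> smooth_on T f ->
  smooth_on [set x : R * R | T (x, k)] (slice f k).
Proof.
move=> oT Sf n; rewrite sliceE; have oX := @slice_domain T k oT.
have [_ _ S1] := @plane_coord_smooth fst (or_introl erefl).
have [_ _ S2] := @plane_coord_smooth snd (or_intror erefl).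
apply: (Cn_comp3 oX _ (S1 _ n) (S2 _ n) (Cn_cst n _ k) (Sf n)).
by move=> -[x1 x2].
Qed.

End Slices.

(** * Elimination of [u_2] on the manifold of [Q^zeta] *)

Section Elimination.
Context {R : realType}.
Notation base := (base R).

Lemma Qman_first_order r (U : set base) (xi zeta : base -> R) (j : jet R r) :
  (0 < r)%N -> Qman r (Qzeta xi U zeta) j ->
  U (jbase j) /\ ucoord j 0 1 = zeta (jbase j) - xi (jbase j) * ucoord j 1 0.
Proof.
move=> r0 [Uj /(_ 0%N 0%N r0) /= H]; split=> //; move: H.
rewrite /charact /= !ucoord_jproj // jbase_jproj mul1r.
by move=> /eqP; rewrite subr_eq0 => /eqP.
Qed.

(** Coordinates of the first-order jet on the manifold over [((x, u), u_1)], with [u_2] replaced by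
    [zeta - xi u_1]. Only the entries with [a + b <= 1] are meaningful. *)
Let c01 (xi zeta : base -> R) (z : base * R) (a b : nat) : R :=
  if a is 0 then if b is 0 then z.1.2 else zeta z.1 - xi z.1 * z.2 else z.2.

Let jet01 (xi zeta : base -> R) n (z : base * R) : jet R n := mkjet n z.1.1 (c01 xi zeta z).

Let z_coord (l : base * R -> R) :
  [\/ l = (fun z => z.1.1.1), l = (fun z => z.1.1.2), l = (fun z => z.1.2) | l = snd] ->
  forall U, smooth_on U l.
Proof.
move=> H; have [||_ _ H3] := @linear_fun_smooth R _ l => //.
  by move=> k x y; case: H => ->.
case: H => -> p.
- apply: (@continuous_comp _ _ _ fst (fun q : base => q.1.1)); first exact: cvg_fst.
  by have [_ _ S] := @x1_smooth R; exact: (S setT 0%N).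
- apply: (@continuous_comp _ _ _ fst (fun q : base => q.1.2)); first exact: cvg_fst.
  by have [_ _ S] := @x2_smooth R; exact: (S setT 0%N).
- apply: (@continuous_comp _ _ _ fst (fun q : base => q.2)); first exact: cvg_fst.
  by have [_ _ S] := @x3_smooth R; exact: (S setT 0%N).
- exact: cvg_snd.
Qed.

(** Co-order at most 1 already provides a function on a jet space of order at most 1 that agrees
    with [L] on the manifold; there remains to substitute [u_2]. Co-order -1 means that [L] vanishes
    on the manifold, and then [lam] is zero. *)
Lemma elimination r (Omega : set (jet R r)) (L : jet R r -> R)
    (Xi U : set base) (xi zeta : base -> R) : (0 < r)%N ->
  smooth_on Xi xi -> first_coorder_singular Omega L (reduced_family xi Xi) ->
  open U -> U `<=` Xi -> smooth_on U zeta ->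
  exists (V : set (base * R)) (lam : base * R -> R),
    eliminated xi Omega L U zeta V lam.
Proof.
move=> r0 Sxi [S1 S2 _] oU UXi Sz.
have SxiU : smooth_on U xi by move=> n; exact: Cn_sub UXi (Sxi n).
have QS : reduced_family xi Xi (Qzeta xi U zeta) by exists U, zeta.
have [_ [k Hk _]] := S1 _ QS.
have k1 := S2 _ _ QS Hk; have [_ + _] := Hk; case: k k1 {Hk} => [n|n] kn; last first.
  move=> HL; exists setT, (fun=> 0); split; first exact: openT.
    by move=> m; exact: Cn_cst.
  by move=> j Oj Qj; rewrite HL.
move=> [V0 [F [oV0 SF HF]]].
have n1 : (n <= 1)%N by [].
pose phi := jet01 xi zeta n.
pose D := [set z : base * R | U z.1].
have oD : open D by apply: (@open_comp _ _ fst U) => // z _; exact: cvg_fst.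
have z1 := @z_coord _ (Or41 _ _ _ erefl).
have z2 := @z_coord _ (Or42 _ _ _ erefl).
have z3 := @z_coord _ (Or43 _ _ _ erefl).
have z4 := @z_coord _ (Or44 _ _ _ erefl).
have Sg (g : base -> R) : smooth_on U g -> smooth_on D (fun z => g z.1).
  move=> Sg m; have E (z : base * R) : (z.1.1.1, z.1.1.2, z.1.2) = z.1 by case: z => [[[]]].
  apply: Cn_eq oD _ (Cn_comp3 (f := g) oD _ (z1 D m) (z2 D m) (z3 D m) (Sg m)).
    by move=> z _; rewrite E.
  by move=> z; rewrite E.
have Sc m a b : Cn m D (fun z => c01 xi zeta z a b).
  case: a => [|a]; last exact: z4.
  case: b => [|b]; first exact: z3.
  exact: CnB oD (Sg _ Sz m) (CnM oD (Sg _ SxiU m) (z4 D m)).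
have Sphi m (i : mindex n) : Cn m D (fun z => (phi z).2 0 (enum_rank i)).
  apply: Cn_eq oD _ (Sc m (val i).1 (val i).2) => z _.
  by rewrite -ucoord_mindex /phi /jet01 ucoord_mkjet //; exact: (valP i).
have cphi z : D z -> {for z, continuous phi}.
  move=> Dz; apply: continuous_jet.
  - exact: (z1 D 0%N z Dz).
  - exact: (z2 D 0%N z Dz).
  - by move=> i; exact: (Sphi 0%N i z Dz).
pose V := [set z | D z /\ V0 (phi z)].
have oV : open V.
  rewrite openE => z [Dz Vz]; rewrite /interior.
  have nV : \forall w \near z, V0 (phi w) by apply: (cphi z Dz); exact: (open_near oV0 Vz).
  have nD := open_near oD Dz.
  by apply: filterI; [exact: nD|exact: nV].
exists V, (fun z => F (phi z)); split=> //.
  move=> m; apply: (Cn_comp_jet (F := F) oV (phi := phi) _ _ _ _ (SF m)).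
  - by move=> z [].
  - by apply: Cn_sub (z1 D m) => z [].
  - by apply: Cn_sub (z2 D m) => z [].
  - by move=> i; apply: Cn_sub (Sphi m i) => z [].
move=> j Oj Qj; have [Uj u01] := Qman_first_order r0 Qj.
have E : jproj n j = phi (jbase j, ucoord j 1 0).
  apply: mkjet_eq => a b abn; have := leq_trans abn n1.
  by case: a {abn} => [|[|a]]; case: b => [|[|b]].
have [H1 H2] := HF j Oj Qj; rewrite H2 E; split=> //; split=> //.
by rewrite -E.
Qed.

End Elimination.

(** * From a solution of the determining equation to a family of solutions *)

Section Backlund.
Context {R : realType}.
Notation base := (base R).

(** The first linear equation is [xi] times the second plus [Phi_2 + H Phi_u = 0], so the pair is
    equivalent to the system integrated by [frobenius]. *)
Lemma backlund_solvable (U : set base) (xi zeta G : base -> R) (p : base) :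
  open U -> smooth_on U xi -> smooth_on U zeta -> smooth_on U G ->
  determining_eq xi U zeta G -> U p ->
  exists (N : set base) (Phi : base -> R),
    [/\ open N, N p, N `<=` U &
      [/\ smooth_on N Phi, grad_neq0 N Phi & backlund xi N zeta G Phi]].
Proof.
move=> oU Sxi Sz SG DE Up.
pose H q := zeta q - xi q * G q.
have SH : smooth_on U H by move=> n; exact: CnB oU (Sz n) (CnM oU (Sxi n) (SG n)).
have dif (g : base -> R) q : smooth_on U g -> U q -> differentiable g q.
  by move=> Sg Uq; exact: Cn_differentiable (Sg 1%N) Uq.
have DH v q : U q -> 'D_v H q = 'D_v zeta q - (xi q * 'D_v G q + G q * 'D_v xi q).
  move=> Uq; rewrite -(deriveMp v (dif _ _ Sxi Uq) (dif _ _ SG Uq)).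
  rewrite /H -[LHS]/('D_v (zeta - (fun q => xi q * G q)) q) deriveB //.
    exact: diff_derivable (dif _ _ Sz Uq).
  exact: diff_derivable (differentiableMp (dif _ _ Sxi Uq) (dif _ _ SG Uq)).
have compat q : U q -> pd2 G q + H q * pd3 G q = pd1 H q + G q * pd3 H q.
  move=> Uq; have := DE _ Uq; rewrite [pd1 H q]DH // [pd3 H q]DH // /H.
  rewrite -/(pd1 zeta q) -/(pd3 zeta q) -/(pd1 G q) -/(pd3 G q) -/(pd1 xi q) -/(pd3 xi q).
  move: (pd1 zeta q) (pd3 zeta q) (pd1 G q) (pd2 G q) (pd3 G q) (pd1 xi q) (pd3 xi q).
  move: (zeta q) (xi q) (G q) => z x g z1 z3 g1 g2 g3 x1 x3 E.
  have -> : g2 = z1 + z3 * g - (x1 + x3 * g) * g - x * g1 - z * g3 by rewrite E; ring.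
  by ring.
have [T [Phi [oT SPhi Tp TU HP]]] := frobenius oU SG SH Up compat.
exists T, Phi; split=> //; split=> //.
  move=> q /HP[P3 _ _]; apply/eqP => -[_ _ E].
  by rewrite E eqxx in P3.
move=> q /HP[_]; rewrite /H; move: (pd1 Phi q) (pd2 Phi q) (pd3 Phi q) (zeta q) (xi q) (G q).
move=> a b c z x g E1 E2; split=> //.
have -> : a = - (g * c) by apply/eqP; rewrite -addr_eq0 E1.
have -> : b = - ((z - x * g) * c) by apply/eqP; rewrite -addr_eq0 E2.
by ring.
Qed.

(** Where [Phi_u] vanishes, the second equation forces [Phi_1 = 0] and then the first forces
    [Phi_2 = 0], against the nonzero gradient. *)
Lemma backlund_pd3_neq0 (N : set base) (xi zeta G Phi : base -> R) :
  grad_neq0 N Phi -> backlund xi N zeta G Phi -> forall p, N p -> pd3 Phi p != 0.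
Proof.
move=> gP BP p Np; have := gP p Np; have [] := BP p Np.
move: (pd1 Phi p) (pd2 Phi p) (pd3 Phi p) => a b c E1 E2.
apply: contra_neq => c0; move: E1 E2; rewrite c0 !mulr0 !addr0 => E1 E2.
by rewrite E2 mulr0 add0r in E1; rewrite E1 E2.
Qed.

(** The linear equations for [Phi] are rewritten through [Phi_1 = - ut_1 Phi_u] and
    [Phi_2 = - ut_2 Phi_u], and the nonzero factor [Phi_u] is cancelled. The last identity is the
    invariance of the graphs under [Q^zeta]. *)
Lemma hodograph_derive (U N T : set base) (xi zeta G Phi ut : base -> R) :
  smooth_on N Phi -> grad_neq0 N Phi -> backlund xi N zeta G Phi ->
  solves_last N Phi T ut -> forall t, T t ->
  [/\ pd3 ut t != 0, pd1 ut t = G (t.1, ut t) &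
      zeta (t.1, ut t) = xi (t.1, ut t) * pd1 ut t + pd2 ut t].
Proof.
move=> SP gP BP ST t Tt.
have [oT Sut HT] := ST; have [Nt _] := HT _ Tt.
have P3 := backlund_pd3_neq0 gP BP Nt; have [B1 B2] := BP _ Nt.
have [] := solves_last_derive SP ST Tt.
move: P3 B1 B2; move: (pd1 Phi _) (pd2 Phi _) (pd3 Phi _) (pd1 ut t) (pd2 ut t) (pd3 ut t).
move: (zeta _) (xi _) (G _) => z x g a b c u1 u2 u3 c0 B1 B2 E1 E2 E3.
have u1E : u1 = g.
  apply: (mulIf c0); have := etrans B2 (esym E1).
  by move/addrI => ->.
split=> //.
  by apply/eqP => u30; move: E3; rewrite u30 mul0r => /esym/eqP; rewrite oner_eq0.
apply: (mulIf c0).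
have aE : a = - (u1 * c) by apply/eqP; rewrite -addr_eq0 E1.
have bE : b = - (u2 * c) by apply/eqP; rewrite -addr_eq0 E2.
move: B1; rewrite aE bE => B1.
have -> : z * c = (x * - (u1 * c) + - (u2 * c) + z * c) + (x * u1 + u2) * c by ring.
by rewrite B1 add0r.
Qed.

Section Invariance.
Variables (r : nat) (Omega : set (jet R r)) (L : jet R r -> R) (r1 : (1 < r)%N).
Variables (U : set base) (xi zeta : base -> R) (V : set (base * R)) (lam : base * R -> R).
Hypotheses (oU : open U) (Sxi : smooth_on U xi) (Sz : smooth_on U zeta).
Hypothesis El : eliminated xi Omega L U zeta V lam.

(** Shared by both directions of the reduction. The open set [X] of points [x] is what allows the
    invariance condition to be differentiated, placing the jet of the slice on the manifold where
    [L] and [lam] agree. *)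
Lemma eliminated_on_invariant (f : base -> R) (T : set base) k (X : set (R * R)) :
  open T -> smooth_on T f -> open X -> (forall x, X x -> T (x, k)) ->
  (forall x, X x -> U (x, f (x, k)) /\
     zeta (x, f (x, k)) = xi (x, f (x, k)) * pd1 f (x, k) + pd2 f (x, k)) ->
  forall x, X x -> Omega (jet_of r (slice f k) x) ->
  V ((x, f (x, k)), pd1 f (x, k)) /\
  L (jet_of r (slice f k) x) = lam ((x, f (x, k)), pd1 f (x, k)).
Proof.
move=> oT Sf oX XT H x Xx Ox.
have Sg : smooth_on X (slice f k).
  by move=> n; apply: Cn_sub (slice_smooth k oT Sf n) => y /XT.
have D y : X y -> 'D_((1, 0) : R * R) (slice f k) y = pd1 f (y, k) /\
    'D_((0, 1) : R * R) (slice f k) y = pd2 f (y, k).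
  by move=> /XT Ty; apply: derive_slice; exact: Cn_differentiable (Sf 1%N) Ty.
have Q : Qman r (Qzeta xi U zeta) (jet_of r (slice f k) x).
  apply: (jet_of_Qman oX Sg oU Sxi Sz) => //; last exact: ltnW.
  by move=> y Xy; have [-> ->] := D y Xy; exact: H.
have [_ _ /(_ _ Ox Q)] := El.
rewrite jbase_jet_of ucoord_jet_of ?(ltnW r1) //=.
by have [-> _] := D x Xx.
Qed.

Lemma hodograph_solution (N T : set base) (G Phi ut : base -> R) (W : set (base * R)) :
  solved_for_u1 U V lam W G -> N `<=` U ->
  smooth_on N Phi -> grad_neq0 N Phi -> backlund xi N zeta G Phi ->
  solves_last N Phi T ut -> forall t, T t -> pd3 ut t != 0 /\
    (Omega (jet_of r (slice ut t.2) t.1) -> L (jet_of r (slice ut t.2) t.1) = 0).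
Proof.
move=> [_ _ SG WG WE] NU SP gP BP ST t Tt.
have HD := hodograph_derive U SP gP BP ST.
have [oT Sut HT] := ST.
split; first by have [] := HD t Tt.
move=> Ot; pose X := [set x : R * R | T (x, t.2)].
have Xt : X t.1 by rewrite /X /= -surjective_pairing.
have [||_ ->] := @eliminated_on_invariant ut T t.2 X oT Sut (slice_domain (k := t.2) oT) _ _ t.1 Xt Ot => //.
  move=> x Xx; have [Nx _] := HT _ Xx; split; first exact: NU.
  by have [] := HD _ Xx.
rewrite -surjective_pairing; have [_ E1 _] := HD t Tt.
have Ut : U (t.1, ut t) by apply: NU; have [] := HT _ Tt.
have [Wt _] := WG _ Ut.
by rewrite E1; apply/(WE _ _ Ut Wt).
Qed.

End Invariance.
End Backlund.

(** * From a family of solutions to the determining equation *)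

Section Converse.
Context {R : realType}.
Notation base := (base R).

(** By definition [Phi] satisfies [f (x, Phi (x, u)) = u]; the opposite composition needs
    injectivity of [f (x, .)] near [Phi p], given by [pd3 f != 0], and continuity of [Phi]. It
    ensures that [Phi] is constant along the slice through [p], so that slice is invariant under one
    and the same [Q^zeta]. *)
Lemma local_left_inverse (f Phi : base -> R) (T U : set base) (p : base) :
  open T -> smooth_on T f -> (forall t, T t -> pd3 f t != 0) ->
  open U -> solves_last T f U Phi -> U p ->
  exists2 d : R, 0 < d & forall x : R * R, ball p.1 d x ->
    [/\ T (x, Phi p), U (x, f (x, Phi p)) & Phi (x, f (x, Phi p)) = Phi p].
Proof.
move=> oT Sf f3 oU [_ SPhi HU] Up.
have [TP fP] := HU _ Up; set k := Phi p in TP fP *.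
have [d d0 dT] := ift_box oT Sf TP (f3 _ TP).
have mv := ift_mvt Sf (fun q H => (dT q H).1).
have inj x a b : `|x - p.1| < d -> `|a - k| < d -> `|b - k| < d ->
    f (x, a) = f (x, b) -> a = b.
  move=> xd ad bd /esym/eqP; rewrite -subr_eq0.
  have [c [cd _ ->]] := mv _ _ _ xd ad bd.
  have [Tc _] : T (x, c) /\ `|pd3 f (p.1, k) - pd3 f (x, c)| < `|pd3 f (p.1, k)| / 2.
    by apply: dT; rewrite prod_normE gt_max /= xd.
  by rewrite mulf_eq0 (negbTE (f3 _ Tc)) subr_eq0 => /eqP.
have pE : (p.1, f (p.1, k)) = p :> base by rewrite fP -surjective_pairing.
have cf : {for p.1, continuous (fun x : R * R => f (x, k))}.
  exact: (Cn_continuous (slice_smooth k oT Sf 0%N) TP).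
have ch : {for p.1, continuous (fun x : R * R => ((x, f (x, k)) : base))}.
  have c1 : {for p.1, continuous (fun x : R * R => x)} by exact: cvg_id.
  exact: cvg_pair c1 cf.
have cP : {for p.1, continuous (fun x : R * R => Phi (x, f (x, k)))}.
  by apply: continuous_comp ch _; rewrite pE; exact: (SPhi 0%N).
have [n1 n10 H1] := eps_continuous cP d0.
have oT' := slice_domain (k := k) oT.
have [n2 n20 H2] := near_norm (open_near oT' TP).
have NU : \forall x \near p.1, U (x, f (x, k)).
  by apply: ch; rewrite /= pE; exact: (open_near oU Up).
have [n3 n30 H3] := near_norm NU.
exists (Num.min (Num.min n1 n2) (Num.min n3 d)); first by rewrite !lt_min n10 n20 n30.
move=> x; rewrite -ball_normE /ball_ /= distrC !lt_min => /andP[/andP[x1 x2] /andP[x3 x4]].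
have := H1 _ x1; have := H2 _ x2; have := H3 _ x3; rewrite !subrK pE => Ux Tx Px.
split=> //; have [_ fx] := HU _ Ux.
apply: (inj x) => //; last by rewrite subrr normr0.
by rewrite distrC.
Qed.

(** Nonvanishing of the [u_1]-derivative isolates the branch: a second zero of [lam] over the same
    [(x, u)], close to the graph of [G], would contradict the mean value theorem on the segment
    joining it to the graph. *)
Lemma branch_exists (U : set base) (V : set (base * R)) (lam : base * R -> R) (G : base -> R) :
  open U -> open V -> smooth_on V lam -> smooth_on U G ->
  (forall p, U p -> [/\ V (p, G p), lam (p, G p) = 0 &
     'D_((0, 1) : base * R) lam (p, G p) != 0]) ->
  exists W : set (base * R), solved_for_u1 U V lam W G.
Proof.
move=> oU oV Sl SG HG.
(* The largest set on which zeros of [lam] over [U] lie on the graph of [G]; the work is to show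
   that the graph lies in its interior. *)
pose W0 := [set z : base * R | V z /\ (U z.1 -> lam z = 0 -> z.2 = G z.1)].
exists W0°; have WG p : U p -> W0° (p, G p).
  move=> Up; have [Vp lp Dp] := HG p Up.
  set e := (0, 1) : base * R in Dp; set P := (p, G p) : base * R in Vp lp Dp *.
  have e20 : 0 < `|'D_e lam P| / 2 by rewrite divr_gt0 // normr_gt0.
  have SD : smooth_on V ('D_e lam) by move=> n; have [_ D] := Sl n.+1; exact: D.
  have cD : {for P, continuous ('D_e lam)} by exact: (SD 0%N).
  have [d1 d10 H1] := eps_continuous cD e20.
  have [d2 d20 H2] := near_norm (open_near oV Vp).
  pose d := Num.min d1 d2; have d0 : 0 < d by rewrite lt_min d10.
  have BD z : ball P d z -> V z /\ 'D_e lam z != 0.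
    rewrite -ball_normE /ball_ /= distrC lt_min => /andP[z1 z2].
    have := H1 _ z1; have := H2 _ z2; rewrite subrK => Vz Dz; split=> //.
    have [Hz _] := half_away Dp Dz; rewrite -normr_gt0.
    exact: lt_le_trans e20 Hz.
  (* The foot [(q, G q)] must lie in the same ball as the given point, so that by convexity the
     whole segment between them does. *)
  have [n n0 Hn] := eps_continuous (SG 0%N p Up) d0.
  have [n' n'0 Hn'] := near_norm (open_near oU Up).
  suff NB : \forall z \near P, W0 z by exact: NB.
  apply: (norm_near (d := Num.min d n)); first by rewrite lt_min d0.
  move=> h; rewrite lt_min => /andP[hd hn].
  have Bz : ball P d (h + P).
    by rewrite -ball_normE /ball_ /= opprD addrCA subrr addr0 normrN.
  have [Vz _] := BD _ Bz; split=> // Uz lz.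
  have h1 : `|h.1| <= `|h| by rewrite [leRHS]prod_normE le_max lexx.
  pose q := (h + P).1; have BG : ball P d (q, G q).
    have := Hn _ (le_lt_trans h1 hn) => Gq.
    rewrite -ball_normE /ball_ /= prod_normE gt_max /= Gq andbT.
    by rewrite opprD addrCA subrr addr0 normrN (le_lt_trans h1).
  pose t := (h + P).2 - G q.
  have zE (s : R) : s *: (t *: e) + (q, G q) = (q, s * t + G q) :> base * R.
    rewrite -[LHS]/(s *: (t *: 0) + q, s * (t * 1) + G q) !scaler0 add0r mulr1.
    by [].
  have zz : t *: e + (q, G q) = h + P.
    have := zE 1; rewrite scale1r mul1r => ->; rewrite /t subrK.
    by rewrite [RHS]surjective_pairing.
  have Bs (s : R) : 0 <= s <= 1 -> ball P d (s *: (t *: e) + (q, G q)).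
    by move=> s01; apply: ball_convex => //; rewrite zz.
  have dl (z : base * R) : V z -> differentiable lam z.
    exact: Cn_differentiable (Sl 1%N).
  have [s s01|s s01] := @line_mvt _ _ lam (q, G q) (t *: e).
    by apply: diff_derivable; apply: dl; have [] := BD _ (Bs s s01).
  have [_ lq _] := HG q Uz.
  rewrite zz lz lq subrr; have [Vs Ds] := BD _ (Bs s s01).
  rewrite (deriveZv _ _ (dl _ Vs)) => /esym/eqP.
  by rewrite mulf_eq0 (negbTE Ds) orbF subr_eq0 => /eqP.
split=> //.
- exact: open_interior.
- by move=> z /interior_subset [].
- by move=> p Up; split; [exact: WG|have [] := HG p Up].
- move=> p q Up /interior_subset [_ Hq]; split; first exact: Hq.
  by move=> ->; have [] := HG p Up.
Qed.

End Converse.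

Section Family.
Context {R : realType}.
Notation base := (base R).
Variables (T : set base) (f : base -> R) (U : set base) (Phi : base -> R).
Variables (Xi : set base) (xi : base -> R).
Hypotheses (oT : open T) (Sf : smooth_on T f) (f3 : forall t, T t -> pd3 f t != 0).
Hypothesis ST : solves_last T f U Phi.
Hypotheses (Sxi : smooth_on Xi xi) (UXi : U `<=` Xi).

Let zeta p := - (xi p * pd1 Phi p + pd2 Phi p) / pd3 Phi p.
Let G p := pd1 f (p.1, Phi p).
Let H p := pd2 f (p.1, Phi p).

Let oU : open U. Proof. by case: ST. Qed.
Let SPhi : smooth_on U Phi. Proof. by case: ST. Qed.
Let TU p : U p -> T (p.1, Phi p). Proof. by case: ST => _ _ HU /HU[]. Qed.
Let fU p : U p -> f (p.1, Phi p) = p.2. Proof. by case: ST => _ _ HU /HU[]. Qed.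
Let SxiU : smooth_on U xi. Proof. by move=> n; exact: Cn_sub UXi (Sxi n). Qed.

Let Sgraph (g : base -> R) : smooth_on T g -> smooth_on U (fun p => g (p.1, Phi p)).
Proof. by move=> Sg n; exact: Cn_graph oU (SPhi n) (Sg n) TU. Qed.

(** All four follow from differentiating [f (x, Phi (x, u)) = u], whose [u]-derivative shows that
    [Phi_u] and [f_kappa] are mutually inverse. *)
Lemma family_relations p : U p ->
  [/\ pd3 Phi p != 0, pd1 Phi p = - (G p * pd3 Phi p), pd2 Phi p = - (H p * pd3 Phi p) &
      zeta p = xi p * G p + H p].
Proof.
move=> Up; have [] := solves_last_derive Sf ST Up.
rewrite /zeta /G /H; move: (pd1 Phi p) (pd2 Phi p) (pd3 Phi p) (pd1 f _) (pd2 f _) (pd3 f _).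
move=> P1 P2 P3 a b c E1 E2 E3.
have P30 : P3 != 0.
  by apply/eqP => P30; move: E3; rewrite P30 mul0r => /esym/eqP; rewrite oner_eq0.
have E1' : P1 = - (a * P3).
  by have -> : a = - (P1 * c) by [apply/eqP; rewrite -addr_eq0 E1]; rewrite mulNr opprK -mulrA (mulrC c) E3 mulr1.
have E2' : P2 = - (b * P3).
  by have -> : b = - (P2 * c) by [apply/eqP; rewrite -addr_eq0 E2]; rewrite mulNr opprK -mulrA (mulrC c) E3 mulr1.
by split=> //; rewrite E1' E2'; field.
Qed.

Lemma family_zeta_smooth : smooth_on U zeta.
Proof.
have P30 p : U p -> pd3 Phi p != 0 by case/family_relations.
move=> n; have S1 := smooth_derive ((1, 0, 0) : base) SPhi n.
have S2 := smooth_derive ((0, 1, 0) : base) SPhi n.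
have S3 := smooth_derive ((0, 0, 1) : base) SPhi n.
exact: CnM oU (CnN oU (CnD oU (CnM oU (SxiU n) S1) S2)) (CnV oU P30 S3).
Qed.

Lemma family_determining : determining_eq xi U zeta G.
Proof.
move=> p Up.
have dif (g : base -> R) (V : set base) q : smooth_on V g -> V q -> differentiable g q.
  by move=> Sg Vq; exact: Cn_differentiable (Sg 1%N) Vq.
have Sf1 : smooth_on T (pd1 f) by exact: smooth_derive.
have Sf2 : smooth_on T (pd2 f) by exact: smooth_derive.
have dP := dif _ _ _ SPhi Up; have Tp := TU Up.
have DG v : 'D_v G p = _ := derive_graph v dP (dif _ _ _ Sf1 Tp).
have DH v : 'D_v H p = _ := derive_graph v dP (dif _ _ _ Sf2 Tp).
have dG := dif _ _ _ (Sgraph Sf1) Up; have dH := dif _ _ _ (Sgraph Sf2) Up.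
have dxi := dif _ _ _ SxiU Up.
have Dz v : 'D_v zeta p = xi p * 'D_v G p + G p * 'D_v xi p + 'D_v H p.
  rewrite -(deriveMp v dxi dG) -(deriveDp v (differentiableMp dxi dG) dH).
  apply: near_eq_derive; apply: (open_near_eq oU Up) => q Uq.
  by have [_ _ _] := family_relations Uq.
have f12 : pd1 (pd2 f) (p.1, Phi p) = pd2 (pd1 f) (p.1, Phi p).
  exact: schwarz oT Tp (Sf 2%N).
have [_ E1 E2 zE] := family_relations Up.
have Dz1 : pd1 zeta p = xi p * pd1 G p + G p * pd1 xi p + pd1 H p := Dz _.
have Dz3 : pd3 zeta p = xi p * pd3 G p + G p * pd3 xi p + pd3 H p := Dz _.
have e1E (x y z : R) : 1 * x + 0 * y + z = x + z by rewrite mul1r mul0r addr0.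
have e2E (x y z : R) : 0 * x + 1 * y + z = y + z by rewrite mul1r mul0r add0r.
have e3E (x y z : R) : 0 * x + 0 * y + z = z by rewrite !mul0r !add0r.
have G2 : pd2 G p = pd2 (pd1 f) (p.1, Phi p) + pd2 Phi p * pd3 (pd1 f) (p.1, Phi p).
  exact (etrans (DG (0, 1, 0)) (e2E _ _ _)).
have G3 : pd3 G p = pd3 Phi p * pd3 (pd1 f) (p.1, Phi p).
  exact (etrans (DG (0, 0, 1)) (e3E _ _ _)).
have H1 : pd1 H p = pd2 (pd1 f) (p.1, Phi p) + pd1 Phi p * pd3 (pd2 f) (p.1, Phi p).
  by rewrite -f12; exact (etrans (DH (1, 0, 0)) (e1E _ _ _)).
have H3 : pd3 H p = pd3 Phi p * pd3 (pd2 f) (p.1, Phi p).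
  exact (etrans (DH (0, 0, 1)) (e3E _ _ _)).
(* With [a] the common value of the two mixed derivatives of [f], the determining equation is a
   polynomial identity in the derivatives at the point. *)
have key (z z1 z3 x x1 x3 g g1 g2 g3 h h1 h3 P1 P2 P3 a b c : R) :
    z1 = x * g1 + g * x1 + h1 -> z3 = x * g3 + g * x3 + h3 -> z = x * g + h ->
    g2 = a + P2 * b -> g3 = P3 * b -> h1 = a + P1 * c -> h3 = P3 * c ->
    P1 = - (g * P3) -> P2 = - (h * P3) ->
    z1 + z3 * g - (x1 + x3 * g) * g = x * g1 + g2 + z * g3.
  by move=> -> -> -> -> -> -> -> -> ->; ring.
exact (key _ _ _ _ _ _ _ _ _ _ _ _ _ _ _ _ _ _ _ Dz1 Dz3 zE G2 G3 H1 H3 E1 E2).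
Qed.

Section Solution.
Variables (r : nat) (Omega : set (jet R r)) (L : jet R r -> R) (r1 : (1 < r)%N).
Variables (V : set (base * R)) (lam : base * R -> R).
Hypothesis El : eliminated xi Omega L U zeta V lam.
Hypothesis fL : forall t, T t ->
  Omega (jet_of r (slice f t.2) t.1) /\ L (jet_of r (slice f t.2) t.1) = 0.

(** The slice with parameter [Phi p] passes through [p], and by [local_left_inverse] it is invariant
    over a ball around [p.1]; so [lam] at this point equals [L] on a solution. *)
Lemma family_on_branch p : U p -> V (p, G p) /\ lam (p, G p) = 0.
Proof.
move=> Up; have Tp := TU Up.
have [d d0 Hd] := local_left_inverse oT Sf f3 oU ST Up.
have [Op Lp] := fL Tp.
have Bp : ball p.1 d p.1 by exact: ballxx.
have XT x : ball p.1 d x -> T (x, Phi p) by case/Hd.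
have XH x : ball p.1 d x -> U (x, f (x, Phi p)) /\ zeta (x, f (x, Phi p)) =
    xi (x, f (x, Phi p)) * pd1 f (x, Phi p) + pd2 f (x, Phi p).
  move=> /Hd[_ Ux Px]; split=> //.
  by have [_ _ _ ->] := family_relations Ux; rewrite /G /H /= Px.
have [] := eliminated_on_invariant r1 oU SxiU family_zeta_smooth El oT Sf (ball_open p.1 d) XT XH Bp Op.
by rewrite Lp fU // -surjective_pairing => Vp <-.
Qed.

Lemma family_branch :
  (forall p, U p -> 'D_((0, 1) : base * R) lam (p, pd1 f (p.1, Phi p)) != 0) ->
  exists W : set (base * R), solved_for_u1 U V lam W G.
Proof.
move=> Hlam; have [oV Sl _] := El.
apply: branch_exists => //; first by apply: Sgraph; exact: smooth_derive.
by move=> p Up; have [H1 H2] := family_on_branch Up; split=> //; exact: Hlam.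
Qed.

End Solution.
End Family.

Theorem corollary14 (R : realType) (r : nat) (hr : (1 < r)%N)
    (Omega : set (jet R r)) (L : jet R r -> R)
    (hL : diff_fun_of_order Omega L)
    (Xi : set (base R)) (xi : base R -> R)
    (hXi : open Xi) (hxi : smooth_on Xi xi)
    (hS : first_coorder_singular Omega L (reduced_family xi Xi)) :
  [/\ (* elimination *)
      forall (U : set (base R)) (zeta : base R -> R),
        open U -> U `<=` Xi -> smooth_on U zeta ->
        exists (V : set (base R * R)) (lam : base R * R -> R),
          eliminated xi Omega L U zeta V lam,
      (* (a) *)
      forall (U : set (base R)) (zeta : base R -> R)
             (V : set (base R * R)) (lam : base R * R -> R)
             (W : set (base R * R)) (G : base R -> R),
        open U -> U `<=` Xi -> smooth_on U zeta ->
        eliminated xi Omega L U zeta V lam ->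
        solved_for_u1 U V lam W G ->
        determining_eq xi U zeta G ->
        (forall p, U p -> exists (N : set (base R)) (Phi : base R -> R),
           [/\ open N, N p, N `<=` U &
               [/\ smooth_on N Phi, grad_neq0 N Phi &
                   backlund xi N zeta G Phi]]) /\
        (forall (N : set (base R)) (Phi : base R -> R),
           open N -> N `<=` U -> smooth_on N Phi -> grad_neq0 N Phi ->
           backlund xi N zeta G Phi ->
           [/\ forall p, N p -> pd3 Phi p != 0,
               forall p, N p -> exists (T : set (base R)) (ut : base R -> R),
                 [/\ solves_last N Phi T ut, T (p.1, Phi p) &
                     ut (p.1, Phi p) = p.2] &
               forall (T : set (base R)) (ut : base R -> R),
                 solves_last N Phi T ut ->
                 forall t, T t ->
                   pd3 ut t != 0 /\
                   (Omega (jet_of r (slice ut t.2) t.1) ->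
                    L (jet_of r (slice ut t.2) t.1) = 0)]) &
      (* (b) *)
      forall (T : set (base R)) (f : base R -> R),
        open T -> smooth_on T f ->
        (forall t, T t -> pd3 f t != 0) ->
        (forall t, T t -> Omega (jet_of r (slice f t.2) t.1) /\
                          L (jet_of r (slice f t.2) t.1) = 0) ->
        (forall t, T t -> Xi (t.1, f t) ->
           exists (U : set (base R)) (Phi : base R -> R),
           [/\ solves_last T f U Phi, U `<=` Xi, U (t.1, f t) &
               Phi (t.1, f t) = t.2]) /\
        (forall (U : set (base R)) (Phi : base R -> R),
           solves_last T f U Phi -> U `<=` Xi ->
           let zeta := fun p => - (xi p * pd1 Phi p + pd2 Phi p) / pd3 Phi p in
           [/\ forall p, U p -> pd3 Phi p != 0,
               smooth_on U zeta &
               forall (V : set (base R * R)) (lam : base R * R -> R),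
                 eliminated xi Omega L U zeta V lam ->
                 (forall p, U p ->
                    'D_((0, 1) : base R * R) lam (p, pd1 f (p.1, Phi p)) != 0) ->
                 exists (W : set (base R * R)) (G : base R -> R),
                   [/\ solved_for_u1 U V lam W G,
                       forall p, U p -> W (p, pd1 f (p.1, Phi p)) &
                       determining_eq xi U zeta G]])].
Proof.
have r0 : (0 < r)%N by exact: ltnW.
have SxiU (U : set (base R)) : U `<=` Xi -> smooth_on U xi.
  by move=> UX n; exact: Cn_sub UX (hxi n).
split.
- move=> U zeta oU UX Sz; exact: (elimination r0 hxi hS oU UX Sz).
- move=> U zeta V lam W G oU UX Sz El SW DE; split.
    move=> p Up; have [_ _ SG _ _] := SW.
    exact: backlund_solvable oU (SxiU _ UX) Sz SG DE Up.
  move=> N Phi oN NU SPhi gP BP; split.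
  + exact: backlund_pd3_neq0 gP BP.
  + move=> p Np; exact: local_solution oN SPhi Np (backlund_pd3_neq0 gP BP Np).
  + move=> T ut ST t Tt.
    exact: (hodograph_solution hr oU (SxiU _ UX) Sz El SW NU SPhi gP BP ST Tt).
- move=> T f oT Sf f3 fL; split.
    move=> t Tt Xt; have [U [Phi [[oU SPhi HU] Ut Pt]]] := local_solution oT Sf Tt (f3 _ Tt).
    exists (U `&` Xi), Phi; split; [|exact: subIsetr|by split|exact: Pt].
    split; first exact: openI.
      by move=> n; apply: Cn_sub (SPhi n); exact: subIsetl.
    by move=> q [Uq _]; exact: HU.
  move=> U Phi ST UX zeta; split.
  + by move=> p Up; have [] := family_relations xi Sf ST Up.
  + exact: family_zeta_smooth Sf ST hxi UX.
  + move=> V lam El Hlam.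
    have [W SW] := family_branch oT Sf f3 ST hxi UX hr El fL Hlam.
    exists W, (fun p => pd1 f (p.1, Phi p)); split=> //.
      by move=> p Up; have [_ _ _ WG _] := SW; have [] := WG p Up.
    exact: family_determining oT Sf ST hxi UX.
Qed.
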